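(* Let $\alpha\ge1-3\gamma$. For every $(\nu,w)\in\mathrm{CE}_T$ of finite action it holds $$J(\nu):=E(\nu_T)-E(\nu_0)+\frac12\int_0^TD(\nu_t)\,dt+\frac12\int_0^TA(\nu_t,w_t)\,dt\ \ge\ 0 .$$ Moreover, equality holds if and only if $\nu_t$ is a (weak) solution to the LSW equation $$\partial_t\nu_t+\partial_\lambda\big(\lambda^\alpha(u(t)-q\lambda^{-\gamma})\nu_t\big)=0,\qquad u(t)=\frac{q\int\lambda^{\alpha-\gamma}d\nu_t}{\int\lambda^\alpha d\nu_t},$$ understood in the sense of distributions on $(0,T)\times\mathbb{R}_+$.
   Context: Fix $\alpha\in[0,1)$, $\gamma\in(0,1)$, $q>0$, $\bar\varrho>0$, $T>0$, $\mathbb{R}_+=(0,\infty)$. $M:=\{\nu\in C_c^0(\mathbb{R}_+)^*\text{ nonnegative}:\int\lambda\,d\nu=\bar\varrho\}$. $\mathrm{CE}_T$ is the set of pairs $(\nu,w)$ with $[0,T]\ni t\mapsto\nu_t\in M$ weakly$^*$ continuous and $w_t(\lambda)$ measurable, solving $\partial_t\nu_t+\partial_\lambda(\lambda^\alpha w_t\nu_t)=0$ in the sense of distributions on $(0,T)\times\mathbb{R}_+$. A cotangent vector $w\in T^*_\nu M$ is a function $w:\mathbb{R}_+\to\mathbb{R}$ such that $s:=-\partial_\lambda(\lambda^\alpha w\nu)$ satisfies $\int\lambda s\,d\lambda=0$, i.e. $\int\lambda^\alpha w\,d\nu=0$. Energy: $E(\nu):=\frac{q}{1-\gamma}\int\lambda^{1-\gamma}d\nu$.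 Action: $A(\nu,w):=\int\lambda^\alpha|w|^2d\nu$. Dissipation: $D(\nu):=\int\lambda^\alpha|u(\nu)-q\lambda^{-\gamma}|^2d\nu$ with $u(\nu):=q\int\lambda^{\alpha-\gamma}d\nu\big/\int\lambda^\alpha d\nu$ (equivalently, $D(\nu)$ is the infimum over constants $u\in\mathbb{R}$ of $\int\lambda^\alpha|u-q\lambda^{-\gamma}|^2d\nu\in[0,\infty]$). $(\nu,w)\in\mathrm{CE}_T$ has *finite action* if $w_t\in T^*_{\nu_t}M$ for a.e. $t$, $\int_0^TA(\nu_t,w_t)\,dt<\infty$, and $\sup_{t\in[0,T]}E(\nu_t)<\infty$. *)

(* Defs.v *)
From HB Require Import structures.
From mathcomp Require Import all_boot all_order all_algebra.
From mathcomp Require Import all_classical all_reals all_analysis.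

Set Implicit Arguments.
Unset Strict Implicit.
Unset Printing Implicit Defensive.
Import Order.TTheory GRing.Theory Num.Theory.
Import numFieldNormedType.Exports.
Local Open Scope classical_set_scope.
Local Open Scope ring_scope.

(* Nonnegative elements of the dual of C_c(0, +oo) are Radon measures on
   (0, +oo) (Riesz). They are represented by Borel measures on R that do not
   charge (-oo, 0]; local finiteness on (0, +oo) is automatic once the first
   moment is finite, hence is not repeated in [in_M]. *)
Notation Rmeasure R := {measure set (measurableTypeR R) -> \bar R}.
Notation lebesgue R := (@lebesgue_measure R).

Definition in_M (R : realType) (rho : R) (nu : Rmeasure R) : Prop :=
  nu [set` `]-oo, 0]] = 0%E /\
  (\int[nu]_(l in `]0%R, +oo[) l%:E = rho%:E)%E.

Definition Cc_pos (R : realType) (phi : R -> R) : Prop :=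
  continuous phi /\
  exists K : set R, [/\ compact K, K `<=` `]0, +oo[ &
    forall l, ~ K l -> phi l = 0].

Definition weakstar_continuous (R : realType) (T : R) (nu : R -> Rmeasure R) :
  Prop :=
  forall phi : R -> R, Cc_pos phi ->
  {within `[0, T], continuous
     (fun t => \int[nu t]_(l in `]0, +oo[) phi l : R)}.

Definition partial_t (R : realType) (phi : R * R -> R) : R * R -> R :=
  fun p => derive1 (fun s => phi (s, p.2)) p.1.

Definition partial_l (R : realType) (phi : R * R -> R) : R * R -> R :=
  fun p => derive1 (fun l => phi (p.1, l)) p.2.

Fixpoint Ck (R : realType) (k : nat) (phi : R * R -> R) : Prop :=
  if k is k'.+1 then
    [/\ continuous phi,
        (forall p, derivable (fun s => phi (s, p.2)) p.1 1),
        (forall p, derivable (fun l => phi (p.1, l)) p.2 1),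
        Ck k' (partial_t phi) & Ck k' (partial_l phi)]
  else continuous phi.

Definition spacetime (R : realType) (T : R) : set (R * R) :=
  `]0, T[ `*` `]0, +oo[.

Definition test_function (R : realType) (T : R) (phi : R * R -> R) : Prop :=
  (forall k, Ck k phi) /\
  exists K : set (R * R), [/\ compact K, K `<=` spacetime T &
    forall p, ~ K p -> phi p = 0].

(* d_t nu_t + d_l (l^alpha v_t nu_t) = 0 in the sense of distributions on
   (0, T) x (0, +oo). The first clause says that l^alpha v_t nu_t dt is a
   locally finite (signed) measure, so that it is a distribution at all. *)
Definition continuity_equation (R : realType) (alpha T : R)
    (nu : R -> Rmeasure R) (v : R -> R -> R) : Prop :=
  (forall K : set (R * R), compact K -> K `<=` spacetime T ->
    (\int[lebesgue R]_(t in `]0%R, T[) \int[nu t]_(l in xsection K t)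
       `|l `^ alpha * v t l|%:E < +oo)%E) /\
  (forall phi : R * R -> R, test_function T phi ->
    (\int[lebesgue R]_(t in `]0%R, T[) \int[nu t]_(l in `]0%R, +oo[)
       (partial_t phi (t, l) + l `^ alpha * v t l * partial_l phi (t, l))%:E
     = 0)%E).

Definition CE (R : realType) (alpha rho T : R)
    (nu : R -> Rmeasure R) (w : R -> R -> R) : Prop :=
  [/\ forall t, t \in `[0, T] -> in_M rho (nu t),
      weakstar_continuous T nu,
      measurable_fun (`[0, T] `*` `]0, +oo[ :
          set (measurableTypeR R * measurableTypeR R))
        (fun p => w p.1 p.2) &
      continuity_equation alpha T nu w].

Definition cotangent (R : realType) (alpha : R) (nu : Rmeasure R)
    (w : R -> R) : Prop :=
  nu.-integrable `]0, +oo[ (fun l => (l `^ alpha * w l)%:E) /\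
  (\int[nu]_(l in `]0%R, +oo[) (l `^ alpha * w l)%:E = 0)%E.

Definition energy (R : realType) (gamma q : R) (nu : Rmeasure R) : \bar R :=
  ((q / (1 - gamma))%:E * \int[nu]_(l in `]0%R, +oo[) (l `^ (1 - gamma))%:E)%E.

Definition action (R : realType) (alpha : R) (nu : Rmeasure R) (w : R -> R) :
  \bar R :=
  (\int[nu]_(l in `]0%R, +oo[) (l `^ alpha * `|w l| ^+ 2)%:E)%E.

Definition moment (R : realType) (p : R) (nu : Rmeasure R) : \bar R :=
  (\int[nu]_(l in `]0%R, +oo[) (l `^ p)%:E)%E.

(* [fine] sends +oo to 0, so [mean_field] is a junk value when one of the two
   moments is infinite. For nu in M this is harmless in [dissipation]: then
   \int l^(alpha - 2 gamma) = +oo near l = 0, so the integral below is +oo for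
   every real value of u, in agreement with the infimum over u. *)
Definition mean_field (R : realType) (alpha gamma q : R) (nu : Rmeasure R) : R :=
  q * fine (moment (alpha - gamma) nu) / fine (moment alpha nu).

Definition dissipation (R : realType) (alpha gamma q : R) (nu : Rmeasure R) :
  \bar R :=
  (\int[nu]_(l in `]0%R, +oo[)
     (l `^ alpha * `|mean_field alpha gamma q nu - q * l `^ (- gamma)| ^+ 2)%:E)%E.

Definition finite_action (R : realType) (alpha gamma q T : R)
    (nu : R -> Rmeasure R) (w : R -> R -> R) : Prop :=
  [/\ {ae lebesgue R, forall t, t \in `[0, T] -> cotangent alpha (nu t) (w t)},
      (\int[lebesgue R]_(t in `[0%R, T]) action alpha (nu t) (w t) < +oo)%E &
      (ereal_sup [set energy gamma q (nu t) | t in `[0%R, T]] < +oo)%E].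

Definition J (R : realType) (alpha gamma q T : R)
    (nu : R -> Rmeasure R) (w : R -> R -> R) : \bar R :=
  (energy gamma q (nu T) - energy gamma q (nu 0%R)
   + 2^-1%:E * \int[lebesgue R]_(t in `[0%R, T]) dissipation alpha gamma q (nu t)
   + 2^-1%:E * \int[lebesgue R]_(t in `[0%R, T]) action alpha (nu t) (w t))%E.

(* The equation presupposes that the velocity exists: for a.e. t both moments
   in u(t) are finite, so that [mean_field] is the genuine quotient. *)
Definition LSW_solution (R : realType) (alpha gamma q T : R)
    (nu : R -> Rmeasure R) : Prop :=
  {ae lebesgue R, forall t, t \in `[0, T] ->
     (moment alpha (nu t) < +oo)%E /\ (moment (alpha - gamma) (nu t) < +oo)%E} /\
  continuity_equation alpha T nu
    (fun t l => mean_field alpha gamma q (nu t) - q * l `^ (- gamma)).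

(* Main.v *)
From HB Require Import structures.
Require Import Defs.
From mathcomp Require Import all_boot all_order all_algebra.
From mathcomp Require Import all_classical all_reals all_analysis.
From mathcomp Require Import measurable_realfun ring lra.

(* With v = u - q l^(-gamma), the chain rule
     E(nu_T) - E(nu_0) = - \int_0^T \int l^alpha w v dnu_t dt
   turns J into (1/2) \int_0^T \int l^alpha |w - v|^2 dnu_t dt when the total
   dissipation is finite (otherwise J = +oo). So J >= 0, with equality iff w = v
   almost everywhere.

   The function l^(1-gamma) is too singular at 0 to be tested against directly.
   Testing with smooth approximations of (l - a)^+, a > 0, gives
     \int (l - a)^+ dnu_T - \int (l - a)^+ dnu_0
       = \int_0^T \int_(l > a) l^alpha w dnu_t dt,
   where the right side is finite by the action bound. Since the first moment is
   conserved, this is a statement about min(l, a), and l^(1-gamma) / (1-gamma) is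
   the superposition of min(l, x^(-1/gamma)) over x > 0. As \int l^alpha w dnu_t
   vanishes, the indicator of {x <= u / q} can be subtracted before integrating
   in x; this makes Fubini legitimate, because l^alpha |w| |l^(-gamma) - u / q| is
   integrable by Cauchy-Schwarz between action and dissipation.

   Conversely, if nu also solves the equation with velocity v, comparing the two
   fluxes through (a, +oo) for all rational a yields w = v almost everywhere. *)

Set Implicit Arguments.
Unset Strict Implicit.
Unset Printing Implicit Defensive.
Import Order.TTheory GRing.Theory Num.Theory.
Import numFieldNormedType.Exports.
Local Open Scope classical_set_scope.
Local Open Scope ring_scope.

(** The family nu_t is only weak* continuous in t. Measurability of t |-> nu_t(V) is recovered from
    rays (a, +oo), whose mass is a limit of integrals of continuous tents. Together with the common
    first moment [rho], this makes nu an s-finite kernel, and every space-time integral is an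
    iterated integral against it. Rays also fit M as test sets: their mass is bounded through the
    first moment, while the mass near 0 may be infinite. Finite dissipation bounds the two moments
    in u(t) only at almost every t, with constants that depend on u(t). Hence the two terms of v are
    never integrated separately in time; they stay together in l^(-gamma) - u / q. In the converse
    direction l^alpha v is only locally integrable in space-time. The fluxes are therefore compared
    through compactly supported test functions, and the passage to a ray happens at fixed t. Each
    test function has its own null set of exceptional times, which is why only countably many rays
    may be used. Test functions are infinitely differentiable, so all cutoffs descend from
    exp(-1/x). *)

(** * Smooth functions of one variable and a smooth ramp *)

Section smooth_functions.
Context {R : realType}.
Implicit Types (f g : R -> R) (p : {poly R}).

(** The recursion mirrors [Ck], so that products eta(t) psi(l) become test functions by a single
    induction on k. *)
Fixpoint Ck1 (k : nat) (f : R -> R) : Prop :=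
  if k is k'.+1 then (forall x, derivable f x 1) /\ Ck1 k' (derive1 f)
  else continuous f.

Definition smooth f := forall k, Ck1 k f.

Lemma derivable_cont f : (forall x, derivable f x 1) -> continuous f.
Proof. by move=> df x; apply/differentiable_continuous/derivable1_diffP. Qed.

Lemma Ck1_continuous k f : Ck1 k f -> continuous f.
Proof. by case: k => // k [/derivable_cont]. Qed.

Lemma Ck1W k f : Ck1 k.+1 f -> Ck1 k f.
Proof.
elim: k f => [f [/derivable_cont//]|k IH f [df h]]; split => //; exact: IH.
Qed.

Lemma Ck1D k f g : Ck1 k f -> Ck1 k g -> Ck1 k (f \+ g).
Proof.
elim: k f g => [f g cf cg x|k IH f g [df cf] [dg cg]]; first by apply: cvgD; [exact: cf|exact: cg].
split=> [x|]; first exact: derivableD.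
rewrite (_ : derive1 _ = (derive1 f) \+ (derive1 g)); first exact: IH.
by apply/funext => x; rewrite derive1E deriveD//= !derive1E.
Qed.

Lemma Ck1M k f g : Ck1 k f -> Ck1 k g -> Ck1 k (f \* g).
Proof.
elim: k f g => [f g cf cg x|k IH f g fk gk]; first by apply: cvgM; [exact: cf|exact: cg].
have [df cf] := fk; have [dg cg] := gk.
split=> [x|]; first exact: derivableM.
rewrite (_ : derive1 _ = (f \* (derive1 g)) \+ ((derive1 f) \* g)).
  apply: Ck1D; apply: IH => //; exact: Ck1W.
apply/funext => x; rewrite derive1E deriveM//= !derive1E.
by rewrite /GRing.scale/= [X in _ + X]mulrC.
Qed.

Lemma smooth_derivable f : smooth f -> forall x, derivable f x 1.
Proof. by move=> /(_ 1%N) []. Qed.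

Lemma smooth_derive f : smooth f -> smooth (derive1 f).
Proof. by move=> sf k; have [] := sf k.+1. Qed.

Lemma smooth_continuous f : smooth f -> continuous f.
Proof. by move=> /(_ 0%N). Qed.

Lemma smoothD f g : smooth f -> smooth g -> smooth (f \+ g).
Proof. by move=> sf sg k; exact: Ck1D. Qed.

Lemma smoothM f g : smooth f -> smooth g -> smooth (f \* g).
Proof. by move=> sf sg k; exact: Ck1M. Qed.

Lemma is_derive_affine a b (x : R) : is_derive x 1 (fun y => a * y + b) a.
Proof.
have -> : (fun y => a * y + b) = a \*: (@id R) + cst b by [].
apply: is_derive_eq.
by rewrite addr0 /GRing.scale/= mulr1.
Qed.

Lemma is_derive_comp_affine f a b (x : R) : derivable f (a * x + b) 1 ->
  is_derive x 1 (fun y => f (a * y + b)) (a * (derive1 f) (a * x + b)).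
Proof.
move=> df; have h := is_derive_affine a b x.
have {}df : is_derive (a * x + b) 1 f ((derive1 f) (a * x + b)).
  by rewrite derive1E; exact/derivableP.
have := @is_derive1_comp _ f (fun y => a * y + b) x _ _ df h.
by move=> H; apply: is_derive_eq; rewrite mulrC.
Qed.

Lemma Ck1_comp_affine k f a b : Ck1 k f -> Ck1 k (fun y => f (a * y + b)).
Proof.
elim: k f => [f cf x|k IH f [df cf]].
  apply: (@continuous_comp _ _ _ (fun y => a * y + b) f); last exact: cf.
  apply: derivable_cont => y.
  by have [] := is_derive_affine a b y.
split=> [x|]; first by have [] := @is_derive_comp_affine f a b x (df _).
rewrite (_ : derive1 _ = cst a \* (fun y => (derive1 f) (a * y + b))).
  apply: Ck1M; last exact: IH.
  elim: k {cf IH} a => [a x|k IH c]; first exact: cvg_cst.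
  split => [//|]; rewrite (_ : derive1 _ = cst 0) //.
  by apply/funext => x; rewrite derive1E derive_cst.
apply/funext => x; rewrite derive1E /=.
by have [_ ->] := @is_derive_comp_affine f a b x (df _).
Qed.

Lemma smooth_comp_affine f a b : smooth f -> smooth (fun y => f (a * y + b)).
Proof. by move=> sf k; exact: Ck1_comp_affine. Qed.

Lemma smooth_cst (c : R) : smooth (cst c).
Proof.
move=> k; elim: k c => [c x|k IH c]; first exact: cvg_cst.
split => [//|]; rewrite (_ : derive1 _ = cst 0) //.
by apply/funext => x; rewrite derive1E derive_cst.
Qed.

Lemma smooth_primitive f g : (forall x : R, is_derive x 1 f (g x)) -> smooth g ->
  smooth f.
Proof.
move=> dfg sg [|k].
  by apply: derivable_cont => x; have [] := dfg x.
split=> [x|]; first by have [] := dfg x.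
rewrite (_ : derive1 _ = g)//; apply/funext => x; rewrite derive1E.
by have [_ ->] := dfg x.
Qed.

(* This family is closed under derivation: (flat p)' = flat (X^2 (p - p')). *)
Definition flat p (x : R) : R :=
  if 0 < x then p.[x^-1] * expR (- x^-1) else 0.

(** Each monomial satisfies y^i exp(-y) <= i!, because the exponential series dominates its term of
    degree i. This explains the factorial weights in the constant. *)
Lemma horner_expRN_bounded p : exists2 C : R, 0 <= C &
  forall y : R, 0 <= y -> `|p.[y] * expR (- y)| <= C.
Proof.
exists (\sum_(i < size p) `|p`_i| * i`!%:R).
  by apply: sumr_ge0 => i _; rewrite mulr_ge0.
move=> y y0; rewrite horner_coef mulr_suml.
apply: (le_trans (ler_norm_sum _ _ _)); apply: ler_sum => i _.
rewrite -mulrA normrM ler_wpM2l// ger0_norm ?mulr_ge0 ?exprn_ge0 ?expR_ge0//.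
rewrite expRN ler_pdivrMr ?expR_gt0//.
have fi : (0 < i`!%:R :> R) by rewrite ltr0n fact_gt0.
rewrite mulrC -ler_pdivrMr//.
case: (nat_of_ord i) => [|n]; last first.
  by apply: le_trans (expR_ge1Dxn n y0); rewrite lerDr.
by rewrite expr0 fact0 divr1; apply: le_trans (expR_ge1Dx y); rewrite lerDl.
Qed.

Lemma flat_le0 p x : x <= 0 -> flat p x = 0.
Proof. by move=> x0; rewrite /flat ltNge x0. Qed.

Lemma is_derive_flat p (x : R) :
  is_derive x 1 (flat p) (flat ('X^2 * (p - deriv p)) x).
Proof.
case: (ltgtP 0 x) => x0.
- pose g y : R := p.[y^-1] * expR (- y^-1).
  have dg : is_derive x 1 g (flat ('X^2 * (p - deriv p)) x).
    have xn0 : x != 0 by rewrite gt_eqF.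
    have dV : is_derive x 1 (fun y : R => y^-1) (- x ^- 2).
      have h : is_derive x 1 (fun y : R => y) 1 by exact: is_derive_id.
      have := is_deriveV xn0 h.
      by move=> {}h; apply: is_derive_eq; rewrite /GRing.scale/= mulr1.
    have dp : is_derive x 1 (fun y : R => p.[y^-1]) ((deriv p).[x^-1] * - x ^- 2).
      exact: (is_derive1_comp (f := horner p) (g := fun y : R => y^-1)).
    have de : is_derive x 1 (fun y : R => expR (- y^-1)) (expR (- x^-1) * x ^- 2).
      apply: (is_derive1_comp (f := expR) (g := fun y : R => - y^-1)).
      by apply: is_derive_eq; rewrite opprK.
    apply: is_derive_eq.
    rewrite /flat x0 /= hornerM hornerD hornerN hornerXn -exprVn /GRing.scale/=.
    ring.
  apply: (near_eq_is_derive _ dg).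
  near=> y; rewrite /flat /g ifT//; near: y.
  exact: lt_nbhsr.
- rewrite (flat_le0 _ (ltW x0)).
  apply: (near_eq_is_derive (f := cst 0)).
  near=> y; rewrite flat_le0//; apply: ltW; near: y.
  exact: lt_nbhsl.
- rewrite -x0 (flat_le0 _ (lexx 0)).
  (* Bounding y^2 p(y) exp(-y) at y = 1/x gives |flat p x| <= C x^2, so the difference quotient at 0
     tends to 0. *)
  have [C C0 hC] := horner_expRN_bounded ('X^2 * p).
  suff h : (h^-1 *: ((flat p \o shift 0) (h *: 1) - flat p 0)) @[h --> (0:R)^'] --> (0:R).
    by apply: DeriveDef; [apply/cvg_ex; exists 0|apply/cvg_lim].
  have hle y : `|flat p y| <= C * y ^+ 2.
    rewrite /flat; case: ifPn => y0; last by rewrite normr0 mulr_ge0 ?sqr_ge0.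
    have := hC y^-1; rewrite invr_ge0 => /(_ (ltW y0)).
    rewrite hornerM hornerXn exprVn -mulrA normrM ger0_norm ?invr_ge0 ?sqr_ge0//.
    by rewrite mulrC ler_pdivrMr ?exprn_gt0.
  have small (e : R) : 0 < e -> \forall h \near (0 : R)^', `|h| <= e.
    by move=> e0; exact: dnbhs0_le.
  apply/cvgr0Pnorm_le => e e0.
  have C1 : 0 < C + 1 by rewrite ltr_wpDl.
  apply: (filterS _ (small _ (divr_gt0 e0 C1))) => h.
  rewrite ler_pdivlMr// => he.
  rewrite /= (flat_le0 _ (lexx 0)) subr0 addr0 [h%:A]/GRing.scale/= mulr1 normrZ normfV.
  have [->|hn0] := eqVneq h 0; first by rewrite normr0 invr0 mul0r ltW.
  rewrite ler_pdivrMl ?normr_gt0//; apply: (le_trans (hle h)).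
  rewrite -[_ ^+ 2]ger0_norm ?sqr_ge0// normrX expr2 mulrCA ler_wpM2l//.
  by apply: le_trans he; rewrite mulrC ler_wpM2l// lerDl.
Unshelve. all: by end_near. Qed.

Lemma smooth_flat p : smooth (flat p).
Proof.
move=> k; elim: k p => [p|k IH p].
  by apply: derivable_cont => x; have [] := is_derive_flat p x.
split=> [x|]; first by have [] := is_derive_flat p x.
rewrite (_ : derive1 _ = flat ('X^2 * (p - deriv p)))//.
apply/funext => x; rewrite derive1E.
by have [_ ->] := is_derive_flat p x.
Qed.

(** The classical bump exp(-1/x) exp(-1/(1 - x)) on (0, 1), extended by zero. *)
Definition bump0 (x : R) : R := flat 1 x * flat 1 (1 - x).

Lemma flat1_ge0 x : 0 <= flat 1 x.
Proof. by rewrite /flat; case: ifP => // _; rewrite hornerC mul1r expR_ge0. Qed.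

Lemma flat1_gt0 x : 0 < x -> 0 < flat 1 x.
Proof. by move=> x0; rewrite /flat x0 hornerC mul1r expR_gt0. Qed.

Lemma bump0_ge0 x : 0 <= bump0 x.
Proof. by rewrite mulr_ge0// flat1_ge0. Qed.

Lemma smooth_bump0 : smooth bump0.
Proof.
apply: smoothM; first exact: smooth_flat.
rewrite (_ : (fun x => _) = fun x => flat 1 (-1 * x + 1)).
  exact/smooth_comp_affine/smooth_flat.
by apply/funext => x; rewrite mulN1r addrC.
Qed.

Lemma bump0_le0 x : x <= 0 -> bump0 x = 0.
Proof. by move=> x0; rewrite /bump0 flat_le0 ?mul0r. Qed.

Lemma bump0_ge1 x : 1 <= x -> bump0 x = 0.
Proof. by move=> x0; rewrite /bump0 mulrC flat_le0 ?mul0r// subr_le0. Qed.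

Lemma primitive_exists g : continuous g -> (forall x : R, x <= 0 -> g x = 0) ->
  exists2 F : R -> R, (forall x : R, is_derive x 1 F (g x)) &
    (forall x : R, x <= 0 -> F x = 0).
Proof.
move=> cg g0.
(* The base point -1 lies strictly to the left of 0, so the fundamental theorem, which holds at
   interior points, covers x = 0 as well. The vanishing of [g] on the left makes the choice
   harmless. *)
pose F (x : R) : R := \int[@lebesgue_measure R]_(t in `[-1, x]) g t.
have F0 (x : R) : x <= 0 -> F x = 0.
  move=> x0; rewrite /F /Rintegral integral0_eq// => t.
  by rewrite /= in_itv/= => /andP[_ tx]; rewrite g0// (le_trans tx).
exists F => // x; case: (ltP x 0) => x0.
  rewrite g0 ?ltW//; apply: (near_eq_is_derive (f := cst 0)).
  near=> y; rewrite F0//; apply: ltW; near: y; exact: lt_nbhsl.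
have x1 : -1 < x by rewrite (lt_le_trans _ x0)// ltrN10.
have [] := @continuous_FTC1_closed R g (-1) x (x + 1) _ _ x1 (cg x).
- by rewrite ltrDl.
- apply: continuous_compact_integrable; first exact: segment_compact.
  by apply: continuous_subspaceT => y; exact: cg.
- move=> dF dFE; apply: DeriveDef; first exact: dF.
  by rewrite -derive1E.
Unshelve. all: by end_near. Qed.

Lemma is_derive_nondecreasing f g : (forall x : R, is_derive x 1 f (g x)) ->
  (forall x, 0 <= g x) -> forall x y, x <= y -> f x <= f y.
Proof.
move=> df g0 x y; rewrite le_eqVlt => /predU1P[->//|xy].
have [|c _ /eqP] := @MVT R f g _ _ xy (fun z _ => df z).
  apply: continuous_subspaceT => z.
  by apply: derivable_cont => {}z; have [] := df z.
by rewrite subr_eq => /eqP ->; rewrite lerDr mulr_ge0// subr_ge0 ltW.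
Qed.

Lemma is_derive_eq_itv f g (a b : R) : (forall x : R, is_derive x 1 f (g x)) ->
  a <= b -> (forall x, a < x < b -> g x = 0) -> f a = f b.
Proof.
move=> df; rewrite le_eqVlt => /predU1P[->//|ab] g0.
have [|c] := @MVT R f g _ _ ab (fun z _ => df z).
  apply: continuous_subspaceT => z.
  by apply: derivable_cont => {}z; have [] := df z.
by rewrite in_itv/= => /g0 ->; rewrite mul0r => /eqP; rewrite subr_eq0 => /eqP.
Qed.

(** [P] is a rounded positive part, [B] its slope, a smooth step on [0, 1], and [b] the slope of
    [B]. Time cutoffs are built from [B], space cutoffs from [P]. The delay [c] caused by the
    rounding is later cancelled or scaled away. *)
Lemma smooth_ramp : exists P B b : R -> R, exists c : R,
  [/\ (forall x : R, is_derive x 1 P (B x)) /\ smooth B,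
      (forall x : R, is_derive x 1 B (b x)) /\ (forall x, 0 <= b x),
      forall x : R, 0 <= B x <= 1,
      (forall x : R, x <= 0 -> [/\ P x = 0, B x = 0 & b x = 0]) &
      (forall x : R, 1 <= x -> [/\ P x = x - c, B x = 1 & b x = 0])].
Proof.
have [B0 dB0 B00] := primitive_exists (smooth_continuous smooth_bump0) bump0_le0.
have Bmono := is_derive_nondecreasing dB0 bump0_ge0.
pose Z := B0 1.
(* If [Z] were 0, the nondecreasing [B0] would vanish on [0, 1], against the positive value of the
   bump at 1/2. *)
have Z0 : 0 < Z.
  rewrite lt_def -{2}(B00 0 (lexx 0)) Bmono// andbT; apply/negP => /eqP Z0.
  have B0E x : 0 <= x <= 1 -> B0 x = 0.
    move=> /andP[x0 x1]; apply/eqP; rewrite eq_le -{1}Z0 Bmono//=.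
    by rewrite -(B00 0 (lexx 0)) Bmono.
  have : derive1 B0 2^-1 = 0.
    have h : is_derive (2^-1 : R) 1 B0 0.
      apply: (near_eq_is_derive (f := cst 0)).
      near=> y; rewrite B0E//; apply/andP; split.
        by apply: ltW; near: y; apply: lt_nbhsr; rewrite invr_gt0.
      by apply: ltW; near: y; apply: lt_nbhsl; rewrite invf_lt1// ltr1n.
    by rewrite derive1E; have [_ ->] := h.
  rewrite derive1E; have [_ ->] := dB0 2^-1 => /eqP.
  suff b0 : 0 < bump0 2^-1 by rewrite gt_eqF.
  apply: mulr_gt0; apply: flat1_gt0; first by rewrite invr_gt0.
  by rewrite subr_gt0 invf_lt1// ltr1n.
pose B x := Z^-1 * B0 x; pose b x := Z^-1 * bump0 x.
have dB (x : R) : is_derive x 1 B (b x).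
  by have := is_deriveZ Z^-1 (dB0 x).
have b0 x : 0 <= b x by rewrite mulr_ge0 ?bump0_ge0// invr_ge0 ltW.
have BS : smooth B.
  apply: (smooth_primitive dB).
  by apply: (smoothM (smooth_cst _)); exact: smooth_bump0.
have Bge1 x : 1 <= x -> B x = 1.
  move=> x1; rewrite -(is_derive_eq_itv dB x1).
    by rewrite /B mulVf// gt_eqF.
  by move=> y /andP[y1 _]; rewrite /b bump0_ge1 ?mulr0// ltW.
have Ble0 x : x <= 0 -> B x = 0 by move=> x0; rewrite /B B00// mulr0.
have {}Bmono := is_derive_nondecreasing dB b0.
have [P dP P0] := primitive_exists (smooth_continuous BS) Ble0.
exists P, B, b, (1 - P 1); split => //.
- move=> x; apply/andP; split.
    by case: (leP x 0) => x0; [rewrite Ble0|rewrite -(Ble0 0)// Bmono// ltW].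
  by case: (leP 1 x) => x0; [rewrite Bge1|rewrite -(Bge1 1)// Bmono// ltW].
- by move=> x x0; rewrite P0// Ble0// /b bump0_le0// mulr0.
- move=> x x1; split; [|exact: Bge1|by rewrite /b bump0_ge1// mulr0].
  have dQ (y : R) : is_derive y 1 (P - id) (B y - 1) by exact: is_deriveB.
  have := is_derive_eq_itv dQ x1.
  rewrite !fctE => h; rewrite -[LHS](subrK x) -h.
    by ring.
  by move=> y /andP[y1 _]; rewrite Bge1 ?subrr// ltW.
Unshelve. all: by end_near. Qed.

End smooth_functions.

(** * Iterated integrals against an s-finite kernel *)

Section kernel_iterated_integrals.
Local Open Scope ereal_scope.
Context d (X : measurableType d) d' (Y : measurableType d') (R : realType).
Variables (K : R.-sfker X ~> Y) (m : {measure set X -> \bar R}).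
Variables (A : set X) (D : set Y).
Implicit Types f g : X * Y -> \bar R.
Hypotheses (mA : measurable A) (mD : measurable D).

Lemma measurable_fun_kernel_ge0 f : (forall z, 0 <= f z) ->
  measurable_fun [set: X * Y] f -> measurable_fun setT (fun t => \int[K t]_(l in D) f (t, l)).
Proof.
move=> f0 mf.
pose g := f \_ ([set: X] `*` D).
have mg : measurable_fun [set: X * Y] g.
  apply/(measurable_restrictT _ _).1; first exact: measurableX.
  exact: measurable_funTS.
rewrite (_ : (fun t => _) = fun t => \int[K t]_l g (t, l)); last first.
  apply/funext => t; rewrite integral_mkcond; apply: eq_integral => l _.
  rewrite /g !patchE; congr (if _ then _ else _).
  by apply/idP/idP; rewrite !inE/=; [split|case].
apply: measurable_fun_integral_sfinite_kernel => // z.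
by rewrite /g patchE; case: ifPn.
Qed.

Lemma measurable_fun_kernel f :
  measurable_fun [set: X * Y] f -> measurable_fun setT (fun t => \int[K t]_(l in D) f (t, l)).
Proof.
move=> mf; rewrite (_ : (fun t => _) = fun t =>
  \int[K t]_(l in D) f^\+ (t, l) - \int[K t]_(l in D) f^\- (t, l)); last first.
  apply/funext => t; rewrite [LHS]integralE; congr (_ - _); apply: eq_integral => l _;
    by rewrite ?funeposE ?funenegE.
apply: emeasurable_funB; apply: measurable_fun_kernel_ge0 => //.
  exact: measurable_funepos.
exact: measurable_funeneg.
Qed.

Lemma measurable_fun_section f t : measurable_fun [set: X * Y] f ->
  measurable_fun D (fun l => f (t, l)).
Proof.
by move=> mf; apply: measurable_funTS; exact: measurableT_comp.
Qed.

Lemma iter_integrable f : measurable_fun [set: X * Y] f ->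
  \int[m]_(t in A) \int[K t]_(l in D) `|f (t, l)| < +oo ->
  m.-integrable A (fun t => \int[K t]_(l in D) f (t, l)) /\
  {ae m, forall t, A t -> (K t).-integrable D (fun l => f (t, l))}.
Proof.
move=> mf foo.
have mabs : measurable_fun setT (fun t => \int[K t]_(l in D) `|f (t, l)|).
  by apply: (measurable_fun_kernel_ge0 (f := abse \o f)); [by move=> z; exact: abse_ge0|exact: measurableT_comp].
have h0 t : 0 <= \int[K t]_(l in D) `|f (t, l)| by exact: integral_ge0.
have iabs : m.-integrable A (fun t => \int[K t]_(l in D) `|f (t, l)|).
  apply/integrableP; split; first exact: measurable_funTS.
  by under eq_integral => t _ do rewrite gee0_abs//.
split.
  apply: (le_integrable mA _ _ iabs).
    by apply: measurable_funTS; exact: measurable_fun_kernel.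
  move=> t At; rewrite [leRHS]gee0_abs//.
  by apply: le_abse_integral => //; exact: measurable_fun_section.
apply: filterS (integrable_ae mA iabs) => t /[apply] h.
apply/integrableP; split; first exact: measurable_fun_section.
by rewrite ltey_eq h.
Qed.

Lemma iter_integralD f g : measurable_fun [set: X * Y] f -> measurable_fun [set: X * Y] g ->
  \int[m]_(t in A) \int[K t]_(l in D) `|f (t, l)| < +oo ->
  \int[m]_(t in A) \int[K t]_(l in D) `|g (t, l)| < +oo ->
  \int[m]_(t in A) \int[K t]_(l in D) (f (t, l) + g (t, l)) =
  \int[m]_(t in A) \int[K t]_(l in D) f (t, l) +
  \int[m]_(t in A) \int[K t]_(l in D) g (t, l).
Proof.
move=> mf mg /(iter_integrable mf)[if1 if2] /(iter_integrable mg)[ig1 ig2].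
rewrite -integralD//; apply: ae_eq_integral => //.
- apply: measurable_funTS; apply: (measurable_fun_kernel (f := f \+ g)).
  exact: emeasurable_funD.
- by apply: measurable_funTS; apply: emeasurable_funD; exact: measurable_fun_kernel.
- apply: filterS2 if2 ig2 => t h1 h2 At.
  by rewrite integralD//; [exact: h1|exact: h2].
Qed.

Lemma le_iter_integral f g : measurable_fun [set: X * Y] f -> measurable_fun [set: X * Y] g ->
  (forall t l, A t -> D l -> 0 <= f (t, l) <= g (t, l)) ->
  \int[m]_(t in A) \int[K t]_(l in D) f (t, l) <=
  \int[m]_(t in A) \int[K t]_(l in D) g (t, l).
Proof.
move=> mf mg fg; apply: ge0_le_integral => //.
- move=> t At; apply: integral_ge0 => l Dl; by have /andP[] := fg t l At Dl.
- by apply: measurable_funTS; exact: measurable_fun_kernel.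
- by apply: measurable_funTS; exact: measurable_fun_kernel.
- move=> t At; apply: ge0_le_integral => //.
  + by move=> l Dl; have /andP[] := fg t l At Dl.
  + exact: measurable_fun_section.
  + exact: measurable_fun_section.
  + by move=> l Dl; have /andP[] := fg t l At Dl.
Qed.

(** Dominated convergence is used twice: inside for almost every t, namely where g(t, .) is
    integrable, and then outside with the inner integral of g as the bound. *)
Lemma iter_dominated_convergence (f_ : nat -> X * Y -> \bar R) f g :
  (forall n, measurable_fun [set: X * Y] (f_ n)) -> measurable_fun [set: X * Y] f ->
  measurable_fun [set: X * Y] g ->
  (forall t l, A t -> D l -> f_ n (t, l) @[n --> \oo] --> f (t, l)) ->
  (forall n t l, A t -> D l -> `|f_ n (t, l)| <= g (t, l)) ->
  \int[m]_(t in A) \int[K t]_(l in D) g (t, l) < +oo ->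
  \int[m]_(t in A) \int[K t]_(l in D) f_ n (t, l) @[n --> \oo] -->
  \int[m]_(t in A) \int[K t]_(l in D) f (t, l).
Proof.
move=> mf_ mf mg ff fg goo.
have g0 t l : A t -> D l -> 0 <= g (t, l).
  by move=> At Dl; apply: le_trans (fg 0%N t l At Dl).
have [ig1 ig2] : m.-integrable A (fun t => \int[K t]_(l in D) g (t, l)) /\
  {ae m, forall t, A t -> (K t).-integrable D (fun l => g (t, l))}.
  apply: iter_integrable => //.
  rewrite (_ : integral _ _ _ = \int[m]_(t in A) \int[K t]_(l in D) g (t, l))//.
  apply: eq_integral => t /[!inE] At; apply: eq_integral => l /[!inE] Dl.
  by rewrite gee0_abs// g0.
have [//|||//| |_ _] := @dominated_convergence _ _ _ m A mA
  (fun n t => \int[K t]_(l in D) f_ n (t, l))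
  (fun t => \int[K t]_(l in D) f (t, l)) (fun t => \int[K t]_(l in D) g (t, l)).
- by move=> n; apply: measurable_funTS; exact: measurable_fun_kernel.
- by apply: measurable_funTS; exact: measurable_fun_kernel.
- apply: filterS ig2 => t ig At.
  have [//|||//| |_ _] := @dominated_convergence _ _ _ (K t) D mD
    (fun n l => f_ n (t, l)) (fun l => f (t, l)) (fun l => g (t, l)).
  + by move=> n; exact: measurable_fun_section.
  + exact: measurable_fun_section.
  + by apply: aeW => l; exact: ff.
  + exact: ig.
  + by apply: aeW => l n; exact: fg.
  + exact.
- apply: aeW => t n At.
  apply: (le_trans (le_abse_integral _ mD _)); first exact: measurable_fun_section.
  apply: ge0_le_integral => //.
  + by apply: measurableT_comp => //; exact: measurable_fun_section.
  + exact: measurable_fun_section.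
  + by move=> l Dl; exact: fg.
- exact.
Qed.

Lemma iter_integralZl (r : R) f : measurable_fun [set: X * Y] f ->
  (\int[m]_(t in A) \int[K t]_(l in D) `|f (t, l)| < +oo) ->
  (\int[m]_(t in A) \int[K t]_(l in D) `|r%:E * f (t, l)| < +oo) /\
  (\int[m]_(t in A) \int[K t]_(l in D) (r%:E * f (t, l)) =
   r%:E * \int[m]_(t in A) \int[K t]_(l in D) f (t, l)).
Proof.
move=> mf flty; have [if1 if2] := iter_integrable mf flty.
have mabs : measurable_fun [set: X * Y] (abse \o f) by exact: measurableT_comp.
split.
  under eq_integral => t _.
    under eq_integral do rewrite abseM.
    rewrite ge0_integralZl//; last first.
      exact: (measurable_fun_section _ mabs).
    over.
  rewrite ge0_integralZl//; last first.
  - by move=> t _; exact: integral_ge0.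
  - apply: measurable_funTS; exact: (measurable_fun_kernel mabs).
  by rewrite lte_mul_pinfty.
rewrite -integralZl//; apply: ae_eq_integral => //.
- apply: measurable_funTS; apply: (measurable_fun_kernel (f := fun p => r%:E * f p)).
  exact: emeasurable_funM.
- apply: emeasurable_funM => //; apply: measurable_funTS; exact: measurable_fun_kernel.
- by apply: filterS if2 => t h At; rewrite integralZl//; exact: h.
Qed.

End kernel_iterated_integrals.

(** * Tail bounds, sigma-finiteness and kernels in M *)

Section measures_in_M.
Local Open Scope ereal_scope.
Context {R : realType}.
Implicit Types (rho : R) (nu : Rmeasure R).

(** Markov's inequality for the first moment. *)
Lemma in_M_tail rho nu (a : R) : in_M rho nu -> (0 < a)%R ->
  nu `]a, +oo[%classic <= (a^-1 * rho)%:E.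
Proof.
move=> [_ Mrho] a0.
suff : a%:E * nu `]a, +oo[%classic <= rho%:E.
  by rewrite EFinM lee_pdivlMl.
rewrite -Mrho -integral_cst//.
apply: (@le_trans _ _ (\int[nu]_(x in `]a, +oo[) x%:E)).
  apply: ge0_le_integral => //=.
  - by move=> x _; rewrite lee_fin ltW.
  - by move=> x; rewrite in_itv/= andbT lee_fin => /ltW.
apply: ge0_subset_integral => //=.
- by move=> x; rewrite in_itv/= andbT lee_fin => /ltW.
- by apply: subset_itvr; rewrite bnd_simp ltW.
Qed.

Lemma in_M_tail_lty rho nu (a : R) (U : set (measurableTypeR R)) : in_M rho nu -> (0 < a)%R ->
  measurable U -> nu (U `&` `]a, +oo[%classic) < +oo.
Proof.
move=> Mnu a0 mU; apply: (le_lt_trans _ (ltry (a^-1 * rho))).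
apply: le_trans (in_M_tail Mnu a0).
by apply: le_measure; rewrite ?inE//; exact: measurableI.
Qed.

Let E n : set (measurableTypeR R) := `](n.+1%:R^-1)%R, +oo[%classic.

Let E_nd : nondecreasing_seq E.
Proof.
move=> m n mn; rewrite subsetEset; apply: subset_itvr.
by rewrite bnd_simp lef_pV2 ?posrE ?ltr0n// ler_nat.
Qed.

Let bigcupE : \bigcup_n E n = `]0%R, +oo[%classic.
Proof.
apply/seteqP; split => x.
  by move=> [n _]; rewrite /E /= !in_itv/= !andbT; apply: lt_trans; rewrite invr_gt0.
rewrite /= in_itv/= andbT => x0.
have [n nx] := ltr_add_invr x0.
by exists n => //; rewrite /E/= in_itv/= andbT -[X in (X < _)%R]add0r.
Qed.

Let bigcupG : \bigcup_n (`]-oo, 0%R]%classic `|` E n) = setT.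
Proof.
apply/seteqP; split => // x _; have [x0|x0] := leP x 0%R.
  by exists 0%N => //; left; rewrite /= in_itv.
have : (\bigcup_n E n) x by rewrite bigcupE /= in_itv/= x0.
by move=> [n _ Enx]; exists n => //; right.
Qed.

Let mE n : measurable (E n). Proof. exact: measurable_itv. Qed.

Let mN : measurable (`]-oo, 0%R]%classic : set (measurableTypeR R)).
Proof. exact: measurable_itv. Qed.

Let mG0 n : measurable (`]-oo, 0%R]%classic `|` E n : set (measurableTypeR R)).
Proof. exact: measurableU. Qed.

Let Epos n : (0 < n.+1%:R^-1 :> R)%R. Proof. by rewrite invr_gt0. Qed.

Lemma in_M_null rho nu (U : set (measurableTypeR R)) : in_M rho nu -> measurable U ->
  nu (U `&` `]-oo, 0%R]%classic) = 0.
Proof.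
move=> [nu0 _] mU; apply/eqP; rewrite -measure_le0 -nu0.
by apply: le_measure; rewrite ?inE//; exact: measurableI.
Qed.

Lemma in_M_pos rho nu (U : set (measurableTypeR R)) : in_M rho nu -> measurable U ->
  nu U = nu (U `&` `]0%R, +oo[%classic).
Proof.
move=> Mnu mU; rewrite [LHS](measureDI _ mU (measurable_itv `]0%R, +oo[)).
rewrite [X in X + _](_ : _ = 0) ?add0e// -(in_M_null Mnu mU) setDE.
by rewrite setCitvr.
Qed.

Lemma in_M_sigma_finite rho nu : in_M rho nu -> sigma_finite setT nu.
Proof.
(* The tails cover only (0, +oo); the half-line ]-oo, 0], which is null, is added to each of them to
   exhaust R. *)
move=> Mnu; exists (fun n => `]-oo, 0%R]%classic `|` E n).
  by rewrite bigcupG.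
move=> n; split; first exact: mG0.
rewrite (in_M_pos Mnu); last exact: mG0.
apply: (le_lt_trans _ (in_M_tail_lty Mnu (Epos n) measurableT)).
rewrite setTI; apply: le_measure; rewrite ?inE//.
  by apply: measurableI; [exact: mG0|exact: measurable_itv].
move=> x [[|//]]; rewrite /= !in_itv/= andbT => x0 /(le_lt_trans x0).
by rewrite ltxx.
Qed.

Context d (X : measurableType d) (rho : R) (nu : X -> Rmeasure R).
Hypothesis Mnu : forall x, in_M rho (nu x).

Lemma cvg_tail x (U : set (measurableTypeR R)) : measurable U ->
  nu x (U `&` E n) @[n --> \oo] --> nu x U.
Proof.
move=> mU; rewrite (in_M_pos (Mnu x) mU) -bigcupE setI_bigcupr.
apply: (nondecreasing_cvg_mu (F := fun n => U `&` E n)).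
- by move=> n; exact: measurableI.
- by apply: bigcup_measurable => n _; exact: measurableI.
- by move=> m n mn; rewrite subsetEset; apply: setIS; exact/subsetPset/E_nd.
Qed.

(** A pi-lambda argument leads from rays to Borel sets. It is run on the traces on [E n], where the
    measures are finite and complements can be subtracted; letting n tend to infinity removes the
    truncation. *)
Lemma measurable_fun_in_M :
  (forall a : R, (0 < a)%R -> measurable_fun setT (fun x => nu x `]a, +oo[%classic)) ->
  forall U : set (measurableTypeR R), measurable U ->
  measurable_fun setT (fun x => nu x U).
Proof.
move=> mray U mU.
apply: (emeasurable_fun_cvg (fun n x => nu x (U `&` E n))) => [n|x _]; last first.
  exact: cvg_tail.
have mEn : measurable_fun setT (fun x => nu x (E n)) by exact: mray.
move: U mU; rewrite RGenOInfty.measurableE => U sU.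
pose P := [set U : set (measurableTypeR R) | measurable_fun setT (fun x => nu x (U `&` E n))].
change (P U); move: U sU; apply: dynkin_induction.
- exact: RGenOInfty.measurableE.
- move=> _ _ [x ->] [y ->]; exists (Num.max x y)%R.
  by rewrite /= predeqE => z /=; rewrite !in_itv/= !andbT gt_max; split => /andP.
- by rewrite /P/= setTI.
- move=> _ [y ->]; rewrite /P/=.
  rewrite (_ : _ `&` _ = `](Num.max y n.+1%:R^-1)%R, +oo[%classic); last first.
    by rewrite /E predeqE => z /=; rewrite !in_itv/= !andbT gt_max; split => /andP.
  by apply: mray; rewrite lt_max Epos orbT.
- move=> S mS PS; rewrite /P/=.
  rewrite (_ : (fun _ => _) = fun x => nu x (E n) - nu x (S `&` E n)).
    exact: emeasurable_funB.
  apply/funext => x; rewrite setIC -setDE setIC measureD//.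
  have := in_M_tail_lty (Mnu x) (Epos n) measurableT; rewrite setTI; exact.
- move=> F mF tF PF; rewrite /P/=.
  rewrite (_ : (fun _ => _) = fun x => \sum_(k <oo | k \in setT) nu x (F k `&` E n)).
    by apply: ge0_emeasurable_sum => // k _; exact: PF.
  apply/funext => x; rewrite setI_bigcupl measure_bigcup//.
  - by move=> i _; exact: measurableI.
  - exact: trivIset_setIr.
Qed.

Hypothesis mnu : forall U : set (measurableTypeR R), measurable U ->
  measurable_fun setT (fun x => nu x U).

(** Restriction to the disjointed truncations gives finite kernels. Their masses are bounded
    uniformly in x by the tail estimate, since all the measures share the first moment [rho]. *)
Lemma in_M_sfkernel : exists K : R.-sfker X ~> measurableTypeR R, K = nu :> (X -> Rmeasure R).
Proof.
pose G n : set (measurableTypeR R) := `]-oo, 0%R]%classic `|` E n.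
have mG n : measurable (G n) by exact: mG0.
have mD n : measurable (seqDU G n) by exact: seqDU_measurable.
pose s n (x : X) : Rmeasure R := mrestr (nu x) (mD n).
have ms n : isKernel _ _ X (measurableTypeR R) R (s n).
  by split => U mU; apply: mnu; exact: measurableI.
pose sk n : R.-ker X ~> measurableTypeR R := HB.pack (s n) (ms n).
have K1 : isKernel _ _ X (measurableTypeR R) R nu by split.
have K2 : isSFiniteKernel_subdef _ _ X (measurableTypeR R) R nu.
  split; exists sk.
    (* The tail bound (n + 1) rho, enlarged by 1 because finite kernels ask for a strict bound. *)
    move=> n; exists (n.+1%:R^-1^-1 * rho + 1)%R => x.
    rewrite /= /s /mrestr /= setTI.
    rewrite (in_M_pos (Mnu x))//.
    apply: (@le_lt_trans _ _ (n.+1%:R^-1^-1 * rho)%:E); last first.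
      by rewrite lte_fin ltrDl.
    apply: le_trans (in_M_tail (Mnu x) (Epos n)).
    apply: le_measure; rewrite ?inE//; first exact: measurableI.
    move=> y [sy]; have [|//] := @subset_seqDU _ G n y sy.
    by rewrite /= !in_itv/= andbT => y0 /(le_lt_trans y0); rewrite ltxx.
  move=> x U mU; rewrite /kseries/= /mseries /= /s/= /mrestr/=.
  rewrite -[in LHS](setIT U) (_ : setT = \bigcup_n seqDU G n).
    rewrite setI_bigcupr measure_bigcup//=.
    - by apply: eq_eseriesl => i; rewrite in_setT.
    - by move=> i _; exact: measurableI.
    - exact/trivIset_setIl/trivIset_seqDU.
  by rewrite -seqDU_bigcup_eq bigcupG.
pose K : R.-sfker X ~> measurableTypeR R := HB.pack nu K1 K2.
by exists K.
Qed.

End measures_in_M.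

(** * Test functions in product form *)

Section product_test_functions.
Context {R : realType}.
Implicit Types eta psi : R -> R.

Definition tensor eta psi (p : R * R) : R := eta p.1 * psi p.2.

Lemma partial_t_tensor eta psi : (forall x, derivable eta x 1) ->
  partial_t (tensor eta psi) = tensor (derive1 eta) psi.
Proof.
move=> de; apply/funext => -[t l]; rewrite /partial_t /tensor/=.
by rewrite -derive1Mr//; apply: de.
Qed.

Lemma partial_l_tensor eta psi : (forall x, derivable psi x 1) ->
  partial_l (tensor eta psi) = tensor eta (derive1 psi).
Proof.
move=> de; apply/funext => -[t l]; rewrite /partial_l /tensor/=.
by rewrite -derive1Ml//; apply: de.
Qed.

Lemma tensor_continuous eta psi : continuous eta -> continuous psi ->
  continuous (tensor eta psi).
Proof.
move=> ce cp p; apply: cvgM.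
  by apply: (@continuous_comp _ _ _ fst eta); [exact: cvg_fst|exact: ce].
by apply: (@continuous_comp _ _ _ snd psi); [exact: cvg_snd|exact: cp].
Qed.

(** Both partial derivatives of a product are again products, which closes the induction. *)
Lemma Ck_tensor k eta psi : Ck1 k eta -> Ck1 k psi -> Ck k (tensor eta psi).
Proof.
elim: k eta psi => [eta psi|k IH eta psi ke kp]; first exact: tensor_continuous.
have [de ke'] := ke; have [dp kp'] := kp.
split.
- by apply: tensor_continuous; exact: Ck1_continuous ke || exact: Ck1_continuous kp.
- by move=> p; exact: (derivableM (g := cst (psi p.2)) (de p.1) (derivable_cst _ _ _)).
- by move=> p; exact: (derivableM (f := cst (eta p.1)) (derivable_cst _ _ _) (dp p.2)).
- by rewrite partial_t_tensor//; apply: IH => //; exact: Ck1W.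
- by rewrite partial_l_tensor//; apply: IH => //; exact: Ck1W.
Qed.

Lemma test_function_tensor (T s1 s2 a b : R) eta psi : smooth eta -> smooth psi ->
  0 < s1 -> s2 < T -> 0 < a ->
  (forall t, t \notin `[s1, s2] -> eta t = 0) ->
  (forall l, l \notin `[a, b] -> psi l = 0) ->
  test_function T (tensor eta psi).
Proof.
move=> se sp s10 s2T a0 eta0 psi0; split; first by move=> k; exact: Ck_tensor.
exists (`[s1, s2]%classic `*` `[a, b]%classic); split.
- by apply: compact_setX; exact: segment_compact.
- move=> [t l] [] /=; rewrite !in_itv/= => /andP[s1t ts2] /andP[al lb].
  by rewrite /spacetime; split; rewrite /= in_itv/= ?(lt_le_trans _ s1t) ?(le_lt_trans ts2)// (lt_le_trans _ al).
- move=> [t l] /= /not_andP[] /= /negP h; rewrite /tensor/=.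
    by rewrite eta0 ?mul0r.
  by rewrite psi0 ?mulr0.
Qed.

End product_test_functions.

(** * Measurability in time from weak* continuity *)

Section weakstar_measurability.
Context {R : realType} (rho : R) (nu : R -> Rmeasure R).
Hypothesis Mnu : forall t, in_M rho (nu t).
Hypothesis cnu : forall phi : R -> R, Cc_pos phi ->
  continuous (fun t => \int[nu t]_(l in `]0, +oo[) phi l : R).

(** Continuous, supported in [a, n], with values in [0, 1], and converging pointwise to the
    indicator of (a, +oo). *)
Let tent (a : R) (n : nat) (l : R) : R :=
  Num.max 0 (Num.min (Num.min 1 (n%:R * (l - a))) (n%:R - l)).

Let tent_continuous a n : continuous (tent a n).
Proof.
move=> l.
have c0 (c : R) : {for l, continuous (fun _ : R => c : R^o)} by exact: cvg_cst.
apply: (continuous_max (f := fun _ => 0)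
  (g := (fun l => Num.min 1 (n%:R * (l - a))) \min (fun l => n%:R - l))) => //.
apply: (continuous_min (f := fun l => Num.min 1 (n%:R * (l - a)))).
  apply: (continuous_min (f := fun=> 1)) => //.
  by apply: cvgM; [exact: cvg_cst|apply: cvgB; [exact: cvg_id|exact: cvg_cst]].
by apply: cvgB; [exact: cvg_cst|exact: cvg_id].
Qed.

Let tent_ge0 a n l : 0 <= tent a n l.
Proof. by rewrite /tent le_max lexx. Qed.

Let tent_le1 a n l : tent a n l <= 1.
Proof. by rewrite /tent ge_max ler01 !ge_min lexx. Qed.

Let tent_le0 a n l : l <= a -> tent a n l = 0.
Proof.
move=> la; apply/eqP; rewrite eq_le tent_ge0 andbT ge_max lexx !ge_min.
by rewrite mulr_ge0_le0// ?subr_le0// !orbT.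
Qed.

Let tent_ge a n l : n%:R <= l -> tent a n l = 0.
Proof.
move=> la; apply/eqP; rewrite eq_le tent_ge0 andbT ge_max lexx !ge_min.
by rewrite subr_le0 la !orbT.
Qed.

Let tent_cvg a l : tent a n l @[n --> \oo] --> (if a < l then 1 else 0 : R).
Proof.
case: ltP => al; last first.
  rewrite (_ : (fun n => _) = cst 0); first exact: cvg_cst.
  by apply/funext => n; rewrite tent_le0.
apply: cvg_near_cst; near=> n; rewrite /tent.
have h1 : 1 <= n%:R * (l - a).
  rewrite -ler_pdivrMr ?subr_gt0//; near: n; exact: nbhs_infty_ger.
have h2 : 1 <= n%:R - l.
  rewrite lerBrDr; near: n; exact: nbhs_infty_ger.
by rewrite (min_l h1) (min_l h2) max_r.
Unshelve. all: by end_near. Qed.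

(** The mass of the ray is a pointwise limit of functions that are continuous in t. The indicator of
    the ray itself dominates the tents, and it is integrable by Markov's inequality. *)
Lemma weakstar_measurable_ray (a : R) : 0 < a ->
  measurable_fun setT (fun t : R => nu t `]a, +oo[%classic).
Proof.
move=> a0.
apply: (@emeasurable_fun_cvg _ R _ setT
  (fun n t => (\int[nu t]_(l in `]0, +oo[) tent a n l)%:E)).
  move=> n; apply/measurable_EFinP; apply: continuous_measurable_fun; apply: cnu.
  split; first exact: tent_continuous.
  exists `[a, n%:R]%classic; split; first exact: segment_compact.
    by move=> l; rewrite /= !in_itv/= => /andP[/(lt_le_trans a0) ->].
  move=> l; rewrite /= in_itv/= => /negP; rewrite negb_and -!ltNge.
  by move=> /orP[/ltW|/ltW]; [exact: tent_le0|exact: tent_ge].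
move=> t _.
have mD : measurable (`]0, +oo[%classic : set (measurableTypeR R)) by exact: measurable_itv.
have mtent n : measurable_fun [set: measurableTypeR R] (EFin \o tent a n).
  by apply/measurable_EFinP; apply: continuous_measurable_fun; exact: tent_continuous.
have intE : (\int[nu t]_(l in `]0%R, +oo[) (\1_(`]a, +oo[%classic) l)%:E =
    nu t `]a, +oo[%classic)%E.
  rewrite integral_indic//; congr (nu t _); apply: setIidl.
  by apply: subset_itvr; rewrite bnd_simp ltW.
have iind : (nu t).-integrable `]0%R, +oo[ (fun l => (\1_(`]a, +oo[%classic) l)%:E).
  apply/integrableP; split; first exact/measurable_EFinP/measurable_indic.
  under eq_integral => l _ do rewrite gee0_abs ?lee_fin//.
  by rewrite intE (le_lt_trans (in_M_tail (Mnu t) a0))// ltry.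
have tentle n l : tent a n l <= \1_(`]a, +oo[%classic) l.
  case: (leP l a) => la; first by rewrite tent_le0.
  by rewrite indicE mem_set ?tent_le1// /= in_itv/= la.
have fint n : (\int[nu t]_(l in `]0%R, +oo[) (tent a n l)%:E)%E \is a fin_num.
  apply: integrable_fin_num => //.
  apply: (le_integrable mD _ _ iind); first exact: measurable_funTS (mtent n).
  by move=> l _; rewrite !gee0_abs ?lee_fin//.
rewrite -intE.
rewrite (_ : (fun n => _) = (fun n => \int[nu t]_(l in `]0%R, +oo[) (tent a n l)%:E)%E); last first.
  by apply/funext => n; rewrite /Rintegral fineK.
have [//|||//| |_ _] := @dominated_convergence _ _ _ (nu t) _ mD
  (fun n l => (tent a n l)%:E) (fun l => (\1_(`]a, +oo[%classic) l)%:E)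
  (fun l => (\1_(`]a, +oo[%classic) l)%:E).
- by move=> n; exact: measurable_funTS (mtent n).
- exact/measurable_EFinP/measurable_indic.
- apply: aeW => l _; apply/cvg_EFin; first exact: nearW.
  have := @tent_cvg a l; rewrite indicE.
  have -> : (l \in `]a, +oo[%classic) = (a < l).
    by apply/idP/idP; rewrite inE/= in_itv/= andbT.
  by case: ltP.
- by apply: aeW => l n _; rewrite gee0_abs ?lee_fin.
- exact.
Qed.

End weakstar_measurability.

(** * Approximate Dirac masses and cutoffs in time *)

Section time_localization.
Context {R : realType}.

(** [s] may be an endpoint of [A]. The mass is normalized over [A] alone, so a one-sided
    approximation still yields the full value F(s). *)
Definition approximates_dirac (A : set R) (s : R) (d : nat -> R -> R) :=
  [/\ forall n, continuous (d n), forall n t, 0 <= d n t,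
      forall n, (\int[lebesgue R]_(t in A) (d n t)%:E = 1)%E &
      forall e : R, 0 < e -> \forall n \near \oo, forall t, e <= `|t - s| -> d n t = 0].

Lemma measurable_continuous (f : R -> R) : continuous f ->
  measurable_fun [set: measurableTypeR R] f.
Proof. exact: continuous_measurable_fun. Qed.

Lemma approximates_dirac_integrable (A : set (measurableTypeR R)) s d n :
  measurable A -> approximates_dirac A s d ->
  (lebesgue R).-integrable A (EFin \o d n).
Proof.
move=> mA [dc d0 d1 _]; apply/integrableP; split.
  by apply/measurable_EFinP; apply: measurable_funTS; apply: measurable_continuous.
under eq_integral => t _ do rewrite gee0_abs ?lee_fin//=.
by rewrite d1 ltry.
Qed.

Lemma approximates_dirac_cvg (A : set (measurableTypeR R)) s d (F : R -> R) :
  measurable A -> approximates_dirac A s d -> continuous F ->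
  (\int[lebesgue R]_(t in A) (d n t * F t)%:E)%E @[n --> \oo] --> (F s)%:E.
Proof.
move=> mA dA cF; have [dc d0 d1 dloc] := dA.
have id n := approximates_dirac_integrable n mA dA.
(* The two-sided bound yields finiteness of the integrals for large n together with the limit. *)
suff H : forall e : R, 0 < e -> \forall n \near \oo,
    ((F s - e)%:E <= \int[lebesgue R]_(t in A) (d n t * F t)%:E <= (F s + e)%:E)%E.
  apply/fine_cvgP; split.
    near=> n; rewrite fin_numElt; apply/andP.
    have /andP[h1 h2] : ((F s - 1)%:E <= \int[lebesgue R]_(t in A) (d n t * F t)%:E <= (F s + 1)%:E)%E.
      by near: n; exact: H.
    by rewrite (lt_le_trans _ h1) ?ltNyr// (le_lt_trans h2) ?ltry.
  apply/cvgrPdist_le => e e0; near=> n.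
  have /andP[] : ((F s - e)%:E <= \int[lebesgue R]_(t in A) (d n t * F t)%:E <= (F s + e)%:E)%E.
    by near: n; exact: H.
  rewrite /=; case: (integral _ _ _) => [r| |]//=; rewrite !lee_fin => h1 h2.
  by rewrite ler_distlC; apply/andP; split; lra.
move=> e e0.
have [r r0 hr] : exists2 r : R, 0 < r & forall t, `|t - s| < r -> `|F t - F s| <= e.
  have /cvgrPdist_le /(_ e e0) := cF s.
  move=> /nbhs_ballP[r/= r0 hr]; exists r => // t ts; rewrite distrC; apply: hr.
  by rewrite /ball/= distrC.
near=> n.
have dn t : r <= `|t - s| -> d n t = 0.
  by move: t; near: n; exact: dloc.
have hF t : d n t * (F s - e) <= d n t * F t <= d n t * (F s + e).
  have [ts|/dn ->] := ltP `|t - s| r; last by rewrite !mul0r lexx.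
  by have := hr t ts; rewrite ler_distl => /andP[h1 h2]; rewrite !ler_wpM2l.
have mdF : measurable_fun A (fun t => (d n t * F t)%:E).
  by apply/measurable_EFinP; apply: measurable_funTS; apply: measurable_continuous => t; apply: cvgM; [exact: dc|exact: cF].
have idc c : (lebesgue R).-integrable A (fun t => (d n t * c)%:E).
  under [X in _.-integrable _ X]eq_fun => t do rewrite mulrC EFinM.
  by apply: integrableZl => //; exact: id.
have intc c : (\int[lebesgue R]_(t in A) (d n t * c)%:E = c%:E)%E.
  under eq_integral => t _ do rewrite mulrC EFinM.
  rewrite (integralZl mA (id n)) -[RHS]mule1; congr (_ * _)%E; exact: d1.
have idF : (lebesgue R).-integrable A (fun t => (d n t * F t)%:E).
  apply: (le_integrable mA mdF _ (idc (`|F s| + e))) => t _ /=.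
  rewrite lee_fin normrM [leRHS]ger0_norm ?mulr_ge0 ?addr_ge0// ?(ltW e0)//.
  have /andP[h1 h2] := hF t.
  rewrite -(ger0_norm (d0 n t)) -normrM ler_norml -mulrN.
  rewrite (ger0_norm (d0 n t)).
  have hs := ler_norm (F s); have hs' := ler_norm (- F s); rewrite normrN in hs'.
  apply/andP; split.
    apply: le_trans h1; rewrite ler_wpM2l//; lra.
  apply: (le_trans h2); rewrite ler_wpM2l//; lra.
rewrite -!intc; apply/andP; split; apply: le_integral => // t _;
  by rewrite lee_fin; have /andP[] := hF t.
Unshelve. all: by end_near. Qed.

Lemma integral_derivative (f g : R -> R) (a b : R) : a < b ->
  (forall x : R, is_derive x 1 f (g x)) -> continuous g ->
  (\int[lebesgue R]_(x in `]a, b[) (g x)%:E = (f b - f a)%:E)%E.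
Proof.
move=> ab df cg.
have cf : continuous f by apply: derivable_cont => x; have [] := df x.
have mg (D : set (measurableTypeR R)) : measurable_fun D (EFin \o g).
  by apply/measurable_EFinP; apply: measurable_funTS; exact: measurable_continuous.
rewrite (_ : \int[_]_(_ in _) _ = \int[lebesgue R]_(x in `[a, b]) (g x)%:E)%E.
  rewrite EFinB (@continuous_FTC2 _ g f)//.
  - by apply: continuous_subspaceT => x; exact: cg.
  - split.
    + by move=> x _; have [] := df x.
    + exact/cvg_at_right_filter/cf.
    + exact/cvg_at_left_filter/cf.
  - by move=> x _; rewrite derive1E; have [_ ->] := df x.
rewrite integral_itv_bndo_bndc; last exact: mg.
by rewrite integral_itv_obnd_cbnd//; exact: mg.
Qed.

(** Smooth approximations of the indicator of (s1, s2) whose derivative is an approximate Dirac mass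
    at s1 minus one at s2. Testing with them turns the time derivative into boundary values. *)
Lemma time_cutoff (s1 s2 : R) : s1 < s2 -> exists eta d1 d2 : nat -> R -> R,
  [/\ forall n, smooth (eta n) /\ (forall t, derive1 (eta n) t = d1 n t - d2 n t),
      forall n t, `|eta n t| <= 1,
      forall n, exists r1 r2, [/\ s1 < r1, r2 < s2 & forall t, t \notin `[r1, r2] -> eta n t = 0],
      forall t, s1 < t < s2 -> eta n t @[n --> \oo] --> (1 : R) &
      approximates_dirac `]s1, s2[ s1 d1 /\ approximates_dirac `]s1, s2[ s2 d2].
Proof.
move=> s12; have [P [B [b [c [[_ sB] [dB b0] B01 le0 ge1]]]]] := @smooth_ramp R.
have cb : continuous b.
  rewrite (_ : b = derive1 B); first exact/smooth_continuous/smooth_derive.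
  by apply/funext => x; rewrite derive1E; have [_ ->] := dB x.
(* Ensures N (s2 - s1) >= 3. Then the rise of eta is complete at s2 - 1/N and its fall has not begun
   at s1 + 1/N, so eta vanishes outside [s1 + 1/N, s2 - 1/N]. *)
pose k := (Num.bound (3 / (s2 - s1))).+1.
pose N n : R := (n + k)%:R.
have N0 n : 0 < N n by rewrite ltr0n addnS.
have N1 n : 1 <= N n by rewrite ler1n addnS.
have Ns n : 3 <= N n * (s2 - s1).
  rewrite -ler_pdivrMr ?subr_gt0//.
  have h : 3 / (s2 - s1) <= (Num.bound (3 / (s2 - s1)))%:R.
    by apply: ltW; apply: archi_boundP; rewrite divr_ge0// subr_ge0 ltW.
  by apply: (le_trans h); rewrite ler_nat /k addnS -addSn leq_addl.
have Noo (x : R) : \forall n \near \oo, x <= N n.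
  near=> n; apply: (@le_trans _ _ n%:R).
    by near: n; exact: nbhs_infty_ger.
  by rewrite ler_nat leq_addr.
(* With these shifts the rise takes place on [s1 + 1/N, s1 + 2/N] and the fall on
   [s2 - 2/N, s2 - 1/N]. The gaps of length 1/N keep the support compact inside (s1, s2). *)
pose c1 n := - (N n * s1) - 1; pose c2 n := - (N n * s2) + 2.
have dBn n (m x : R) : is_derive x 1 (fun t => B (N n * t + m)) (N n * b (N n * x + m)).
  have dBx (y : R) : derivable B y 1 by have [] := dB y.
  have -> : b (N n * x + m) = derive1 B (N n * x + m).
    by rewrite derive1E; have [_ ->] := dB (N n * x + m).
  exact: is_derive_comp_affine.
have cbn n (m : R) : continuous (fun t => N n * b (N n * t + m)).
  move=> t; apply: cvgM; first exact: cvg_cst.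
  apply: (@continuous_comp _ _ _ (fun t => N n * t + m) b); last exact: cb.
  by apply: cvgD; [apply: cvgM; [exact: cvg_cst|exact: cvg_id]|exact: cvg_cst].
exists (fun n t => B (N n * t + c1 n) - B (N n * t + c2 n)).
exists (fun n t => N n * b (N n * t + c1 n)), (fun n t => N n * b (N n * t + c2 n)).
split.
- move=> n; split.
    rewrite (_ : (fun _ => _) = (fun t => B (N n * t + c1 n)) \+
        (cst (-1) \* (fun t => B (N n * t + c2 n)))).
      apply: smoothD; first exact: smooth_comp_affine.
      by apply: smoothM; [exact: smooth_cst|exact: smooth_comp_affine].
    by apply/funext => t /=; rewrite mulN1r.
  move=> t; rewrite derive1E.
  by have [_ ->] := is_deriveB (dBn n (c1 n) t) (dBn n (c2 n) t).
- move=> n t; have /andP[? ?] := B01 (N n * t + c1 n).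
  have /andP[? ?] := B01 (N n * t + c2 n).
  by rewrite ler_norml; apply/andP; split; lra.
- move=> n; exists (s1 + (N n)^-1), (s2 - (N n)^-1); split.
  + by rewrite ltrDl invr_gt0.
  + by rewrite gtrBl invr_gt0.
  + move=> t; rewrite in_itv/= negb_and -!ltNge => /orP[h|h].
      have h1 : N n * (t - s1) < 1.
        by rewrite mulrC -ltr_pdivlMr// div1r ltrBlDl.
      have [|_ -> _] := le0 (N n * t + c1 n); first by rewrite /c1; lra.
      have [|_ -> _] := le0 (N n * t + c2 n); first by have := Ns n; rewrite /c2; lra.
      by rewrite subrr.
    have h1 : -1 < N n * (t - s2).
      by rewrite mulrC -ltr_pdivrMr// mulN1r ltrBrDl.
    have [|_ -> _] := ge1 (N n * t + c1 n); first by have := Ns n; rewrite /c1; lra.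
    have [|_ -> _] := ge1 (N n * t + c2 n); first by rewrite /c2; lra.
    by rewrite subrr.
- move=> t /andP[s1t ts2]; apply: cvg_near_cst; near=> n.
  have h1 : 2 <= N n * (t - s1).
    by rewrite -ler_pdivrMr ?subr_gt0//; near: n; exact: Noo.
  have h2 : 2 <= N n * (s2 - t).
    by rewrite -ler_pdivrMr ?subr_gt0//; near: n; exact: Noo.
  have [|_ -> _] := ge1 (N n * t + c1 n); first by rewrite /c1; lra.
  have [|_ -> _] := le0 (N n * t + c2 n); first by rewrite /c2; lra.
  by rewrite subr0.
- split; split => //.
  + by move=> n t; rewrite mulr_ge0// ltW.
  + move=> n; rewrite (integral_derivative s12 (dBn n (c1 n)) (cbn n _)).
    have [|_ -> _] := ge1 (N n * s2 + c1 n); first by have := Ns n; rewrite /c1; lra.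
    have [|_ -> _] := le0 (N n * s1 + c1 n); first by rewrite /c1; lra.
    by rewrite subr0.
  + move=> e e0; near=> n => t et.
    have h : 2 <= N n * e by rewrite -ler_pdivrMr//; near: n; exact: Noo.
    have {et}h : 2 <= N n * `|t - s1| by apply: (le_trans h); rewrite ler_wpM2l// ltW.
    suff -> : b (N n * t + c1 n) = 0 by rewrite mulr0.
    have [ts|ts] := leP 0 (t - s1).
      rewrite ger0_norm// in h.
      by have [] := ge1 (N n * t + c1 n); rewrite /c1; lra.
    rewrite ltr0_norm// in h.
    by have [] := le0 (N n * t + c1 n); rewrite /c1; lra.
  + by move=> n t; rewrite mulr_ge0// ltW.
  + move=> n; rewrite (integral_derivative s12 (dBn n (c2 n)) (cbn n _)).
    have [|_ -> _] := ge1 (N n * s2 + c2 n); first by rewrite /c2; lra.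
    have [|_ -> _] := le0 (N n * s1 + c2 n); first by have := Ns n; rewrite /c2; lra.
    by rewrite subr0.
  + move=> e e0; near=> n => t et.
    have h : 2 <= N n * e by rewrite -ler_pdivrMr//; near: n; exact: Noo.
    have {et}h : 2 <= N n * `|t - s2| by apply: (le_trans h); rewrite ler_wpM2l// ltW.
    suff -> : b (N n * t + c2 n) = 0 by rewrite mulr0.
    have [ts|ts] := leP 0 (t - s2).
      rewrite ger0_norm// in h.
      by have [] := ge1 (N n * t + c2 n); rewrite /c2; lra.
    rewrite ltr0_norm// in h.
    by have [] := le0 (N n * t + c2 n); rewrite /c2; lra.
Unshelve. all: by end_near. Qed.

End time_localization.

(** * The continuity equation integrated in time *)

Section time_integrated_equation.
Context {R : realType} (alpha rho T : R).
Notation mR := (measurableTypeR R).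
Variable nu : R.-sfker mR ~> mR.
Hypothesis Mnu : forall t, in_M rho (nu t).
Hypothesis cnu : forall phi : R -> R, Cc_pos phi ->
  continuous (fun t => \int[nu t]_(l in `]0, +oo[) phi l : R).

Let D : set mR := `]0%R, +oo[%classic.
Let mD : measurable D. Proof. exact: measurable_itv. Qed.

(** The uniform bound that M provides: the first moment absorbs every integrand of linear growth
    vanishing at 0. *)
Lemma in_M_int_le (f : R -> R) (C : R) t : measurable_fun [set: mR] f ->
  (forall l, 0 < l -> `|f l| <= C * l) ->
  (\int[nu t]_(l in `]0%R, +oo[) `|f l|%:E <= (C * rho)%:E)%E.
Proof.
move=> mf fC; have [_ Mrho] := Mnu t.
have C0 : 0 <= C by have := fC 1 ltr01; rewrite mulr1; apply: le_trans.
rewrite EFinM -Mrho -ge0_integralZl//.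
- apply: ge0_le_integral => //.
  + by apply: measurable_funTS; apply/measurable_EFinP; exact: measurableT_comp.
  + by apply: measurable_funTS; apply/measurable_EFinP; exact: measurable_funM.
  + by move=> l; rewrite /= in_itv/= andbT => l0; rewrite -EFinM lee_fin fC.
- by move=> l; rewrite /= in_itv/= andbT => l0; rewrite lee_fin ltW.
Qed.

Lemma in_M_integrable (f : R -> R) (C : R) t : measurable_fun [set: mR] f ->
  (forall l, 0 < l -> `|f l| <= C * l) ->
  (nu t).-integrable `]0%R, +oo[ (EFin \o f).
Proof.
move=> mf fC; apply/integrableP; split.
  by apply/measurable_EFinP; exact: measurable_funTS.
exact: le_lt_trans (in_M_int_le t mf fC) (ltry _).
Qed.

Lemma measurable_flux (v : R -> R -> R) (g : R -> R) :
  measurable_fun [set: mR * mR] (fun p => v p.1 p.2) ->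
  measurable_fun [set: mR] g ->
  measurable_fun [set: mR * mR] (fun p => p.2 `^ alpha * v p.1 p.2 * g p.2).
Proof.
move=> mv mg; apply: measurable_funM; last exact: measurableT_comp.
apply: measurable_funM => //.
by apply: (@measurableT_comp _ _ _ _ _ _ (@powR R ^~ alpha)) => //; exact: measurable_powR.
Qed.

Variable v : R -> R -> R.
Hypothesis mv : measurable_fun [set: mR * mR] (fun p => v p.1 p.2).
Hypothesis CEv : forall phi : R * R -> R, test_function T phi ->
    (\int[lebesgue R]_(t in `]0%R, T[) \int[nu t]_(l in `]0%R, +oo[)
       (partial_t phi (t, l) + l `^ alpha * v t l * partial_l phi (t, l))%:E
     = 0)%E.

(** The test function is eta_n(t) psi(l). Since t |-> \int psi dnu_t is continuous, the term with
    eta_n' converges to the boundary values; the flux term converges by domination. The flux is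
    integrable up to the ends, so s1 = 0 and s2 = T are allowed. *)
Lemma time_integrated (psi : R -> R) (a b C s1 s2 : R) :
  smooth psi -> 0 < a -> (forall l, l \notin `[a, b] -> psi l = 0) ->
  (forall l, 0 < l -> `|psi l| <= C * l) ->
  0 <= s1 -> s1 < s2 -> s2 <= T ->
  (\int[lebesgue R]_(t in `]s1, s2[) \int[nu t]_(l in `]0%R, +oo[)
     `|(l `^ alpha * v t l * derive1 psi l)%:E| < +oo)%E ->
  (\int[lebesgue R]_(t in `]s1, s2[) \int[nu t]_(l in `]0%R, +oo[)
     (l `^ alpha * v t l * derive1 psi l)%:E =
   (\int[nu s2]_(l in `]0, +oo[) psi l - \int[nu s1]_(l in `]0, +oo[) psi l)%:E)%E.
Proof.
move=> spsi a0 psi0 psiC s10 s12 s2T hloc.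
have [eta [d1 [d2 [heta eta1 etasupp etacvg [dd1 dd2]]]]] := time_cutoff s12.
pose A : set mR := `]s1, s2[%classic.
have mA : measurable A by exact: measurable_itv.
pose F t := \int[nu t]_(l in `]0, +oo[) psi l.
have cpsi : continuous psi by exact: smooth_continuous.
have mpsi : measurable_fun [set: mR] psi by exact: measurable_continuous.
have cpsi' : continuous (derive1 psi) by exact/smooth_continuous/smooth_derive.
have mpsi' : measurable_fun [set: mR] (derive1 psi) by exact: measurable_continuous.
have cF : continuous F.
  apply: cnu; split => //; exists `[a, b]%classic; split.
  - exact: segment_compact.
  - by move=> l; rewrite /= !in_itv/= => /andP[/(lt_le_trans a0) ->].
  - by move=> l /= /negP; exact: psi0.
have FE t : (\int[nu t]_(l in `]0%R, +oo[) (psi l)%:E = (F t)%:E)%E.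
  rewrite /F /Rintegral fineK//; apply: integrable_fin_num => //.
  exact: (in_M_integrable t mpsi psiC).
have ceta n : continuous (eta n) by apply: smooth_continuous; have [] := heta n.
have ceta' n : continuous (derive1 (eta n)).
  by apply: smooth_continuous; apply: smooth_derive; have [] := heta n.
pose f n (p : mR * mR) : \bar R := (derive1 (eta n) p.1 * psi p.2)%:E.
pose g0 (p : mR * mR) : \bar R := (p.2 `^ alpha * v p.1 p.2 * derive1 psi p.2)%:E.
pose g n (p : mR * mR) : \bar R := ((eta n p.1)%:E * g0 p)%E.
have mf n : measurable_fun setT (f n).
  apply/measurable_EFinP; apply: measurable_funM; last exact: measurableT_comp.
  by apply: (measurableT_comp (f := derive1 (eta n))) => //; exact: measurable_continuous.
have mg0 : measurable_fun setT g0 by apply/measurable_EFinP; exact: measurable_flux.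
have mg n : measurable_fun setT (g n).
  apply: emeasurable_funM => //; apply/measurable_EFinP.
  by apply: (measurableT_comp (f := eta n)) => //; exact: measurable_continuous.
have fE n t : (\int[nu t]_(l in D) f n (t, l) = ((d1 n t - d2 n t) * F t)%:E)%E.
  rewrite /f /=; have [_ ->] := heta n.
  under eq_integral => l _ do rewrite EFinM.
  rewrite (integralZl mD (in_M_integrable t mpsi psiC)) FE.
  by [].
have id i : (lebesgue R).-integrable A (fun t => (d1 i t)%:E) /\
            (lebesgue R).-integrable A (fun t => (d2 i t)%:E).
  by split; [exact: approximates_dirac_integrable dd1|exact: approximates_dirac_integrable dd2].
have C0 : 0 <= C by have := psiC 1 ltr01; rewrite mulr1; apply: le_trans.
have rho0 : 0 <= rho.
  have [_ Mrho] := Mnu 0; rewrite -lee_fin -Mrho; apply: integral_ge0 => l.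
  by rewrite /= in_itv/= andbT => /ltW; rewrite lee_fin.
have f_lty n : (\int[lebesgue R]_(t in A) \int[nu t]_(l in D) `|f n (t, l)| < +oo)%E.
  apply: (@le_lt_trans _ _ (\int[lebesgue R]_(t in A) ((C * rho)%:E * ((d1 n t)%:E + (d2 n t)%:E)))%E).
    apply: ge0_le_integral => //.
    - by move=> t _; exact: integral_ge0.
    - apply: measurable_funTS.
      apply: (measurable_fun_kernel nu mD (f := abse \o f n)); exact: measurableT_comp.
    - apply: emeasurable_funM => //; apply: emeasurable_funD.
        by have [/integrableP[]] := id n.
      by have [_ /integrableP[]] := id n.
    - move=> t _.
      have -> : (\int[nu t]_(l in D) `|f n (t, l)| =
          `|derive1 (eta n) t|%:E * \int[nu t]_(l in D) `|psi l|%:E)%E.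
        rewrite -ge0_integralZl//.
          by apply: eq_integral => l _; rewrite /f/= normrM.
        by apply: measurable_funTS; apply/measurable_EFinP; exact: measurableT_comp.
      rewrite muleC; apply: lee_pmul => //.
      + by apply: integral_ge0.
      + exact: in_M_int_le.
      + rewrite -EFinD lee_fin; have [_ ->] := heta n.
        have [_ d10 _ _] := dd1; have [_ d20 _ _] := dd2.
        apply: (le_trans (ler_normB _ _)).
        by rewrite !ger0_norm.
  have [i1 i2] := id n.
  rewrite (integralZl mA (integrableD mA i1 i2)) (integralD mA i1 i2).
  have [_ _ d11 _] := dd1; have [_ _ d21 _] := dd2.
  by rewrite d11 d21 -EFinD -EFinM ltry.
have g_le n t l : (`|g n (t, l)| <= `|g0 (t, l)|)%E.
  by rewrite /g /g0 /= lee_fin normrM ler_piMl.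
have g_lty n : (\int[lebesgue R]_(t in A) \int[nu t]_(l in D) `|g n (t, l)| < +oo)%E.
  apply: le_lt_trans hloc.
  apply: (le_iter_integral nu _ mA mD (f := abse \o g n) (g := abse \o g0)).
  - exact: measurableT_comp.
  - exact: measurableT_comp.
  - by move=> t l _ _; rewrite abse_ge0/=; exact: g_le.
have weak0 n : (\int[lebesgue R]_(t in A) \int[nu t]_(l in D) f n (t, l) +
    \int[lebesgue R]_(t in A) \int[nu t]_(l in D) g n (t, l) = 0)%E.
  rewrite -(iter_integralD mA mD (mf n) (mg n) (f_lty n) (g_lty n)).
  have [r1 [r2 [s1r1 r2s2 eta0]]] := etasupp n.
  have tphi : test_function T (tensor (eta n) psi).
    apply: (@test_function_tensor _ T r1 r2 a b) => //.
    - by have [] := heta n.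
    - exact: le_lt_trans s1r1.
    - exact: lt_le_trans r2s2 s2T.
  rewrite -[RHS](CEv tphi) [LHS]integral_mkcond [RHS]integral_mkcond.
  apply: eq_integral => t _; rewrite !patchE.
  have eqE : (\int[nu t]_(l in D) (f n (t, l) + g n (t, l)) =
    \int[nu t]_(l in `]0%R, +oo[) (partial_t (tensor (eta n) psi) (t, l) +
      l `^ alpha * v t l * partial_l (tensor (eta n) psi) (t, l))%:E)%E.
    apply: eq_integral => l _; rewrite partial_t_tensor; last first.
      by apply: smooth_derivable; have [] := heta n.
    rewrite partial_l_tensor; last exact: smooth_derivable.
    by rewrite /f /g /g0 /tensor /= -EFinM -EFinD; congr (_%:E); ring.
  case: ifPn => tA.
    rewrite mem_set ?eqE//; move: tA; rewrite inE /A /= !in_itv/= => /andP[h1 h2].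
    by rewrite (le_lt_trans s10 h1) (lt_le_trans h2 s2T).
  case: ifPn => // _; rewrite -eqE; apply/esym/integral0_eq => l _.
  (* Outside [A] the cutoff vanishes on a neighbourhood of t and not just at t, so its derivative
     vanishes too. This reduces the integral over (0, T) to one over (s1, s2). *)
  have et0 : \forall u \near t, eta n u = 0.
    have : t \notin `[r1, r2].
      apply: contra tA; rewrite in_itv/= inE /A /= in_itv/= => /andP[h1 h2].
      by rewrite (lt_le_trans s1r1 h1) (le_lt_trans h2 r2s2).
    rewrite in_itv/= negb_and -!ltNge => /orP[h|h]; near=> u; apply: eta0;
      rewrite in_itv/= negb_and -!ltNge; apply/orP; [left|right]; near: u.
      exact: lt_nbhsl.
    exact: lt_nbhsr.
  rewrite /f /g /= (nbhs_singleton et0).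
  have -> : derive1 (eta n) t = 0.
    by rewrite derive1E (near_eq_derive (g := cst 0)) ?derive_cst.
  by rewrite mul0r mul0e adde0.
have icont (h : R -> R) : continuous h -> (lebesgue R).-integrable A (fun t => (h t)%:E).
  move=> ch; apply: (integrableS (E := (`[s1, s2]%classic : set mR))) => //.
    by move=> u; rewrite /A /= !in_itv/= => /andP[/ltW -> /ltW ->].
  apply: continuous_compact_integrable; first exact: segment_compact.
  by apply: continuous_subspaceT => u; exact: ch.
have cvg_f : (\int[lebesgue R]_(t in A) \int[nu t]_(l in D) f n (t, l))%E @[n --> \oo]
    --> (F s1 - F s2)%:E.
  have -> : (fun n => \int[lebesgue R]_(t in A) \int[nu t]_(l in D) f n (t, l))%E =
    (fun n => \int[lebesgue R]_(t in A) (d1 n t * F t)%:E - \int[lebesgue R]_(t in A) (d2 n t * F t)%:E)%E.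
    apply/funext => n; under eq_integral => t _ do rewrite fE mulrBl EFinB.
    by rewrite integralB//; apply: icont => u; apply: cvgM;
      [case: dd1 => + _ _ _; exact|exact: cF|case: dd2 => + _ _ _; exact|exact: cF].
  rewrite EFinB; apply: cvgeB => //.
    exact: approximates_dirac_cvg.
  exact: approximates_dirac_cvg.
have cvg_g : (\int[lebesgue R]_(t in A) \int[nu t]_(l in D) g n (t, l))%E @[n --> \oo]
    --> (\int[lebesgue R]_(t in A) \int[nu t]_(l in D) g0 (t, l))%E.
  apply: (iter_dominated_convergence mA mD (g := abse \o g0)) => //.
  - exact: measurableT_comp.
  - move=> t l; rewrite /A /= in_itv/= => tA _.
    rewrite -[X in _ --> X]mul1e; apply: cvgeZr => //.
    by apply/cvg_EFin; [exact: nearW|exact: etacvg].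
have Ifin : (\int[lebesgue R]_(t in A) \int[nu t]_(l in D) g0 (t, l))%E \is a fin_num.
  apply: integrable_fin_num => //.
  by have [] := iter_integrable mA mD mg0 hloc.
have : (0 = (F s1 - F s2)%:E + \int[lebesgue R]_(t in A) \int[nu t]_(l in D) g0 (t, l))%E.
  have h := cvgeD (fin_num_adde_defl _ Ifin) cvg_f cvg_g.
  rewrite -(cvg_lim (@ereal_hausdorff R) (h _)).
  rewrite (_ : (fun n => _) = cst 0%E); first by rewrite lim_cst.
  by apply/funext => n; rewrite weak0.
move: Ifin; rewrite -/(F s2) -/(F s1) /g0.
case: (integral _ _ _) => [r| |]// _; rewrite -EFinD => -[/esym/eqP].
by rewrite addrC addr_eq0 opprB => /eqP ->.
Unshelve. all: by end_near. Qed.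

End time_integrated_equation.

(** * Compactly supported approximations of (l - a)^+ *)

Section space_cutoff.
Context {R : realType}.

(** The two bounds serve as dominating functions, the first for the integrals against nu_t, the
    second for the flux. The 4 is 1 + 2 + 1, the sum of the absolute coefficients of the second
    difference that defines [psi]. *)
Lemma space_cutoff (a : R) : 0 < a -> exists psi : nat -> R -> R,
  [/\ forall n, smooth (psi n),
      forall n, exists b, forall l, l \notin `[a, b] -> psi n l = 0,
      forall n l, 0 < l -> `|psi n l| <= 4 * l,
      forall n l, `|derive1 (psi n) l| <= 4 * (a < l)%R%:R &
      forall l, psi n l @[n --> \oo] --> Num.max (l - a) 0 /\
        derive1 (psi n) l @[n --> \oo] --> ((a < l)%R%:R : R)].
Proof.
move=> a0; have [P [B [b [c [[dP sB] [dB b0] B01 le0 ge1]]]]] := @smooth_ramp R.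
have P0 x : 0 <= P x.
  have [x0|x0] := leP x 0; first by have [->] := le0 x x0.
  have [<- _ _] := le0 0 (lexx 0).
  by apply: (is_derive_nondecreasing dP) (ltW x0) => y; have /andP[] := B01 y.
have Pmax (x y : R) : 0 <= y -> x <= y -> P x <= y.
  have [x0|x0] := leP x 0; first by have [->] := le0 x x0.
  have dQ (z : R) : is_derive z 1 (id - P) (1 - B z) by exact: is_deriveB.
  have : (id - P) 0 <= (id - P) x.
    apply: (is_derive_nondecreasing dQ) (ltW x0) => z; rewrite subr_ge0.
    by have /andP[] := B01 z.
  rewrite !fctE; have [-> _ _] := le0 0 (lexx 0).
  by rewrite subrr subr_ge0 => h _; apply: le_trans.
pose N n : R := n.+1%:R.
have N0 n : 0 < N n by rewrite ltr0n.
have Nn0 n : N n != 0 by rewrite gt_eqF.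
pose m n := a + N n.
pose c1 n := - (N n * a); pose c2 n := - (N n * m n); pose c3 n := - (N n * (2 * m n - a)).
(* A rounded tent: up from a to m n with slope 1, down to 0 at 2 * m n - a. *)
pose psi n l := (N n)^-1 * (P (N n * l + c1 n) + - 2 * P (N n * l + c2 n) + P (N n * l + c3 n)).
have sP : smooth P by exact: smooth_primitive dP sB.
have dPn n (d x : R) : is_derive x 1 (fun l => P (N n * l + d)) (N n * B (N n * x + d)).
  have dPx (y : R) : derivable P y 1 by have [] := dP y.
  have -> : B (N n * x + d) = derive1 P (N n * x + d).
    by rewrite derive1E; have [_ ->] := dP (N n * x + d).
  exact: is_derive_comp_affine.
have dpsi n l : derive1 (psi n) l =
    B (N n * l + c1 n) + - 2 * B (N n * l + c2 n) + B (N n * l + c3 n).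
  have h := is_deriveZ (N n)^-1 (is_deriveD (is_deriveD (dPn n (c1 n) l)
    (is_deriveZ (- 2) (dPn n (c2 n) l))) (dPn n (c3 n) l)).
  rewrite derive1E; have [_ ->] := h.
  by rewrite /GRing.scale/=; field.
have mpos n : a < m n by rewrite ltrDl.
exists psi; split.
- move=> n; apply: (smoothM (smooth_cst _)); apply: smoothD; last exact: smooth_comp_affine.
  apply: smoothD; first exact: smooth_comp_affine.
  by apply: (smoothM (smooth_cst _)); exact: smooth_comp_affine.
- move=> n; exists (2 * m n - a + 1) => l.
  rewrite in_itv/= negb_and -!ltNge => /orP[h|h]; rewrite /psi.
    have [|-> _ _] := le0 (N n * l + c1 n).
      by rewrite /c1 -mulrBr pmulr_rle0// subr_le0 ltW.
    have [|-> _ _] := le0 (N n * l + c2 n).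
      by rewrite /c2 -mulrBr pmulr_rle0// subr_le0 ltW// (lt_trans h).
    have [|-> _ _] := le0 (N n * l + c3 n).
      rewrite /c3 -mulrBr pmulr_rle0//; have := mpos n; lra.
    by rewrite mulr0 !addr0 mulr0.
  have N1 : 1 <= N n by rewrite ler1n.
  have big d : d <= 2 * m n - a -> 1 <= N n * l + - (N n * d).
    move=> dm; rewrite -mulrBr; apply: (le_trans N1); rewrite ler_peMr ?(ltW (N0 n))//.
    lra.
  have [|-> _ _] := ge1 (N n * l + c1 n); first by apply: big; have := mpos n; lra.
  have [|-> _ _] := ge1 (N n * l + c2 n); first by apply: big; have := mpos n; lra.
  have [|-> _ _] := ge1 (N n * l + c3 n); first exact: big.
  (* To the right of the tent all three ramps are linear. Their second difference vanishes, and the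
     delays cancel as c - 2 c + c. *)
  by rewrite /c1 /c2 /c3; ring.
- move=> n l l0; rewrite /psi normrM gtr0_norm ?invr_gt0// ler_pdivrMl//.
  have h d : 0 <= d -> 0 <= P (N n * l + - (N n * d)) <= N n * l.
    move=> d0; rewrite P0/=; apply: Pmax; first by rewrite mulr_ge0// ltW.
    by rewrite gerDl oppr_le0 mulr_ge0// ltW.
  have /andP[h1 h1'] : 0 <= P (N n * l + c1 n) <= N n * l by apply: h; exact: ltW.
  have /andP[h2 h2'] : 0 <= P (N n * l + c2 n) <= N n * l.
    by apply: h; have := mpos n; lra.
  have /andP[h3 h3'] : 0 <= P (N n * l + c3 n) <= N n * l.
    by apply: h; have := mpos n; lra.
  by rewrite ler_norml; apply/andP; split; lra.
- move=> n l; rewrite dpsi; case: ltP => al; last first.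
    have [|_ -> _] := le0 (N n * l + c1 n).
      by rewrite /c1 -mulrBr pmulr_rle0// subr_le0.
    have [|_ -> _] := le0 (N n * l + c2 n).
      by rewrite /c2 -mulrBr pmulr_rle0// subr_le0 (le_trans al)// ltW.
    have [|_ -> _] := le0 (N n * l + c3 n).
      rewrite /c3 -mulrBr pmulr_rle0//; have := mpos n; lra.
    by rewrite !mulr0 !addr0 normr0.
  have /andP[? ?] := B01 (N n * l + c1 n).
  have /andP[? ?] := B01 (N n * l + c2 n).
  have /andP[? ?] := B01 (N n * l + c3 n).
  by rewrite mulr1 ler_norml; apply/andP; split; lra.
- move=> l; have far : \forall n \near \oo, l <= m n.
    near=> n; rewrite /m -lerBlDl; apply: (@le_trans _ _ n%:R).
      by near: n; exact: nbhs_infty_ger.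
    by rewrite ler_nat.
  have zero n d : l <= d -> P (N n * l + - (N n * d)) = 0 /\ B (N n * l + - (N n * d)) = 0.
    move=> ld; have [|-> -> _] := le0 (N n * l + - (N n * d)) => //.
    by rewrite -mulrBr pmulr_rle0// subr_le0.
  have [al|la] := ltP a l; last first.
    rewrite max_r ?subr_le0//; split; apply: cvg_near_cst; near=> n.
      rewrite /psi (zero n _ la).1 (zero n (m n) _).1 ?(zero n (2 * m n - a) _).1.
      + by rewrite mulr0 !addr0 mulr0.
      + by have := mpos n; lra.
      + by rewrite (le_trans la)// ltW.
    rewrite dpsi (zero n _ la).2 (zero n (m n) _).2 ?(zero n (2 * m n - a) _).2.
    + by rewrite mulr0 !addr0.
    + by have := mpos n; lra.
    + by rewrite (le_trans la)// ltW.
  have near1 : \forall n \near \oo, 1 <= N n * l + c1 n.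
    near=> n; rewrite /c1 -mulrBr -ler_pdivrMr ?subr_gt0//.
    apply: (@le_trans _ _ n%:R); first by near: n; exact: nbhs_infty_ger.
    by rewrite ler_nat.
  rewrite max_l ?subr_ge0 ?(ltW al)//; split.
    (* For large n only the first ramp is active at l, and past its rounded part, so that psi n l =
       (l - a) - c / N. *)
    have h : (fun n => (l - a) - c * (N n)^-1) @ \oo --> l - a.
      rewrite -[X in _ --> X]subr0; apply: cvgB; first exact: cvg_cst.
      rewrite -(mulr0 c); apply: cvgM; first exact: cvg_cst.
      exact: cvg_harmonic.
    apply: cvg_trans h; apply: near_eq_cvg; near=> n.
    have lm : l <= m n by near: n.
    rewrite /psi (zero n _ lm).1 (zero n (2 * m n - a) _).1; last by have := mpos n; lra.
    have [|-> _ _] := ge1 (N n * l + c1 n); first by near: n.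
    by rewrite /c1; field.
  apply: cvg_near_cst; near=> n.
  have lm : l <= m n by near: n.
  rewrite dpsi (zero n _ lm).2 (zero n (2 * m n - a) _).2; last by have := mpos n; lra.
  have [|_ -> _] := ge1 (N n * l + c1 n); first by near: n.
  by rewrite mulr0 !addr0.
Unshelve. all: by end_near. Qed.

End space_cutoff.

(** * Densities whose integrals over rays vanish *)

Section vanishing_on_rays.
Local Open Scope ereal_scope.
Context {R : realType}.
Notation mR := (measurableTypeR R).
Variable mu : {measure set mR -> \bar R}.

Let D : set mR := `]0%R, +oo[%classic.
Let mD : measurable D. Proof. exact: measurable_itv. Qed.

(** The approach is from above because (b, +oo) is the union of the rays (a n, +oo) with a n > b. *)
Lemma cvg_integral_rays (h : mR -> \bar R) (a : nat -> R) (b : R) :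
  mu.-integrable D h -> (0 <= b)%R -> (forall n, b < a n)%R ->
  (a n @[n --> \oo] --> b)%R ->
  (forall n, \int[mu]_(l in `]a n, +oo[) h l = 0) ->
  \int[mu]_(l in `]b, +oo[) h l = 0.
Proof.
move=> ih b0 ba ab h0.
have bD : `]b, +oo[ `<=` D by apply: subset_itvr; rewrite bnd_simp.
have mb : measurable (`]b, +oo[%classic : set mR) by exact: measurable_itv.
have ma n : measurable (`]a n, +oo[%classic : set mR) by exact: measurable_itv.
have ihb : mu.-integrable `]b, +oo[ h by exact: (integrableS mD mb bD).
have mhb : measurable_fun `]b, +oo[ h by have /integrableP[] := ihb.
have [//|||//| |_ _] := @dominated_convergence _ _ _ mu _ mb
  (fun n => h \_ `]a n, +oo[) h (abse \o h).
- move=> n; apply/measurable_restrict => //.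
  by apply: measurable_funS mhb => //; exact: subIsetl.
- exact: mhb.
- apply: aeW => l; rewrite /= in_itv/= andbT => bl.
  apply: cvg_near_cst; near=> n; rewrite patchE ifT// inE/= in_itv/= andbT.
  by near: n; apply: (cvgr_lt b).
- exact: integrable_abse.
- apply: aeW => l n _; rewrite patchE; case: ifPn => // _.
  by change (`|0 : \bar R| <= `|h l|); rewrite abse0.
- rewrite (_ : (fun n => _) = cst 0).
    by move=> /(cvg_lim (@ereal_hausdorff R)); rewrite lim_cst.
  apply/funext => n; rewrite -(h0 n) -integral_mkcondr; congr (integral _ _ _).
  by apply: setIidr; apply: subset_itvr; rewrite bnd_simp ltW.
Unshelve. all: by end_near. Qed.

(** A pi-lambda argument for a signed density: integrability of [h] permits complements and
    countable disjoint unions. It gives zero integral over every Borel subset of [D]. *)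
Lemma ae_eq0_rays (h : mR -> \bar R) : mu.-integrable D h ->
  (forall a : R, (0 <= a)%R -> \int[mu]_(l in `]a, +oo[) h l = 0) ->
  ae_eq mu D h (cst 0).
Proof.
move=> ih h0.
have mh : measurable_fun D h by have /integrableP[] := ih.
have intD E : measurable E -> \int[mu]_(l in E `&` D) h l = 0.
  rewrite RGenOInfty.measurableE => sE.
  pose P := [set E : set mR | \int[mu]_(l in E `&` D) h l = 0].
  change (P E); move: E sE; apply: dynkin_induction.
  - exact: RGenOInfty.measurableE.
  - move=> _ _ [x ->] [y ->]; exists (Num.max x y)%R.
    by rewrite /= predeqE => z /=; rewrite !in_itv/= !andbT gt_max; split => /andP.
  - by rewrite /P/= setTI h0.
  - move=> _ [y ->]; rewrite /P/=.
    rewrite (_ : _ `&` _ = `](Num.max y 0)%R, +oo[%classic); last first.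
      by rewrite /D predeqE => z /=; rewrite !in_itv/= !andbT gt_max; split => /andP.
    by rewrite h0// le_max lexx orbT.
  - move=> S mS; rewrite /P/= => PS.
    have mSD : measurable (S `&` D) by exact: measurableI.
    have mCD : measurable (~` S `&` D) by apply: measurableI => //; exact: measurableC.
    have : \int[mu]_(l in (S `&` D) `|` (~` S `&` D)) h l = 0.
      by rewrite -setIUl setUv setTI h0.
    rewrite integral_setU//.
    + by rewrite PS add0e.
    + by rewrite -setIUl setUv setTI.
    + apply/disj_setPS => x [[Sx _] [/(_ Sx)[]]].
  - move=> F mF tF; rewrite /P/= => PF; rewrite setI_bigcupl.
    rewrite integral_bigcup//.
    + by apply: eseries0 => i _ _; exact: PF.
    + exact: trivIset_setIr.
    + by move=> i; exact: measurableI.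
    + by apply: (integrableS mD) => //; [apply: bigcup_measurable => k _; exact: measurableI|rewrite -setI_bigcupl; exact: subIsetr].
apply: (integral_ae_eq mD ih); first exact: measurable_cst.
move=> E ED mE; rewrite integral0 -(setIidl ED); exact: intD.
Qed.

Lemma ae_eq0_rational_rays (h : mR -> \bar R) : mu.-integrable D h ->
  (forall i j : nat, \int[mu]_(l in `](i.+1%:R / j.+1%:R)%R, +oo[) h l = 0) ->
  ae_eq mu D h (cst 0).
Proof.
move=> ih h0; apply: ae_eq0_rays => // b b0.
(* With this numerator, (i + 1) / (j + 1) is the least fraction of denominator j + 1 strictly above
   b, and it exceeds b by at most 1 / (j + 1). *)
pose i j := Num.truncn (b * j.+1%:R).
have j0 j : (0 < j.+1%:R :> R)%R by rewrite ltr0n.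
have hi j : ((i j)%:R <= b * j.+1%:R < (i j).+1%:R)%R.
  by apply: truncn_itv; rewrite mulr_ge0.
apply: (@cvg_integral_rays h (fun j => (i j).+1%:R / j.+1%:R)%R b ih b0).
- by move=> j; have /andP[_] := hi j; rewrite ltr_pdivlMr.
- have hb : (fun j => b + j.+1%:R^-1)%R @ \oo --> b.
    rewrite -[X in _ --> X]addr0; apply: cvgD; first exact: cvg_cst.
    exact: cvg_harmonic.
  apply: (squeeze_cvgr _ (cvg_cst b) hb); near=> j.
  have /andP[h1 h2] := hi j.
  apply/andP; split; first by rewrite ler_pdivlMr// ltW.
  by rewrite ler_pdivrMr// mulrDl mulVf ?gt_eqF// -natr1 lerD2r.
- by move=> j; exact: h0.
Unshelve. all: by end_near. Qed.

End vanishing_on_rays.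

Lemma derive1_off_itv (R : realType) (f : R -> R) (a b l : R) :
  (forall x, x \notin `[a, b] -> f x = 0) -> l \notin `[a, b] -> derive1 f l = 0.
Proof.
move=> f0 lab.
rewrite derive1E (near_eq_derive (g := cst 0)) ?derive_cst//.
move: lab; rewrite in_itv/= negb_and -!ltNge => /orP[h|h]; near=> u; apply: f0;
  rewrite in_itv/= negb_and -!ltNge; apply/orP; [left|right]; near: u.
  exact: lt_nbhsl.
exact: lt_nbhsr.
Unshelve. all: by end_near. Qed.

Lemma powR_le1D (R : realType) (l p : R) : 0 < l -> 0 <= p <= 1 -> l `^ p <= 1 + l.
Proof.
move=> l0 /andP[p0 p1]; have [l1|l1] := leP l 1.
  apply: (@le_trans _ _ 1); last by rewrite lerDl ltW.
  have <- : 1 `^ p = 1 :> R by rewrite powR1.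
  by apply: ge0_ler_powR => //; rewrite nnegrE// ltW.
apply: (@le_trans _ _ (l `^ 1)); first by rewrite ler_powR// ltW.
by rewrite powRr1 ?(ltW l0)// lerDr.
Qed.

(** * The flux through a ray *)

Section ray_flux.
Context {R : realType} (alpha rho T : R).
Notation mR := (measurableTypeR R).
Variable nu : R.-sfker mR ~> mR.
Hypothesis alpha01 : 0 <= alpha <= 1.
Hypothesis T0 : 0 < T.
Hypothesis Mnu : forall t, in_M rho (nu t).
Hypothesis cnu : forall phi : R -> R, Cc_pos phi ->
  continuous (fun t => \int[nu t]_(l in `]0, +oo[) phi l : R).

Let D : set mR := `]0%R, +oo[%classic.
Let mD : measurable D. Proof. exact: measurable_itv. Qed.

Lemma in_M_cvg (f : nat -> R -> R) (g : R -> R) (C : R) t :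
  (forall n, measurable_fun [set: mR] (f n)) -> measurable_fun [set: mR] g ->
  (forall n l, 0 < l -> `|f n l| <= C * l) ->
  (forall l, f n l @[n --> \oo] --> g l) ->
  \int[nu t]_(l in `]0, +oo[) f n l @[n --> \oo] --> \int[nu t]_(l in `]0, +oo[) g l.
Proof.
move=> mf mg fC fg.
have gC l : 0 < l -> `|g l| <= C * l.
  move=> l0; have h : `|f n l| @[n --> \oo] --> `|g l| by apply: cvg_norm; exact: fg.
  rewrite -(cvg_lim (@Rhausdorff R) h); apply: limr_le.
    by apply/cvg_ex; exists `|g l|.
  by apply: nearW => n; exact: fC.
have iC : (nu t).-integrable D (fun l => (C * l)%:E).
  apply: (in_M_integrable Mnu (C := `|C|)); first exact: measurable_funM.
  by move=> l l0; rewrite normrM (gtr0_norm l0).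
have fint n : (\int[nu t]_(l in D) (f n l)%:E)%E \is a fin_num.
  by apply: integrable_fin_num => //; exact: (in_M_integrable Mnu _ (mf n) (fC n)).
have gint : (\int[nu t]_(l in D) (g l)%:E)%E \is a fin_num.
  by apply: integrable_fin_num => //; exact: (in_M_integrable Mnu _ mg gC).
apply: fine_cvg; rewrite fineK//.
have [//|||//| |_ _] := @dominated_convergence _ _ _ (nu t) _ mD
  (fun n l => (f n l)%:E) (fun l => (g l)%:E) (fun l => (C * l)%:E).
- by move=> n; apply/measurable_EFinP; exact: measurable_funTS.
- by apply/measurable_EFinP; exact: measurable_funTS.
- by apply: aeW => l _; apply/cvg_EFin; [exact: nearW|exact: fg].
- apply: aeW => l n; rewrite /D /= in_itv/= andbT => l0.
  by rewrite lee_fin fC.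
- exact.
Qed.

Variable w : R -> R -> R.
Hypothesis mw : measurable_fun [set: mR * mR] (fun p => w p.1 p.2).
Hypothesis Aw : (\int[lebesgue R]_(t in `[0%R, T]) action alpha (nu t) (w t) < +oo)%E.

Lemma measurable_ray (a : R) : measurable_fun [set: mR] (fun l : R => (a < l)%R%:R : R).
Proof.
rewrite (_ : (fun _ => _) = \1_(`]a, +oo[%classic : set mR)).
  exact: measurable_indic.
apply/funext => l; rewrite indicE; congr ((nat_of_bool _)%:R).
by apply/idP/idP; rewrite inE/= in_itv/= andbT.
Qed.

Lemma measurable_action : measurable_fun [set: mR * mR]
  (fun p => (p.2 `^ alpha * `|w p.1 p.2| ^+ 2)%:E).
Proof.
apply/measurable_EFinP; apply: measurable_funM; last first.
  by apply: measurable_funX; exact: measurableT_comp.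
by apply: (@measurableT_comp _ _ _ _ _ _ (@powR R ^~ alpha)) => //; exact: measurable_powR.
Qed.

(** For l > a one has l^alpha |w| <= l^alpha + l^alpha |w|^2 and l^alpha <= 1 + l <= (1/a + 1) l.
    The first moment bounds one term and the action the other, over a bounded time interval. *)
Lemma flux_ray_lty (a : R) (A : set mR) : 0 < a -> measurable A -> A `<=` `[0, T] ->
  (\int[lebesgue R]_(t in A) \int[nu t]_(l in `]0%R, +oo[)
     `|(l `^ alpha * w t l * (a < l)%R%:R)%:E| < +oo)%E.
Proof.
move=> a0 mA AT.
pose C : R := a^-1 + 1.
have C0 : 0 < C by rewrite addr_gt0// invr_gt0.
pose g (p : mR * mR) := (`|C * p.2|%:E + (p.2 `^ alpha * `|w p.1 p.2| ^+ 2)%:E)%E.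
have mC : measurable_fun [set: mR] (fun l : R => C * l) by exact: measurable_funM.
have mg : measurable_fun [set: mR * mR] g.
  apply: emeasurable_funD; last exact: measurable_action.
  apply/measurable_EFinP; apply: measurableT_comp => //.
  by apply: measurable_funM => //; exact: measurable_snd.
apply: (@le_lt_trans _ _ (\int[lebesgue R]_(t in A) \int[nu t]_(l in D) g (t, l))%E).
  apply: (le_iter_integral nu _ mA mD
    (f := fun p => `|(p.2 `^ alpha * w p.1 p.2 * (a < p.2)%R%:R)%:E|%E)) => //.
    apply: measurableT_comp => //; apply/measurable_EFinP.
    exact: (measurable_flux alpha mw (measurable_ray a)).
  move=> t l _ Dl; rewrite abse_ge0/= /g/=.
  have l0 : 0 < l by move: Dl; rewrite /D /= in_itv/= andbT.
  rewrite -EFinD lee_fin; have [al|la] := ltP a l; last first.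
    by rewrite mulr0 normr0 addr_ge0 ?normr_ge0// mulr_ge0 ?powR_ge0// sqr_ge0.
  rewrite mulr1 normrM (ger0_norm (powR_ge0 _ _)) (ger0_norm (ltW (mulr_gt0 C0 l0))).
  have la1 : 1 <= a^-1 * l by rewrite ler_pdivlMl// mulr1 ltW.
  have hp : l `^ alpha <= C * l.
    apply: (le_trans (powR_le1D l0 alpha01)).
    by rewrite /C mulrDl mul1r lerD2r.
  have hw : `|w t l| <= 1 + `|w t l| ^+ 2.
    have := sqr_ge0 (`|w t l| - 2^-1); rewrite expr2; nra.
  apply: (@le_trans _ _ (l `^ alpha * (1 + `|w t l| ^+ 2))).
    by rewrite ler_wpM2l// powR_ge0.
  by rewrite mulrDr mulr1 lerD2r.
have intE t : (\int[nu t]_(l in D) g (t, l) =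
    \int[nu t]_(l in `]0%R, +oo[) `|C * l|%:E + action alpha (nu t) (w t))%E.
  rewrite /g ge0_integralD//=.
  - by apply/measurable_EFinP; apply: measurable_funTS; apply: measurableT_comp.
  - by move=> l _; rewrite lee_fin mulr_ge0 ?powR_ge0// sqr_ge0.
  - exact: (measurable_fun_section t measurable_action).
have mact : measurable_fun [set: mR] (fun t => action alpha (nu t) (w t)).
  exact: (measurable_fun_kernel nu mD measurable_action).
under eq_integral => t _ do rewrite intE.
have act0 t : (0 <= action alpha (nu t) (w t))%E.
  by apply: integral_ge0 => l _; rewrite lee_fin mulr_ge0 ?powR_ge0// sqr_ge0.
apply: (@le_lt_trans _ _ (\int[lebesgue R]_(t in A) ((`|C| * rho)%:E + action alpha (nu t) (w t)))%E).
  apply: ge0_le_integral => //.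
  - by move=> t _; apply: adde_ge0 => //; exact: integral_ge0.
  - apply: emeasurable_funD; last exact: measurable_funTS.
    apply: measurable_funTS; apply: (measurable_fun_kernel nu mD (f := fun p => `|C * p.2|%:E)).
    apply/measurable_EFinP; apply: measurableT_comp => //.
    by apply: measurable_funM => //; exact: measurable_snd.
  - by apply: emeasurable_funD => //; exact: measurable_funTS.
  - move=> t _; rewrite leeD2r//; apply: in_M_int_le => // l l0.
    by rewrite normrM (gtr0_norm l0).
have rho0 : 0 <= rho.
  have [_ Mrho] := Mnu 0; rewrite -lee_fin -Mrho; apply: integral_ge0 => l.
  by rewrite /= in_itv/= andbT => /ltW; rewrite lee_fin.
rewrite ge0_integralD//; last 2 first.
- by move=> t _; rewrite lee_fin mulr_ge0.
- exact: measurable_funTS.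
rewrite lte_add_pinfty//.
  rewrite integral_cst// lte_mul_pinfty ?lee_fin ?mulr_ge0//.
  apply: (@le_lt_trans _ _ (lebesgue R `[0, T]%classic)).
    by apply: le_measure; rewrite ?inE.
  by rewrite lebesgue_measure_itv/= lte_fin T0 -EFinB ltry.
apply: le_lt_trans Aw; apply: ge0_subset_integral => //.
exact: measurable_funTS.
Qed.

Hypothesis CEw : forall phi : R * R -> R, test_function T phi ->
    (\int[lebesgue R]_(t in `]0%R, T[) \int[nu t]_(l in `]0%R, +oo[)
       (partial_t phi (t, l) + l `^ alpha * w t l * partial_l phi (t, l))%:E
     = 0)%E.

(** The limit of [time_integrated] along the functions of [space_cutoff]: 4 l dominates the boundary
    terms, and 4 times the absolute flux on the ray dominates the flux term. *)
Lemma ray_flux (a : R) : 0 < a ->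
  (\int[lebesgue R]_(t in `]0%R, T[) \int[nu t]_(l in `]0%R, +oo[)
     (l `^ alpha * w t l * (a < l)%R%:R)%:E =
   (\int[nu T]_(l in `]0, +oo[) Num.max (l - a) 0 -
    \int[nu 0]_(l in `]0, +oo[) Num.max (l - a) 0)%:E)%E.
Proof.
move=> a0; have [psi [spsi psi0 psiC psi'C psicvg]] := space_cutoff a0.
have mA : measurable (`]0, T[%classic : set mR) by exact: measurable_itv.
have AT : (`]0, T[ `<=` `[0, T]) by exact: subset_itv_oo_cc.
have mpsi n : measurable_fun [set: mR] (psi n).
  by apply: measurable_continuous; exact: smooth_continuous.
have mpsi' n : measurable_fun [set: mR] (derive1 (psi n)).
  by apply: measurable_continuous; apply: smooth_continuous; exact: smooth_derive.
have mmax : measurable_fun [set: mR] (fun l : R => Num.max (l - a) 0).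
  by apply: measurable_maxr => //; exact: measurable_funB.
pose g (p : mR * mR) := (4%:E * `|(p.2 `^ alpha * w p.1 p.2 * (a < p.2)%R%:R)%:E|)%E.
have mray := measurable_flux alpha mw (measurable_ray a).
have mg : measurable_fun [set: mR * mR] g.
  apply: emeasurable_funM => //; apply: measurableT_comp => //.
  exact/measurable_EFinP.
have psi_le n t l : (`|(l `^ alpha * w t l * derive1 (psi n) l)%:E| <= g (t, l))%E.
  rewrite /g /= -EFinM lee_fin !normrM mulrCA ler_wpM2l ?mulr_ge0//.
  by rewrite (ger0_norm (ler0n _ _)).
have glty : (\int[lebesgue R]_(t in `]0%R, T[) \int[nu t]_(l in D) g (t, l) < +oo)%E.
  have h := flux_ray_lty a0 mA AT.
  under eq_integral => t _.
    rewrite /g ge0_integralZl//; last first.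
      by apply: measurableT_comp => //; exact: (measurable_fun_section t ((measurable_EFinP _ _).2 mray)).
    over.
  rewrite ge0_integralZl//; last first.
  - by move=> t _; exact: integral_ge0.
  - apply: measurable_funTS; apply: (measurable_fun_kernel nu mD
      (f := fun p => `|(p.2 `^ alpha * w p.1 p.2 * (a < p.2)%R%:R)%:E|%E)).
    by apply: measurableT_comp => //; exact/measurable_EFinP.
  by rewrite lte_mul_pinfty.
have step n := @time_integrated _ alpha rho T nu Mnu cnu w mw CEw (psi n) a
  (sval (cid (psi0 n))) 4 0 T (spsi n) a0 (svalP (cid (psi0 n))) (psiC n) (lexx 0) T0 (lexx T).
have {}step n : (\int[lebesgue R]_(t in `]0%R, T[) \int[nu t]_(l in D)
     (l `^ alpha * w t l * derive1 (psi n) l)%:E =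
   (\int[nu T]_(l in `]0, +oo[) psi n l - \int[nu 0]_(l in `]0, +oo[) psi n l)%:E)%E.
  apply: step; apply: le_lt_trans glty.
  apply: (le_iter_integral nu _ mA mD
    (f := fun p => `|(p.2 `^ alpha * w p.1 p.2 * derive1 (psi n) p.2)%:E|%E)) => //.
    by apply: measurableT_comp => //; apply/measurable_EFinP; exact: measurable_flux.
  by move=> t l _ _; rewrite abse_ge0/=; exact: psi_le.
have cvgL : (\int[lebesgue R]_(t in `]0%R, T[) \int[nu t]_(l in D)
     (l `^ alpha * w t l * derive1 (psi n) l)%:E)%E @[n --> \oo] -->
   (\int[lebesgue R]_(t in `]0%R, T[) \int[nu t]_(l in D)
     (l `^ alpha * w t l * (a < l)%R%:R)%:E)%E.
  apply: (iter_dominated_convergence mA mD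
    (f_ := fun n p => (p.2 `^ alpha * w p.1 p.2 * derive1 (psi n) p.2)%:E)
    (f := fun p => (p.2 `^ alpha * w p.1 p.2 * (a < p.2)%R%:R)%:E) (g := g)) => //.
  - by move=> n; apply/measurable_EFinP; exact: measurable_flux.
  - exact/measurable_EFinP.
  - move=> t l _ _; apply/cvg_EFin; first exact: nearW.
    by apply: cvgM; [exact: cvg_cst|have [] := psicvg l].
have cvgR : ((\int[nu T]_(l in `]0, +oo[) psi n l - \int[nu 0]_(l in `]0, +oo[) psi n l)%:E)%E @[n --> \oo] -->
   (\int[nu T]_(l in `]0, +oo[) Num.max (l - a) 0 -
    \int[nu 0]_(l in `]0, +oo[) Num.max (l - a) 0)%:E.
  apply/cvg_EFin; first exact: nearW.
  by apply: cvgB; apply: in_M_cvg mpsi mmax psiC _ => l; have [] := psicvg l.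
rewrite -(cvg_lim (@ereal_hausdorff R) cvgL) -(cvg_lim (@ereal_hausdorff R) cvgR).
by congr (limn _); apply/funext => n; exact: step.
Qed.

End ray_flux.

(** Integrability is assumed only away from 0 and T, as befits a distributional flux. On each [I k]
    the result on rays applies to f - g extended by zero, because a ray meets [I k] in an
    interval. *)
Lemma ae_eq_intervals (R : realType) (T : R) (f g : R -> \bar R) :
  measurable_fun [set: measurableTypeR R] f -> measurable_fun [set: measurableTypeR R] g ->
  (forall s1 s2 : R, 0 < s1 -> s1 < s2 -> s2 < T ->
    [/\ (lebesgue R).-integrable `]s1, s2[ f, (lebesgue R).-integrable `]s1, s2[ g &
    \int[lebesgue R]_(t in `]s1, s2[) f t = \int[lebesgue R]_(t in `]s1, s2[) g t]%E) ->
  {ae lebesgue R, forall t, t \in `]0, T[ -> f t = g t}.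
Proof.
move=> mf mg fg.
pose D : set (measurableTypeR R) := `]0%R, +oo[%classic.
have mD : measurable D by exact: measurable_itv.
pose I k : set (measurableTypeR R) := `]k.+1%:R^-1, (T - k.+1%:R^-1)[%classic.
have mI k : measurable (I k) by exact: measurable_itv.
have k0 k : 0 < k.+1%:R^-1 :> R by rewrite invr_gt0.
have ID k : I k `<=` D.
  by move=> t; rewrite /I /D /= !in_itv/= => /andP[/(lt_trans (k0 k)) ->].
have main k : ae_eq (lebesgue R) (I k) f g.
  have [kT|kT] := ltP k.+1%:R^-1 (T - k.+1%:R^-1); last first.
    apply: aeW => t; rewrite /I /= in_itv/= => /andP[h1 h2].
    by have := lt_trans h1 h2; rewrite ltNge kT.
  have [|if_ ig _] := fg _ _ (k0 k) kT; first by rewrite gtrBl.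
  have mfg : measurable_fun (I k) (f \- g)%E.
    by apply: emeasurable_funB; exact: measurable_funTS.
  have ifg : (lebesgue R).-integrable (I k) (f \- g)%E by exact: integrableB.
  have ih : (lebesgue R).-integrable D ((f \- g)%E \_ (I k)).
    by apply/integrable_restrict => //; rewrite setIidr.
  have h0 (a : R) : 0 <= a ->
      (\int[lebesgue R]_(l in `]a, +oo[) ((f \- g)%E \_ (I k)) l = 0)%E.
    move=> a0; rewrite -integral_mkcondr.
    have -> : `]a, +oo[ `&` I k = `](Num.max a k.+1%:R^-1), (T - k.+1%:R^-1)[%classic.
      rewrite predeqE => z; rewrite /I /= !in_itv/= andbT gt_max.
      by split=> [[-> ->//]|/andP[/andP[-> -> ->]]].
    have [aT|aT] := ltP (Num.max a k.+1%:R^-1) (T - k.+1%:R^-1); last first.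
      rewrite set_itv_ge ?integral_set0//.
      by rewrite bnd_simp -leNgt.
    have [|||jf jg fgE] := fg (Num.max a k.+1%:R^-1) (T - k.+1%:R^-1).
    - by rewrite lt_max k0 orbT.
    - exact: aT.
    - by rewrite gtrBl.
    rewrite /= (integralB _ jf jg); last exact: measurable_itv.
    rewrite fgE subee//; apply: integrable_fin_num jg; exact: measurable_itv.
  have := ae_eq0_rays ih h0.
  apply: filterS2 (integrable_ae (mI k) if_) => t ft ht It.
  have := ht (ID k t It); rewrite /= patchE mem_set// => /eqP.
  have := ft It; case: (f t) => [r| |]// _; case: (g t) => [r'| |]//.
  by rewrite -EFinB eqe subr_eq0 => /eqP ->.
have /ae_foralln : forall k, {ae lebesgue R, forall t, I k t -> f t = g t} by exact: main.
apply: filterS => t h; rewrite in_itv/= => /andP[t0 tT].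
have [i it] := ltr_add_invr t0.
have [j jt] := ltr_add_invr tT.
apply: (h (maxn i j)); rewrite /I /= in_itv/=; apply/andP; split.
  apply: le_lt_trans it; rewrite add0r lef_pV2 ?posrE ?ltr0n// ler_nat.
  by rewrite ltnS leq_maxl.
rewrite ltrBrDr; apply: le_lt_trans jt; rewrite lerD2l lef_pV2 ?posrE ?ltr0n// ler_nat.
by rewrite ltnS leq_maxr.
Qed.

(** * Uniqueness of the velocity *)

Section velocity_uniqueness.
Context {R : realType} (alpha rho T : R).
Notation mR := (measurableTypeR R).
Variable nu : R.-sfker mR ~> mR.
Hypothesis Mnu : forall t, in_M rho (nu t).
Hypothesis cnu : forall phi : R -> R, Cc_pos phi ->
  continuous (fun t => \int[nu t]_(l in `]0, +oo[) phi l : R).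

Let D : set mR := `]0%R, +oo[%classic.
Let mD : measurable D. Proof. exact: measurable_itv. Qed.

(** [derive1 psi] vanishes off [a, b], and [s1, s2] times [a, b] is compact in spacetime, so the
    local finiteness clause of [continuity_equation] applies. This forces s1 and s2 strictly inside
    (0, T). *)
Lemma locally_finite_flux (v : R -> R -> R) (psi : R -> R) (a b s1 s2 : R) :
  measurable_fun [set: mR * mR] (fun p => v p.1 p.2) ->
  continuity_equation alpha T nu v ->
  0 < a -> 0 < s1 -> s1 < s2 -> s2 < T ->
  (forall l, l \notin `[a, b] -> psi l = 0) ->
  continuous (derive1 psi) ->
  (forall l, `|derive1 psi l| <= 4) ->
  (\int[lebesgue R]_(t in `]s1, s2[) \int[nu t]_(l in `]0%R, +oo[)
     `|(l `^ alpha * v t l * derive1 psi l)%:E| < +oo)%E.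
Proof.
move=> mv [hloc _] a0 s10 s12 s2T psi0 cpsi' psi'4.
pose S : set mR := `[s1, s2]%classic; pose L : set mR := `[a, b]%classic.
have mS : measurable S by exact: measurable_itv.
have mL : measurable L by exact: measurable_itv.
pose flux (p : mR * mR) : \bar R := `|p.2 `^ alpha * v p.1 p.2|%:E.
have mflux : measurable_fun [set: mR * mR] flux.
  apply/measurable_EFinP; apply: measurableT_comp => //; apply: measurable_funM => //.
  by apply: (@measurableT_comp _ _ _ _ _ _ (@powR R ^~ alpha)) => //; exact: measurable_powR.
have flux0 p : (0 <= flux p)%E by rewrite lee_fin.
have LD : L `<=` D.
  by move=> l; rewrite /L /D /= !in_itv/= => /andP[/(lt_le_trans a0) ->].
have key : (\int[lebesgue R]_(t in S) \int[nu t]_(l in L) flux (t, l) < +oo)%E.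
  have cSL : compact (S `*` L) by apply: compact_setX; exact: segment_compact.
  have sub : S `*` L `<=` spacetime T.
    move=> [t l] [] /=; rewrite /S/= in_itv/= => /andP[h1 h2] Ll.
    split; last exact: LD Ll.
    by rewrite /= in_itv/= (lt_le_trans s10 h1) (le_lt_trans h2 s2T).
  apply: le_lt_trans (hloc _ cSL sub); rewrite le_eqVlt; apply/orP; left; apply/eqP/esym.
  transitivity (\int[lebesgue R]_(t in `]0%R, T[)
      ((fun t => \int[nu t]_(l in L) flux (t, l)) \_ S) t)%E.
    apply: eq_integral => t _; rewrite patchE; case: ifPn => tS.
      congr (integral _ _ _); rewrite xsectionE predeqE => l /=; split => [[]//|Ll].
      by split => //=; exact: set_mem.
    rewrite (_ : xsection _ _ = set0) ?integral_set0// xsectionE predeqE => l /=.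
    by split => // -[/mem_set]; rewrite (negPf tS).
  rewrite -integral_mkcondr; congr (integral _ _ _); apply: setIidr.
  by move=> t; rewrite /S/= !in_itv/= => /andP[h1 h2]; rewrite (lt_le_trans s10 h1) (le_lt_trans h2 s2T).
have msec t : measurable_fun D (fun l => flux (t, l)) by exact: measurable_fun_section.
have mkey : measurable_fun [set: mR] (fun t => \int[nu t]_(l in L) flux (t, l))%E.
  exact: measurable_fun_kernel.
apply: (@le_lt_trans _ _ (\int[lebesgue R]_(t in `]s1, s2[) (4%:E * \int[nu t]_(l in L) flux (t, l)))%E).
  apply: ge0_le_integral => //.
  - by move=> t _; exact: integral_ge0.
  - apply: measurable_funTS.
    apply: (measurable_fun_kernel nu mD (f := fun p => `|(p.2 `^ alpha * v p.1 p.2 * derive1 psi p.2)%:E|%E)).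
    apply: measurableT_comp => //; apply/measurable_EFinP; apply: measurable_flux => //.
    exact: measurable_continuous.
  - by apply: measurable_funTS; exact: emeasurable_funM.
  - move=> t _.
    have msecL : measurable_fun L (fun l => flux (t, l)).
      exact: measurable_funS mD LD (msec t).
    rewrite -(ge0_integralZl (nu t) mL msecL)//.
    rewrite [leRHS](_ : _ = \int[nu t]_(l in D) ((fun l => 4%:E * flux (t, l)) \_ L) l)%E; last first.
      by rewrite -integral_mkcondr setIidr.
    apply: ge0_le_integral => //.
    + apply: measurable_funTS; apply: measurableT_comp => //; apply/measurable_EFinP.
      have h := measurable_flux alpha mv (measurable_continuous cpsi').
      exact: (measurableT_comp h (measurable_pair1 t)).
    + apply/measurable_restrict => //; apply: emeasurable_funM => //.
      by apply: measurable_funS (msec t) => //; exact: subIsetl.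
    + move=> l _; rewrite patchE; case: ifPn => [_|lL].
        by rewrite /flux /= -EFinM lee_fin normrM mulrC ler_wpM2r.
      rewrite (derive1_off_itv psi0); last by apply: contra lL => lL; rewrite inE.
      by rewrite mulr0 abse0; change (0 <= 0 :> \bar R)%E.
rewrite ge0_integralZl//; last 2 first.
- exact: measurable_funTS.
- by move=> t _; exact: integral_ge0.
rewrite lte_mul_pinfty//; apply: le_lt_trans key.
apply: ge0_subset_integral => //.
- exact: measurable_funTS.
- by move=> t _; exact: integral_ge0.
- exact: subset_itv_oo_cc.
Qed.

(** For each of the countably many [psi i j n], the two fluxes have equal integrals over all time
    intervals inside (0, T), hence agree for almost every t. One null set serves all indices. At a
    remaining t, sending n to infinity replaces psi' by the indicator of a rational ray, with 4 |h|
    as dominating function. *)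
Lemma velocity_unique (v w : R -> R -> R) :
  measurable_fun [set: mR * mR] (fun p => v p.1 p.2) ->
  measurable_fun [set: mR * mR] (fun p => w p.1 p.2) ->
  continuity_equation alpha T nu v -> continuity_equation alpha T nu w ->
  {ae lebesgue R, forall t, t \in `]0, T[ ->
    (nu t).-integrable D (fun l => (l `^ alpha * v t l)%:E)} ->
  {ae lebesgue R, forall t, t \in `]0, T[ ->
    (nu t).-integrable D (fun l => (l `^ alpha * w t l)%:E)} ->
  {ae lebesgue R, forall t, t \in `]0, T[ ->
    {ae nu t, forall l, D l -> w t l = v t l}}.
Proof.
move=> mv mw cev cew iv iw.
pose r (i j : nat) : R := i.+1%:R / j.+1%:R.
have r0 i j : 0 < r i j by rewrite divr_gt0.
pose psi i j := sval (cid (space_cutoff (r0 i j))).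
have psiP i j := svalP (cid (space_cutoff (r0 i j))).
have spsi i j n : smooth (psi i j n) by have [+ _ _ _ _] := psiP i j; exact.
have cpsi' i j n : continuous (derive1 (psi i j n)).
  by apply: smooth_continuous; exact: smooth_derive.
have psi'4 i j n l : `|derive1 (psi i j n) l| <= 4.
  have [_ _ _ + _] := psiP i j => /(_ n l)/le_trans; apply.
  by rewrite -[X in _ <= X]mulr1 ler_wpM2l// lern1 leq_b1.
pose H u i j n t := (\int[nu t]_(l in `]0%R, +oo[)
  (l `^ alpha * u t l * derive1 (psi i j n) l)%:E)%E.
have Heq i j n : {ae lebesgue R, forall t, t \in `]0, T[ -> H v i j n t = H w i j n t}.
  have mH u : measurable_fun [set: mR * mR] (fun p => u p.1 p.2) ->
      measurable_fun [set: mR * mR] (fun p => (p.2 `^ alpha * u p.1 p.2 * derive1 (psi i j n) p.2)%:E).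
    move=> mu_; apply/measurable_EFinP; apply: measurable_flux => //.
    exact: measurable_continuous.
  apply: ae_eq_intervals.
  - exact: (measurable_fun_kernel nu mD (mH v mv)).
  - exact: (measurable_fun_kernel nu mD (mH w mw)).
  - move=> s1 s2 s10 s12 s2T.
    have [_ /(_ n)[b psi0] psiC _ _] := psiP i j.
    have mA : measurable (`]s1, s2[%classic : set mR) by exact: measurable_itv.
    have lv := locally_finite_flux mv cev (r0 i j) s10 s12 s2T psi0 (cpsi' i j n) (psi'4 i j n).
    have lw := locally_finite_flux mw cew (r0 i j) s10 s12 s2T psi0 (cpsi' i j n) (psi'4 i j n).
    have [_ cev2] := cev; have [_ cew2] := cew.
    split.
    + by have [] := iter_integrable mA mD (mH v mv) lv.
    + by have [] := iter_integrable mA mD (mH w mw) lw.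
    + rewrite (time_integrated Mnu cnu mv cev2 (spsi i j n) (r0 i j) psi0 (psiC n) (ltW s10) s12 (ltW s2T) lv).
      by rewrite (time_integrated Mnu cnu mw cew2 (spsi i j n) (r0 i j) psi0 (psiC n) (ltW s10) s12 (ltW s2T) lw).
have {}Heq : {ae lebesgue R, forall t, forall i j n, t \in `]0, T[ -> H v i j n t = H w i j n t}.
  apply: ae_foralln => i; apply: ae_foralln => j; apply: ae_foralln => n; exact: Heq.
have Fae := ae_filter_ringOfSetsType (lebesgue R).
have H1 := @filterI _ _ Fae _ _ Heq iv.
have H2 := @filterI _ _ Fae _ _ H1 iw.
apply: (@filterS _ _ Fae _ _ _ H2) => t [[heq ivt] iwt] tT.
have {}ivt := ivt tT; have {}iwt := iwt tT.
pose h l : \bar R := (l `^ alpha * w t l - l `^ alpha * v t l)%:E.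
have ih : (nu t).-integrable D h by exact: (integrableB mD iwt ivt).
have h0 i j : (\int[nu t]_(l in `](i.+1%:R / j.+1%:R)%R, +oo[) h l = 0)%E.
  have mdpsi n : measurable_fun [set: mR] (derive1 (psi i j n)) by exact: measurable_continuous.
  have mh : measurable_fun D h by have /integrableP[] := ih.
  have zero n : (\int[nu t]_(l in D) (h l * (derive1 (psi i j n) l)%:E) = 0)%E.
    have ibd (g : mR -> R) : (nu t).-integrable D (EFin \o g) ->
        (nu t).-integrable D (fun l => (g l * derive1 (psi i j n) l)%:E).
      move=> ig; apply: (le_integrable mD _ _ (integrableZl mD 4 ig)).
        apply/measurable_EFinP; apply: measurable_funM; last exact: measurable_funTS.
        by apply/measurable_EFinP; have /integrableP[] := ig.
      move=> l _; rewrite /= lee_fin !normrM mulrC ler_wpM2r//.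
      by rewrite (ger0_norm (ler0n _ _)).
    transitivity (H w i j n t - H v i j n t)%E; last first.
      rewrite -(heq i j n tT) subee//; apply: integrable_fin_num => //; exact: ibd ivt.
    rewrite /H -integralB//; [|exact: ibd iwt|exact: ibd ivt].
    by apply: eq_integral => l _; rewrite /h -EFinM -EFinB mulrBl.
  have [//|||//| |_ _] := @dominated_convergence _ _ _ (nu t) _ mD
    (fun n l => (h l * (derive1 (psi i j n) l)%:E)%E)
    (fun l => (h l * ((r i j < l)%R%:R)%:E)%E) (fun l => (4%:E * `|h l|)%E).
  - move=> n; apply: emeasurable_funM => //; apply: measurable_funTS.
    exact/measurable_EFinP.
  - apply: emeasurable_funM => //; apply: measurable_funTS.
    by apply/measurable_EFinP; exact: measurable_ray.
  - apply: aeW => l _; rewrite /h; under eq_fun do rewrite -EFinM; rewrite -EFinM.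
    apply/cvg_EFin; first exact: nearW.
    by apply: cvgM; [exact: cvg_cst|have [_ _ _ _ /(_ l)[]] := psiP i j].
  - by apply: integrableZl => //; exact: integrable_abse.
  - apply: aeW => l n _; rewrite /h -EFinM /= -EFinM lee_fin normrM mulrC.
    by rewrite ler_wpM2r.
  under eq_fun do rewrite zero.
  move=> /(cvg_lim (@ereal_hausdorff R)); rewrite lim_cst// => E; rewrite [RHS]E => {E}.
  have -> : `](i.+1%:R / j.+1%:R)%R, +oo[%classic = D `&` `](r i j), +oo[%classic.
    apply/esym/setIidr; apply: subset_itvr; rewrite bnd_simp; exact: ltW.
  rewrite integral_mkcondr; apply: eq_integral => l _; rewrite patchE.
  case: ifPn => lr.
    by move: lr; rewrite inE/= in_itv/= andbT => ->; rewrite mule1.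
  have -> : (r i j < l)%R = false.
    by apply/negbTE; apply: contra lr => lr; rewrite inE/= in_itv/= andbT.
  by rewrite mule0.
have := ae_eq0_rational_rays ih h0.
apply: filterS => l hl Dl; have := hl Dl; rewrite /h => -[/eqP].
rewrite -mulrBr mulf_eq0 => /orP[|]; last by rewrite subr_eq0 => /eqP.
by rewrite powR_eq0 gt_eqF//; move: Dl; rewrite /D /= in_itv/= andbT.
Qed.

End velocity_uniqueness.

(** * Fubini and Tonelli on measurable rectangles *)

(** The measures nu_t are sigma-finite by a proof and not by their type. Repackaging them makes the
    product measure theorems applicable. *)
Lemma sigma_finite_measureE d (X : measurableType d) (R : realType)
  (m : {measure set X -> \bar R}) : sigma_finite setT m ->
  exists M : {sigma_finite_measure set X -> \bar R}, m = M.
Proof.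
move=> sm.
pose H2 := isSFinite.Build _ _ _ _ (sfinite_measure_sigma_finite sm).
pose H3 := isSigmaFinite.Build _ _ _ _ sm.
pose M := HB.pack_for (SigmaFiniteMeasure.type X R) (Measure.sort m) H2 H3.
by exists M; exact: eq_measure.
Qed.

Section fubini_on_sets.
Local Open Scope ereal_scope.
Context d d' (X : measurableType d) (Y : measurableType d') (R : realType).
Variables (m1 : {measure set X -> \bar R}) (m2 : {measure set Y -> \bar R}).
Hypotheses (s1 : sigma_finite setT m1) (s2 : sigma_finite setT m2).
Variables (A : set X) (B : set Y).
Hypotheses (mA : measurable A) (mB : measurable B).
Variable f : X * Y -> \bar R.
Hypothesis mf : measurable_fun [set: X * Y] f.

Let patch12 (g : X * Y -> \bar R) :
  \int[m1]_(x in A) \int[m2]_(y in B) g (x, y) =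
  \int[m1]_x \int[m2]_y (g \_ (A `*` B)) (x, y).
Proof.
rewrite [LHS]integral_mkcond; apply: eq_integral => x _; rewrite patchE.
case: ifPn => xA; last first.
  rewrite [RHS]integral0_eq// => y _; rewrite patchE ifF//.
  by apply/negbTE; apply: contra xA; rewrite !inE => -[].
rewrite [LHS]integral_mkcond; apply: eq_integral => y _; rewrite !patchE.
congr (if _ then _ else _); apply/idP/idP; rewrite !inE; last by case.
by split => //; exact: set_mem.
Qed.

Let patch21 (g : X * Y -> \bar R) :
  \int[m2]_(y in B) \int[m1]_(x in A) g (x, y) =
  \int[m2]_y \int[m1]_x (g \_ (A `*` B)) (x, y).
Proof.
rewrite [LHS]integral_mkcond; apply: eq_integral => y _; rewrite patchE.
case: ifPn => yB; last first.
  rewrite [RHS]integral0_eq// => x _; rewrite patchE ifF//.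
  by apply/negbTE; apply: contra yB; rewrite !inE => -[].
rewrite [LHS]integral_mkcond; apply: eq_integral => x _; rewrite !patchE.
congr (if _ then _ else _); apply/idP/idP; rewrite !inE; last by case.
by split => //; exact: set_mem.
Qed.

Let mp : measurable_fun [set: X * Y] (f \_ (A `*` B)).
Proof.
apply/(measurable_restrictT _ _).1; first exact: measurableX.
exact: measurable_funTS.
Qed.

Lemma tonelli_on : (forall z, 0 <= f z) ->
  \int[m1]_(x in A) \int[m2]_(y in B) f (x, y) =
  \int[m2]_(y in B) \int[m1]_(x in A) f (x, y).
Proof.
move=> f0; rewrite patch12 patch21.
have [M1 ->] := sigma_finite_measureE s1.
have [M2 ->] := sigma_finite_measureE s2.
apply: (sfinite_Fubini M1 M2 (f \_ (A `*` B)) _ mp) => z.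
by rewrite patchE; case: ifPn.
Qed.

Lemma fubini_on :
  \int[m2]_(y in B) \int[m1]_(x in A) `|f (x, y)| < +oo ->
  \int[m1]_(x in A) \int[m2]_(y in B) f (x, y) =
  \int[m2]_(y in B) \int[m1]_(x in A) f (x, y).
Proof.
rewrite patch12 patch21 (patch21 (abse \o f)).
have [M1 ->] := sigma_finite_measureE s1.
have [M2 ->] := sigma_finite_measureE s2.
move=> flty.
apply: (Fubini (m1 := M1) (m2 := M2)) => //.
apply/(integrable21ltyP M1 M2 mp).
apply: le_lt_trans flty; rewrite le_eqVlt; apply/orP; left; apply/eqP.
apply: eq_integral => y _; apply: eq_integral => x _; rewrite !patchE.
case: ifPn => // _.
by change (`|0 : \bar R| = 0); rewrite abse0.
Qed.

Lemma measurable_integral_on :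
  measurable_fun [set: Y] (fun y => \int[m1]_(x in A) f (x, y)).
Proof.
have [M1 ->] := sigma_finite_measureE s1.
pose g := f \_ (A `*` [set: Y]).
have mg : measurable_fun [set: X * Y] g.
  by apply/(measurable_restrictT _ _).1; [exact: measurableX|exact: measurable_funTS].
rewrite (_ : (fun y => _) = fun y => \int[M1]_x g^\+ (x, y) - \int[M1]_x g^\- (x, y)).
  apply: emeasurable_funB.
    by apply: (@measurable_fun_fubini_tonelli_G _ _ _ _ _ M1 g^\+) => //; exact: measurable_funepos.
  by apply: (@measurable_fun_fubini_tonelli_G _ _ _ _ _ M1 g^\-) => //; exact: measurable_funeneg.
apply/funext => y; rewrite integral_mkcond [LHS]integralE.
have gE x : ((fun x => f (x, y)) \_ A) x = g (x, y).
  rewrite /g !patchE; congr (if _ then _ else _).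
  by apply/idP/idP; rewrite !inE/=; [split|case].
by congr (_ - _); apply: eq_integral => x _; rewrite ?funeposE ?funenegE gE.
Qed.

End fubini_on_sets.

(** * Layer-cake formulas for l^(-gamma) and l^(1 - gamma) *)

Section layer_cake.
Context {R : realType} (gamma : R).
Hypothesis gamma01 : 0 < gamma < 1.
Notation mR := (measurableTypeR R).
Let X : set mR := `]0%R, +oo[%classic.
Let mX : measurable X. Proof. exact: measurable_itv. Qed.

Definition le_ind (x y : R) : R := (x <= y)%R%:R.

Lemma measurable_le_ind d (Z : measurableType d) (f g : Z -> R) :
  measurable_fun [set: Z] f -> measurable_fun [set: Z] g ->
  measurable_fun [set: Z] (fun z => le_ind (f z) (g z)).
Proof.
move=> mf mg; rewrite (_ : (fun _ => _) = \1_[set z | f z <= g z]).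
  apply: measurable_indic.
  have := measurable_fun_ler mf mg => /(_ measurableT [set true]).
  rewrite setTI; apply; exact.
apply/funext => z; rewrite indicE /le_ind; congr ((nat_of_bool _)%:R).
by apply/idP/idP; rewrite inE.
Qed.

Lemma integral_le_ind (y : R) : 0 <= y ->
  (\int[lebesgue R]_(x in `]0%R, +oo[) (le_ind x y)%:E = y%:E)%E.
Proof.
move=> y0; rewrite (_ : (fun _ => _) = fun x => (\1_(`]-oo, y]%classic) x)%:E); last first.
  apply/funext => x; rewrite indicE /le_ind; congr ((nat_of_bool _)%:R%:E).
  by apply/idP/idP; rewrite inE/= in_itv/=.
rewrite integral_indic//.
rewrite (_ : _ `&` _ = `]0, y]%classic); last first.
  by rewrite predeqE => x /=; rewrite !in_itv/= andbT; split => [[-> ->]|/andP[-> ->]].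
transitivity (lebesgue R `]0, y]%classic) => //.
rewrite lebesgue_measure_itv/= lte_fin; case: ltP => h; first by rewrite oppr0 adde0.
by congr EFin; apply/eqP; rewrite eq_le y0 h.
Qed.

Lemma le_ind_integrable (y : R) : 0 <= y ->
  (lebesgue R).-integrable X (fun x => (le_ind x y)%:E).
Proof.
move=> y0; apply/integrableP; split.
  by apply/measurable_EFinP; apply: measurable_funTS; apply: measurable_le_ind.
under eq_integral => x _ do rewrite gee0_abs ?lee_fin ?ler0n//.
by rewrite integral_le_ind// ltry.
Qed.

Lemma integral_le_indB (p u : R) : 0 <= p -> 0 <= u ->
  (\int[lebesgue R]_(x in `]0%R, +oo[) (le_ind x p - le_ind x u)%:E = (p - u)%:E)%E.
Proof.
move=> p0 u0; under eq_integral do rewrite EFinB.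
rewrite (integralB mX (le_ind_integrable p0) (le_ind_integrable u0)).
by rewrite !integral_le_ind// EFinB.
Qed.

(** The indicators are nested, so their difference has constant sign and lives between p and u. This
    identity is what turns the subtracted indicator into the factor |l^(-gamma) - U| in the Fubini
    bound. *)
Lemma integral_abs_le_indB (p u : R) : 0 <= p -> 0 <= u ->
  (\int[lebesgue R]_(x in `]0%R, +oo[) `|(le_ind x p - le_ind x u)%:E| = `|(p - u)%:E|)%E.
Proof.
move=> p0 u0; wlog up : p u p0 u0 / u <= p.
  move=> H; have [|pu] := leP u p; first exact: H.
  rewrite [RHS](_ : _ = `|(u - p)%:E|%E); last by rewrite /= distrC.
  rewrite -H ?(ltW pu)//.
  by apply: eq_integral => x _; rewrite /= distrC.
rewrite [RHS]gee0_abs ?lee_fin ?subr_ge0// -integral_le_indB//.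
apply: eq_integral => x _; rewrite gee0_abs// lee_fin subr_ge0 /le_ind.
by have [xu|xu] := leP x u; rewrite ?ler0n// (le_trans xu up).
Qed.

Lemma cvg_powRN_y (p : R) : 0 < p -> x `^ (- p) @[x --> +oo] --> (0 : R).
Proof.
move=> p0; apply/cvgr0Pnorm_le => e e0.
near=> x.
have x0 : 0 < x by near: x; exact: nbhs_pinfty_gt.
rewrite ger0_norm ?powR_ge0// powRN.
rewrite -[e]invrK lef_pV2 ?posrE ?powR_gt0 ?invr_gt0//.
have hx : (e^-1) `^ p^-1 <= x by near: x; exact: nbhs_pinfty_ge.
have ep : 0 <= e^-1 by rewrite invr_ge0 ltW.
rewrite -[X in X <= _](powRr1 ep) -(mulVf (lt0r_neq0 p0)) powRrM.
by apply: ge0_ler_powR => //; rewrite ?nnegrE ?powR_ge0// ltW.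
Unshelve. all: by end_near. Qed.

(** The split is at y = l^(-gamma), where both entries of the minimum agree. The parts contribute
    l^(1 - gamma) and gamma / (1 - gamma) times l^(1 - gamma). *)
Lemma integral_min_powR (l : R) : 0 < l ->
  (\int[lebesgue R]_(x in `]0%R, +oo[) (Num.min l (x `^ (- gamma^-1)))%:E =
   (l `^ (1 - gamma) / (1 - gamma))%:E)%E.
Proof.
move=> l0; have /andP[g0 g1] := gamma01.
have gn0 : gamma != 0 by rewrite gt_eqF.
have g1n0 : 1 - gamma != 0 by rewrite subr_eq0 gt_eqF.
pose y := l `^ (- gamma); have y0 : 0 < y by exact: powR_gt0.
have yl : y `^ (- gamma^-1) = l.
  by rewrite /y -powRrM mulrNN mulfV// powRr1// ltW.
have hmin x : 0 < x -> x <= y -> Num.min l (x `^ (- gamma^-1)) = l.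
  move=> x0 xy; apply: min_l; rewrite -[X in X <= _]yl !powRN.
  rewrite lef_pV2 ?posrE ?powR_gt0//.
  by apply: ge0_ler_powR; rewrite ?nnegrE ?invr_ge0// ltW.
have hmin' x : y <= x -> Num.min l (x `^ (- gamma^-1)) = x `^ (- gamma^-1).
  move=> xy; have x0 := lt_le_trans y0 xy; apply: min_r; rewrite -[X in _ <= X]yl !powRN.
  rewrite lef_pV2 ?posrE ?powR_gt0//.
  by apply: ge0_ler_powR; rewrite ?nnegrE ?invr_ge0// ltW.
have mpow (S : set mR) (p : R) : measurable_fun S (fun x : R => x `^ p).
  by apply: measurable_funTS; exact: measurable_powR.
have mmin (S : set mR) : measurable_fun S (fun x : R => (Num.min l (x `^ (- gamma^-1)))%:E).
  by apply/measurable_EFinP; apply: measurable_minr.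
have -> : `]0, +oo[%classic = `]0, y] `|` `]y, +oo[ :> set mR.
  rewrite predeqE => x; rewrite /= !in_itv/= !andbT; split.
    by move=> x0; have [xy|xy] := leP x y; [left; rewrite x0|right].
  by move=> [/andP[]//|/(lt_trans y0)].
rewrite integral_setU//=; last first.
  apply/disj_setPS => x [] /=; rewrite !in_itv/= andbT => /andP[_ xy] /(le_lt_trans xy).
  by rewrite ltxx.
have -> : (\int[lebesgue R]_(x in `]0%R, y]) (Num.min l (x `^ (- gamma^-1)))%:E = (l * y)%:E)%E.
  rewrite (eq_integral (cst l%:E)); last first.
    by move=> x; rewrite inE/= in_itv/= => /andP[x0 xy]; rewrite hmin.
  rewrite integral_cst// EFinM; congr (_ * _)%E.
  transitivity (lebesgue R `]0, y]%classic) => //.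
  by rewrite lebesgue_measure_itv/= lte_fin y0 oppr0 adde0.
(* Here -1/c = 1 - 1/gamma is the exponent of the primitive of x^(-1/gamma). It is negative since
   gamma < 1, so [F] vanishes at infinity. *)
pose c := gamma / (1 - gamma).
pose F x : R := - c * x `^ (- c^-1).
have c0 : 0 < c by rewrite divr_gt0// subr_gt0.
have cE : - c^-1 - 1 = - gamma^-1 by rewrite /c; field; rewrite gn0 g1n0.
have -> : (\int[lebesgue R]_(x in `]y, +oo[) (Num.min l (x `^ (- gamma^-1)))%:E = (0 - F y)%:E)%E.
  rewrite (eq_integral (fun x : mR => (x `^ (- gamma^-1))%:E)); last first.
    by move=> x; rewrite inE/= in_itv/= andbT => /ltW xy; rewrite hmin'.
  rewrite integral_itv_obnd_cbnd; last by apply/measurable_EFinP; exact: mpow.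
  have dF (x : R) : 0 < x -> is_derive x 1 F (x `^ (- gamma^-1)).
    move=> x0; have := is_deriveZ (- c) (is_derive1_powR (- c^-1) x0).
    move=> h; apply: is_derive_eq; rewrite /GRing.scale/= cE mulrA mulrNN mulfV ?mul1r//.
    by rewrite gt_eqF.
  have cpow (x p : R) : 0 < x -> {for x, continuous (fun z : R => z `^ p)}.
    move=> x0; apply/differentiable_continuous/derivable1_diffP.
    by have [] := is_derive1_powR p x0.
  rewrite EFinB.
  apply: (@ge0_continuous_FTC2y _ (fun x => x `^ (- gamma^-1)) F y 0).
  - by move=> x _; exact: powR_ge0.
  - apply/continuous_within_itvcyP; split.
      by move=> x; rewrite in_itv/= andbT => yx; apply: cpow; exact: lt_trans yx.
    by apply: cvg_at_right_filter; exact: cpow.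
  - rewrite -[X in _ --> X](mulr0 (- c)); apply: cvgM; first exact: cvg_cst.
    by apply: cvg_powRN_y; rewrite invr_gt0.
  - by move=> x yx; have [] := dF x (lt_trans y0 yx).
  - apply: cvg_at_right_filter; apply: cvgM; first exact: cvg_cst.
    exact: cpow.
  - move=> x; rewrite in_itv/= andbT => yx; rewrite derive1E.
    by have [_ ->] := dF x (lt_trans y0 yx).
rewrite -EFinD; congr EFin; rewrite /F sub0r mulNr opprK.
have -> : y `^ (- c^-1) = l `^ (1 - gamma).
  by rewrite /y -powRrM; congr (_ `^ _); rewrite /c; field; rewrite gn0 g1n0.
have -> : l * y = l `^ (1 - gamma).
  rewrite /y -[X in X * _](powRr1 (ltW l0)) -powRD//.
  by apply/implyP => _; rewrite gt_eqF.
by rewrite /c; field.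
Qed.

End layer_cake.

(** * The chain rule for the energy *)

Section chain_rule.
Context {R : realType} (alpha gamma rho T : R).
Notation mR := (measurableTypeR R).
Variable nu : R.-sfker mR ~> mR.
Hypothesis alpha01 : 0 <= alpha <= 1.
Hypothesis gamma01 : 0 < gamma < 1.
Hypothesis T0 : 0 < T.
Hypothesis Mnu : forall t, in_M rho (nu t).
Hypothesis cnu : forall phi : R -> R, Cc_pos phi ->
  continuous (fun t => \int[nu t]_(l in `]0, +oo[) phi l : R).

Let D : set mR := `]0%R, +oo[%classic.
Let mD : measurable D. Proof. exact: measurable_itv. Qed.
Let DP l : l \in D -> 0 < l.
Proof. by rewrite inE /D /= in_itv/= andbT. Qed.

Let A : set mR := `]0%R, T[%classic.
Let mA : measurable A. Proof. exact: measurable_itv. Qed.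

(* l^(1 - gamma) / (1 - gamma) is the integral over x > 0 of min(l, ray x), and
   l <= ray x if and only if x <= l^(- gamma). *)
Let ray (x : R) := x `^ (- gamma^-1).

Let mray : measurable_fun [set: mR] ray.
Proof. exact: measurable_powR. Qed.

Let ray_gt0 x : 0 < x -> 0 < ray x.
Proof. exact: powR_gt0. Qed.

Let ray_lt x l : 0 < x -> 0 < l -> (ray x < l) = (l `^ (- gamma) < x).
Proof.
move=> x0 l0; have /andP[g0 _] := gamma01.
have h (y z p : R) : 0 < y -> 0 < z -> 0 < p -> (y `^ p < z `^ p) = (y < z).
  move=> y0 z0 p0; apply/idP/idP; last first.
    by move=> yz; apply: gt0_ltr_powR; rewrite ?nnegrE// ltW.
  by apply: contraTT; rewrite -!leNgt => zy; apply: ge0_ler_powR; rewrite ?nnegrE// ltW.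
have gn0 : gamma != 0 by rewrite gt_eqF.
rewrite -(h _ _ _ (ray_gt0 x0) l0 g0) /ray -powRrM mulNr mulVf// (powRN x) (powRN l) (powRr1 (ltW x0)).
by rewrite -[in LHS](invrK (l `^ gamma)) ltf_pV2// posrE ?invr_gt0 ?powR_gt0.
Qed.

Let mmin x : measurable_fun [set: mR] (fun l : R => Num.min l (ray x)).
Proof. by apply: measurable_minr. Qed.

Let min_le x l : 0 < x -> 0 < l -> `|Num.min l (ray x)| <= 1 * l.
Proof.
move=> x0 l0; rewrite mul1r ger0_norm ?ge_min ?lexx//.
by rewrite le_min (ltW l0) ltW// ray_gt0.
Qed.

Let cap s x : R := \int[nu s]_(l in `]0, +oo[) Num.min l (ray x).

Let capE s x : 0 < x ->
  (\int[nu s]_(l in `]0%R, +oo[) (Num.min l (ray x))%:E = (cap s x)%:E)%E.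
Proof.
move=> x0; rewrite /cap /Rintegral fineK//; apply: integrable_fin_num => //.
by apply: (in_M_integrable Mnu s (mmin x) (C := 1)) => l; exact: min_le.
Qed.

Let int_cap s : (\int[lebesgue R]_(x in `]0%R, +oo[) (cap s x)%:E =
  ((1 - gamma)^-1)%:E * moment (1 - gamma) (nu s))%E.
Proof.
have /andP[_ g1] := gamma01.
(* The absolute value makes [f] nonnegative on the whole plane, as [tonelli_on] requires; it has no
   effect for x, l > 0. *)
pose f (p : mR * mR) : \bar R := `|Num.min p.2 (ray p.1)|%:E.
have mf : measurable_fun [set: mR * mR] f.
  apply/measurable_EFinP; apply: measurableT_comp => //; apply: measurable_minr => //.
  exact: (measurableT_comp mray).
have f0 z : (0 <= f z)%E by rewrite lee_fin.
have fE x l : 0 < x -> 0 < l -> f (x, l) = (Num.min l (ray x))%:E.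
  move=> x0 l0; rewrite /f /= ger0_norm// le_min (ltW l0) ltW// ray_gt0//.
transitivity (\int[lebesgue R]_(x in D) \int[nu s]_(l in D) f (x, l))%E.
  apply: eq_integral => x /DP x0.
  rewrite -capE//; apply: eq_integral => l /DP l0.
  by rewrite fE.
rewrite (tonelli_on (sigma_finiteT (lebesgue R)) (in_M_sigma_finite (Mnu s)) mD mD mf f0).
rewrite /moment -ge0_integralZl//.
- apply: eq_integral => l /DP l0.
  rewrite -EFinM mulrC -integral_min_powR//; apply: eq_integral => x.
  by move=> /DP x0; rewrite fE.
- by apply/measurable_EFinP; apply: measurable_funTS; exact: measurable_powR.
- by move=> l _; rewrite lee_fin powR_ge0.
- by rewrite lee_fin invr_ge0 subr_ge0 ltW.
Qed.

Variable w : R -> R -> R.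
Hypothesis mw : measurable_fun [set: mR * mR] (fun p => w p.1 p.2).
Hypothesis Aw : (\int[lebesgue R]_(t in `[0%R, T]) action alpha (nu t) (w t) < +oo)%E.
Hypothesis CEw : forall phi : R * R -> R, test_function T phi ->
    (\int[lebesgue R]_(t in `]0%R, T[) \int[nu t]_(l in `]0%R, +oo[)
       (partial_t phi (t, l) + l `^ alpha * w t l * partial_l phi (t, l))%:E
     = 0)%E.
Hypothesis cotw : {ae lebesgue R, forall t, t \in `[0, T] -> cotangent alpha (nu t) (w t)}.
Variable U : R -> R.
Hypothesis mU : measurable_fun [set: mR] U.
Hypothesis U0 : forall t, 0 <= U t.

(** [U] will be u / q. At fixed t the second indicator does not depend on l, so the cotangent
    condition lets it be inserted for any value of [U]. *)
Let k (x t l : R) : R := le_ind x (l `^ (- gamma)) - le_ind x (U t).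
Let H (x t : R) : \bar R :=
  (\int[nu t]_(l in `]0%R, +oo[) (l `^ alpha * w t l * k x t l)%:E)%E.

Let min_max (l a : R) : Num.min l a = l - Num.max (l - a) 0.
Proof.
have [la|al] := leP l a.
  by rewrite max_r ?subr_le0// subr0.
by rewrite max_l ?subr_ge0 ?(ltW al)// opprB addrC subrK.
Qed.

Let cap_max s x : 0 < x ->
  cap s x = rho - \int[nu s]_(l in `]0, +oo[) Num.max (l - ray x) 0.
Proof.
move=> x0; apply: EFin_inj; rewrite -capE// EFinB.
have mmax : measurable_fun [set: mR] (fun l : R => Num.max (l - ray x) 0).
  by apply: measurable_maxr => //; exact: measurable_funB.
have imax : (nu s).-integrable D (EFin \o (fun l : R => Num.max (l - ray x) 0)).
  apply: (in_M_integrable Mnu s mmax (C := 1)) => l l0; rewrite mul1r.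
  rewrite ger0_norm ?le_max ?lexx ?orbT// ge_max (ltW l0) andbT.
  by rewrite gerBl ltW// ray_gt0.
have iid : (nu s).-integrable D (EFin \o (fun l : R => l)).
  apply: (in_M_integrable Mnu s (f := fun l : R => l) (C := 1)); first exact: measurable_id.
  by move=> l l0; rewrite mul1r gtr0_norm.
have [_ Mrho] := Mnu s.
rewrite /Rintegral fineK; last by apply: integrable_fin_num.
rewrite -Mrho -(integralB mD iid imax).
by apply: eq_integral => l _; rewrite -EFinB min_max.
Qed.

Let measurable_flux3' : measurable_fun [set: (mR * mR) * mR]
  (fun q => (q.2 `^ alpha * w q.1.2 q.2 * k q.1.1 q.1.2 q.2)%:E).
Proof.
have m1 : measurable_fun [set: (mR * mR) * mR] (fun q => q.1.1).
  by apply: measurableT_comp => //; exact: measurable_fst.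
have m2 : measurable_fun [set: (mR * mR) * mR] (fun q => q.1.2).
  by apply: measurableT_comp => //; exact: measurable_fst.
apply/measurable_EFinP; apply: measurable_funM.
  apply: measurable_funM.
    by apply: (@measurableT_comp _ _ _ _ _ _ (@powR R ^~ alpha)) => //; exact: measurable_powR.
  apply: (measurableT_comp (f := fun p : mR * mR => w p.1 p.2) (g := fun q : (mR * mR) * mR => (q.1.2, q.2))) => //.
  exact: measurable_fun_pair.
apply: measurable_funB; apply: measurable_le_ind => //.
  by apply: (@measurableT_comp _ _ _ _ _ _ (@powR R ^~ (- gamma))) => //; exact: measurable_powR.
exact: (measurableT_comp mU m2).
Qed.

Let measurable_flux3 x : measurable_fun [set: mR * mR]
  (fun p => (p.2 `^ alpha * w p.1 p.2 * k x p.1 p.2)%:E).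
Proof.
apply: (measurableT_comp measurable_flux3' (g := fun p : mR * mR => ((x, p.1), p.2))).
by apply: measurable_fun_pair => //; apply: measurable_fun_pair.
Qed.

(** As min(l, a) = l - (l - a)^+, the ray flux enters with a minus sign. In terms of x this is -
    1_(l > ray x) = 1_(x <= l^(-gamma)) - 1, and since \int l^alpha w dnu_t = 0 the last 1 can be
    exchanged for 1_(x <= U t), which produces [k]. *)
Let capB x : 0 < x ->
  ((cap T x - cap 0 x)%:E = \int[lebesgue R]_(t in `]0%R, T[) H x t)%E.
Proof.
move=> x0; have a0 := ray_gt0 x0.
have mrf : measurable_fun [set: mR * mR]
    (fun p => (p.2 `^ alpha * w p.1 p.2 * (ray x < p.2)%R%:R)%:E).
  by apply/measurable_EFinP; exact: (measurable_flux alpha mw (measurable_ray (ray x))).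
have lty := flux_ray_lty alpha01 T0 Mnu mw Aw a0 mA (@subset_itv_oo_cc _ _ _ _).
have [iH iHt] := iter_integrable mA mD mrf lty.
have := ray_flux alpha01 T0 Mnu cnu mw Aw CEw a0.
move=> rf; transitivity (- (\int[nu T]_(l in `]0, +oo[) Num.max (l - ray x) 0 -
    \int[nu 0]_(l in `]0, +oo[) Num.max (l - ray x) 0)%:E)%E.
  by rewrite !cap_max// -EFinN; congr EFin; ring.
rewrite -rf -mulN1e -(integralZl mA iH).
apply: ae_eq_integral => //.
- apply: measurable_funTS; apply: emeasurable_funM => //.
  exact: (measurable_fun_kernel nu mD mrf).
- apply: measurable_funTS; apply: (measurable_fun_kernel nu mD
    (f := fun p => (p.2 `^ alpha * w p.1 p.2 * k x p.1 p.2)%:E)).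
  exact: measurable_flux3.
have cotA := cotw.
have Fae := ae_filter_ringOfSetsType (lebesgue R).
apply: (@filterS _ _ Fae _ _ _ (@filterI _ _ Fae _ _ iHt cotw)) => t [iht cott] At.
have {}iht := iht At.
have [icot cot0] : cotangent alpha (nu t) (w t).
  by apply: cott; move: At; rewrite /A /= !in_itv/= => /andP[/ltW -> /ltW ->].
rewrite mulN1e; apply/esym; rewrite /H.
transitivity (\int[nu t]_(l in D) ((1 - le_ind x (U t))%:E * (l `^ alpha * w t l)%:E -
    (l `^ alpha * w t l * (ray x < l)%R%:R)%:E))%E.
  apply: eq_integral => l /DP l0.
  rewrite -EFinM -EFinB ray_lt// /k {1}/le_ind ltNge; case: (x <= _) => /=; congr EFin; ring.
rewrite (integralB mD (integrableZl mD _ icot) iht) (integralZl mD icot).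
by rewrite (_ : integral _ _ _ = 0%E) ?mule0 ?sub0e.
Qed.

Hypothesis flux_lty :
  (\int[lebesgue R]_(t in `]0%R, T[) \int[nu t]_(l in `]0%R, +oo[)
     `|(l `^ alpha * w t l * (l `^ (- gamma) - U t))%:E| < +oo)%E.

Let mflux (t : mR) : measurable_fun [set: mR * mR]
  (fun p => (p.2 `^ alpha * w t p.2 * k p.1 t p.2)%:E).
Proof.
apply: (measurableT_comp (f := fun q : (mR * mR) * mR =>
  (q.2 `^ alpha * w q.1.2 q.2 * k q.1.1 q.1.2 q.2)%:E)
  (g := fun p : mR * mR => ((p.1, t), p.2))) => //.
by apply: measurable_fun_pair => //; apply: measurable_fun_pair.
Qed.

(** Fubini is applied twice: to x and t, where |H| is bounded by the inner integral of |f3|, and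
    then to x and l at almost every fixed t. Integrating |k| over x gives |l^(-gamma) - U t|, so
    [flux_lty] supplies both hypotheses. *)
Let H_swap : (\int[lebesgue R]_(x in D) \int[lebesgue R]_(t in A) H x t =
  \int[lebesgue R]_(t in A) \int[nu t]_(l in D) (l `^ alpha * w t l * (l `^ (- gamma) - U t))%:E)%E.
Proof.
have sleb := sigma_finiteT (lebesgue R).
have snu t := in_M_sigma_finite (Mnu t).
pose f3 (q : (mR * mR) * mR) := (q.2 `^ alpha * w q.1.2 q.2 * k q.1.1 q.1.2 q.2)%:E.
have mf3 : measurable_fun [set: (mR * mR) * mR] f3 by exact: measurable_flux3'.
(* The kernel is pulled back to pairs (x, t), which makes [H] jointly measurable. *)
have [K KE] : exists K : R.-sfker (mR * mR)%type ~> mR, K = (fun p => nu p.2) :> (_ -> Rmeasure R).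
  apply: (@in_M_sfkernel _ _ _ rho) => // V mV.
  exact: (measurableT_comp (measurable_kernel nu V mV)).
have mH : measurable_fun [set: mR * mR] (fun p => H p.1 p.2).
  have := measurable_fun_kernel K mD mf3.
  congr measurable_fun; apply/funext => -[x t] /=; rewrite KE.
  by [].
have mfl : measurable_fun [set: mR * mR] (fun p => (p.2 `^ alpha * w p.1 p.2 * (p.2 `^ (- gamma) - U p.1))%:E).
  apply/measurable_EFinP; apply: measurable_funM.
    apply: measurable_funM => //.
    by apply: (@measurableT_comp _ _ _ _ _ _ (@powR R ^~ alpha)) => //; exact: measurable_powR.
  apply: measurable_funB; last exact: (measurableT_comp mU).
  by apply: (@measurableT_comp _ _ _ _ _ _ (@powR R ^~ (- gamma))) => //; exact: measurable_powR.
have absE t l : D l -> (\int[lebesgue R]_(x in D) `|f3 ((x, t), l)| =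
    `|(l `^ alpha * w t l * (l `^ (- gamma) - U t))%:E|)%E.
  move=> _; rewrite [in RHS]EFinM abseM -(integral_abs_le_indB (powR_ge0 _ _) (U0 t)).
  rewrite -ge0_integralZl//.
  - by apply: eq_integral => x _; rewrite /f3 /= normrM.
  - by apply: measurableT_comp => //; apply/measurable_EFinP; apply: measurable_funTS; apply: measurable_funB; exact: measurable_le_ind.
have swapt t : (\int[lebesgue R]_(x in D) \int[nu t]_(l in D) `|f3 ((x, t), l)| =
    \int[nu t]_(l in D) `|(l `^ alpha * w t l * (l `^ (- gamma) - U t))%:E|)%E.
  rewrite (tonelli_on sleb (snu t) mD mD (f := fun p => `|f3 ((p.1, t), p.2)|%E)) => //.
  - by apply: eq_integral => l; rewrite inE => Dl; rewrite -absE.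
  - by apply: measurableT_comp => //; exact: (mflux t).
have mG : measurable_fun [set: mR] (fun t => \int[nu t]_(l in D)
    `|(l `^ alpha * w t l * (l `^ (- gamma) - U t))%:E|)%E.
  apply: (measurable_fun_kernel nu mD (f := fun p =>
    `|(p.2 `^ alpha * w p.1 p.2 * (p.2 `^ (- gamma) - U p.1))%:E|%E)).
  exact: measurableT_comp.
have mabsH : measurable_fun [set: mR * mR] (fun p => `|H p.1 p.2|%E) by exact: measurableT_comp.
have H_lty : (\int[lebesgue R]_(t in A) \int[lebesgue R]_(x in D) `|H x t| < +oo)%E.
  apply: le_lt_trans flux_lty; apply: ge0_le_integral => //.
  - by move=> t _; exact: integral_ge0.
  - exact: measurable_funTS (measurable_integral_on sleb mD mabsH).
  - exact: measurable_funTS.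
  - move=> t _; rewrite -swapt; apply: ge0_le_integral => //.
    + exact: measurable_funTS (measurableT_comp mabsH (measurable_pair2 t)).
    + apply: measurable_funTS.
      have h := measurable_fun_kernel K mD (measurableT_comp (@abse_measurable R setT) mf3).
      have := measurableT_comp h (measurable_pair2 t).
      by congr measurable_fun; apply/funext => x /=; rewrite KE.
    + move=> x _; apply: le_abse_integral => //.
      have h := measurable_fun_section (D := D) t (measurable_flux3 x).
      exact: h.
rewrite (fubini_on sleb sleb mD mA mH H_lty).
apply: ae_eq_integral => //.
- exact: measurable_funTS (measurable_integral_on sleb mD mH).
- exact: measurable_funTS (measurable_fun_kernel nu mD mfl).
have [_ ifl] := iter_integrable mA mD mfl flux_lty.
apply: filterS ifl => t + At => /(_ At)/integrableP[_ ltyt].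
transitivity (\int[lebesgue R]_(x in D) \int[nu t]_(l in D) f3 ((x, t), l))%E => //.
rewrite (fubini_on sleb (snu t) mD mD (f := fun p => f3 ((p.1, t), p.2)) (mflux t)).
  apply: eq_integral => l _; rewrite EFinM -(integral_le_indB (powR_ge0 _ _) (U0 t)).
  rewrite -integralZl//.
  have := integrableB mD (le_ind_integrable (powR_ge0 l (- gamma))) (le_ind_integrable (U0 t)).
  by congr (_.-integrable _ _).
apply: le_lt_trans ltyt; rewrite le_eqVlt; apply/orP; left; apply/eqP.
by apply: eq_integral => l; rewrite inE => Dl; rewrite -absE.
Qed.

(** Integration of [capB] over x > 0: the left side becomes the moments by [int_cap], the right side
    is [H_swap]. Finite moments allow the integral of the difference to be split. *)
Lemma chain_rule :
  (moment (1 - gamma) (nu 0%R) < +oo)%E -> (moment (1 - gamma) (nu T) < +oo)%E ->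
  (((1 - gamma)^-1)%:E * moment (1 - gamma) (nu T) -
   ((1 - gamma)^-1)%:E * moment (1 - gamma) (nu 0%R) =
   \int[lebesgue R]_(t in `]0%R, T[) \int[nu t]_(l in `]0%R, +oo[)
     (l `^ alpha * w t l * (l `^ (- gamma) - U t))%:E)%E.
Proof.
have /andP[_ g1] := gamma01.
move=> m0 mT; rewrite -[RHS]H_swap -!int_cap.
have icap s : (moment (1 - gamma) (nu s) < +oo)%E ->
    (lebesgue R).-integrable D (fun x => (cap s x)%:E).
  move=> ms; apply/integrableP; split.
    (* A constant kernel, used to obtain measurability of [cap s] in x. *)
    have [K KE] : exists K : R.-sfker mR ~> mR, K = (fun=> nu s) :> (_ -> Rmeasure R).
      apply: (@in_M_sfkernel _ _ _ rho) => // V mV; exact: measurable_cst.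
    have mf : measurable_fun [set: mR * mR] (fun p => (Num.min p.2 (ray p.1))%:E).
      apply/measurable_EFinP; apply: measurable_minr => //.
      exact: (measurableT_comp mray).
    have := measurable_funTS (D := D) (measurable_fun_kernel K mD mf).
    apply: eq_measurable_fun => x /DP x0 /=.
    by rewrite KE -capE.
  rewrite (_ : integral _ _ _ = \int[lebesgue R]_(x in D) (cap s x)%:E)%E.
    rewrite int_cap lte_mul_pinfty// lee_fin invr_ge0 subr_ge0; exact: ltW.
  apply: eq_integral => x /DP x0; rewrite gee0_abs// -capE//.
  apply: integral_ge0 => l; rewrite -[X in X -> _]/(D l) => /mem_set/DP l0.
  by rewrite lee_fin le_min (ltW l0) ltW// ray_gt0.
rewrite -(integralB mD (icap T mT) (icap 0 m0)).
by apply: eq_integral => x /DP x0; rewrite -EFinB capB.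
Qed.

End chain_rule.

(** * Almost everywhere equality without measurability *)

Section ae_eq_integral_nonmeasurable.
Local Open Scope ereal_scope.
Context d (X : measurableType d) (R : realType) (mu : {measure set X -> \bar R}).

Import HBNNSimple.

(** The integral is a supremum over simple functions. One that lies below f lies below g after being
    set to 0 on a null set, with the same integral. This permits replacing w by v inside integrals
    whose measurability in t has not been established. *)
Lemma ae_le_nnintegral (f g : X -> \bar R) :
  (forall x, 0 <= f x) -> (forall x, 0 <= g x) ->
  {ae mu, forall x, f x <= g x} -> \int[mu]_x f x <= \int[mu]_x g x.
Proof.
move=> f0 g0 [N [mN N0 fgN]].
rewrite [leLHS]ge0_integralE// [leRHS]ge0_integralE// !patch_setT.
apply: ge_ereal_sup => _ [h hf <-].
pose h1 := proj_nnsfun h (measurableC mN).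
have h1E x : h1 x = (h x * \1_(~` N) x)%R by [].
have -> : sintegral mu h = sintegral mu h1.
  rewrite -!integralT_nnsfun; apply: ae_eq_integral => //.
  - exact/measurable_EFinP.
  - exact/measurable_EFinP.
  - exists N; split => // x; apply: contra_notP => xN _.
    by rewrite h1E indicE mem_set ?mulr1.
apply: ereal_sup_ubound; exists h1 => // x.
have [xN|xN] := pselect (N x).
  by rewrite h1E indicE memNset ?mulr0//=; apply.
have fg : f x <= g x by apply: contrapT => h0; apply: xN; exact: fgN.
rewrite h1E indicE mem_set// mulr1; apply: le_trans fg; exact: hf.
Qed.

Lemma ae_eq_integral_nomeas (D : set X) (f g : X -> \bar R) :
  {ae mu, forall x, D x -> f x = g x} ->
  \int[mu]_(x in D) f x = \int[mu]_(x in D) g x.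
Proof.
move=> fg; rewrite [LHS]integral_mkcond [RHS]integral_mkcond [LHS]integralE [RHS]integralE.
have Fae := ae_filter_ringOfSetsType mu.
have {}fg : {ae mu, forall x, (f \_ D) x = (g \_ D) x}.
  apply: (@filterS _ _ Fae _ _ _ fg) => x h; rewrite !patchE.
  by case: ifPn => // /set_mem.
by congr (_ - _); apply/eqP; rewrite eq_le; apply/andP; split;
  apply: ae_le_nnintegral => // ; apply: (@filterS _ _ Fae _ _ _ fg) => x h;
  rewrite ?funeposE ?funenegE h.
Qed.

End ae_eq_integral_nonmeasurable.

(** * Finite dissipation controls the moments in u(t) *)

Section moments.
Context {R : realType} (alpha gamma q rho : R).
Hypothesis alpha01 : 0 <= alpha <= 1.
Hypothesis gamma01 : 0 < gamma < 1.
Hypothesis q0 : 0 < q.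
Notation mR := (measurableTypeR R).
Variable nu : Rmeasure R.
Hypothesis Mnu : in_M rho nu.

(** Put y = q l^(-gamma) and c = |u| + 1; the number d solves q d^(-gamma) = c. If y <= c then l >=
    d, and l^alpha is bounded by a multiple of l. If y > c then |u - y| >= 1 and y <= c |u - y|, so
    the dissipation density dominates. *)
Lemma powR_le_dissipation (u : R) : exists C c : R, [/\ 0 <= C, 0 <= c &
  forall l, 0 < l ->
    l `^ alpha <= C * l + c * (l `^ alpha * `|u - q * l `^ (- gamma)| ^+ 2) /\
    q * l `^ (alpha - gamma) <= C * l + c * (l `^ alpha * `|u - q * l `^ (- gamma)| ^+ 2)].
Proof.
have /andP[g0 g1] := gamma01.
pose c : R := `|u| + 1.
have c1 : 1 <= c by rewrite lerDr.
have c0 : 0 < c by exact: lt_le_trans ltr01 c1.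
pose d : R := (q / c) `^ gamma^-1.
have d0 : 0 < d by rewrite powR_gt0// divr_gt0.
pose C : R := c * (d^-1 + 1).
have C0 : 0 <= C by rewrite mulr_ge0 ?(ltW c0)// addr_ge0// invr_ge0 ltW.
exists C, c; split; [exact: C0|exact: ltW|] => l l0.
have lp : 0 < l `^ alpha by exact: powR_gt0.
rewrite powRD; last by apply/implyP => _; rewrite gt_eqF.
rewrite [q * (_ * _)]mulrCA; set y := q * l `^ (- gamma).
have y0 : 0 < y by rewrite mulr_gt0// powR_gt0.
have [yc|cy] := leP y c.
  have dl : d <= l.
    rewrite leNgt; apply/negP => ld.
    have : l `^ gamma < d `^ gamma by apply: gt0_ltr_powR; rewrite ?nnegrE// ltW.
    rewrite /d -powRrM mulVf ?gt_eqF// powRr1 ?divr_ge0 ?(ltW q0) ?(ltW c0)// => h.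
    move: yc; rewrite /y powRN leNgt; apply/negP/negPn.
    by rewrite ltr_pdivlMr ?powR_gt0// mulrC -ltr_pdivlMr.
  have h1 : l `^ alpha <= (d^-1 + 1) * l.
    apply: (le_trans (powR_le1D l0 alpha01)); rewrite mulrDl mul1r lerD2r.
    by rewrite ler_pdivlMl// mulr1.
  have dl0 : 0 <= (d^-1 + 1) * l := le_trans (ltW lp) h1.
  have r0 : 0 <= c * (l `^ alpha * `|u - y| ^+ 2).
    by rewrite !mulr_ge0 ?sqr_ge0 ?(ltW c0) ?(ltW lp).
  have h2 : c * ((d^-1 + 1) * l) = C * l by rewrite mulrA.
  split; apply: ler_wpDr => //; rewrite -h2.
    by apply: (le_trans h1); rewrite ler_peMl.
  by rewrite mulrC; apply: ler_pM => //; exact: ltW.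
have z1 : 1 <= y - `|u| by rewrite lerBrDl ltW.
have zy : y - `|u| <= `|u - y|.
  by rewrite distrC; apply: le_trans (lerB_dist _ _); rewrite lerB// ler_norm.
have z1' : 1 <= `|u - y| := le_trans z1 zy.
have z2 : `|u - y| <= `|u - y| ^+ 2 by rewrite expr2 ler_peMr.
have Cl : 0 <= C * l by rewrite mulr_ge0// ltW.
have yz : y <= c * `|u - y|.
  apply: (@le_trans _ _ (c * (y - `|u|))); last by rewrite ler_wpM2l// ltW.
  have -> : c * (y - `|u|) = y + `|u| * (y - c) by rewrite /c; ring.
  by rewrite lerDl mulr_ge0// subr_ge0 ltW.
have z20 : 1 <= `|u - y| ^+ 2 := le_trans z1' z2.
have lz : l `^ alpha <= c * (l `^ alpha * `|u - y| ^+ 2).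
  apply: (@le_trans _ _ (l `^ alpha * `|u - y| ^+ 2)); first by rewrite ler_peMr// ltW.
  by rewrite ler_peMl// mulr_ge0 ?sqr_ge0// ltW.
split; apply: ler_wpDl => //.
rewrite [c * (_ * _)]mulrCA ler_wpM2l ?(ltW lp)//; apply: (le_trans yz).
by rewrite ler_wpM2l// ltW.
Qed.

Let D : set mR := `]0%R, +oo[%classic.
Let mD : measurable D. Proof. exact: measurable_itv. Qed.
Let DP l : D l -> 0 < l. Proof. by rewrite /D /= in_itv/= andbT. Qed.

Let mpow p : measurable_fun [set: mR] (fun l : R => l `^ p).
Proof. exact: measurable_powR. Qed.

Lemma moments_lty (u : R) :
  (\int[nu]_(l in `]0%R, +oo[) (l `^ alpha * `|u - q * l `^ (- gamma)| ^+ 2)%:E < +oo)%E ->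
  (moment alpha nu < +oo)%E /\ (moment (alpha - gamma) nu < +oo)%E.
Proof.
move=> ulty; have [C [c [C0 c0 bnd]]] := powR_le_dissipation u.
pose d (l : mR) : \bar R := (l `^ alpha * `|u - q * l `^ (- gamma)| ^+ 2)%:E.
have md : measurable_fun D d.
  apply/measurable_EFinP; apply: measurable_funTS; apply: measurable_funM => //.
  apply: measurable_funX; apply: measurableT_comp => //; apply: measurable_funB => //.
  exact: measurable_funM.
have mC : measurable_fun D (fun l : mR => (C * l)%:E).
  by apply/measurable_EFinP; apply: measurable_funTS; exact: measurable_funM.
have mid : measurable_fun D (fun l : mR => l%:E) by apply/measurable_EFinP.
have d0 l : (0 <= d l)%E by rewrite lee_fin mulr_ge0 ?powR_ge0// sqr_ge0.
have Blty : (\int[nu]_(l in D) ((C * l)%:E + c%:E * d l) < +oo)%E.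
  rewrite ge0_integralD//.
  - under [X in (X + _)%E]eq_integral do rewrite EFinM.
    rewrite ge0_integralZl//; last by move=> l /DP /ltW; rewrite lee_fin.
    have [_ ->] := Mnu; rewrite ge0_integralZl//.
    by rewrite lte_add_pinfty ?ltry// lte_mul_pinfty.
  - by move=> l /DP l0; rewrite lee_fin mulr_ge0// ltW.
  - by move=> l _; rewrite mule_ge0.
  - exact: emeasurable_funM.
have mB : measurable_fun D (fun l => (C * l)%:E + c%:E * d l)%E.
  by apply: emeasurable_funD => //; exact: emeasurable_funM.
split.
  apply: le_lt_trans Blty; apply: ge0_le_integral => //.
  - by move=> l _; rewrite lee_fin powR_ge0.
  - by apply/measurable_EFinP; exact: measurable_funTS.
  - by move=> l /DP l0; rewrite -EFinM -EFinD lee_fin; have [] := bnd l l0.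
have : (\int[nu]_(l in D) (q%:E * (l `^ (alpha - gamma))%:E) < +oo)%E.
  apply: le_lt_trans Blty; apply: ge0_le_integral => //.
  - by move=> l _; rewrite mule_ge0 ?lee_fin ?powR_ge0// ltW.
  - by apply: emeasurable_funM => //; apply/measurable_EFinP; exact: measurable_funTS.
  - by move=> l /DP l0; rewrite -!EFinM -EFinD lee_fin; have [] := bnd l l0.
rewrite ge0_integralZl//; last 3 first.
- by apply/measurable_EFinP; exact: measurable_funTS.
- by move=> l _; rewrite lee_fin powR_ge0.
- by rewrite lee_fin ltW.
rewrite -/(moment (alpha - gamma) nu); case: (moment (alpha - gamma) nu) => [r| |]//.
  by move=> _; exact: ltry.
by rewrite gt0_muley ?lte_fin.
Qed.

Lemma mean_field_ge0 : 0 <= mean_field alpha gamma q nu.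
Proof.
by rewrite /mean_field divr_ge0 ?mulr_ge0 ?fine_ge0 ?(ltW q0)//;
  apply: integral_ge0 => l _; rewrite lee_fin powR_ge0.
Qed.

Lemma velocity_integrable :
  (moment alpha nu < +oo)%E -> (moment (alpha - gamma) nu < +oo)%E ->
  nu.-integrable D (fun l => (l `^ alpha * (mean_field alpha gamma q nu - q * l `^ (- gamma)))%:E).
Proof.
move=> m1 m2.
have imom p : (moment p nu < +oo)%E -> nu.-integrable D (fun l => (l `^ p)%:E).
  move=> mp; apply/integrableP; split.
    by apply/measurable_EFinP; exact: measurable_funTS.
  by under eq_integral do rewrite gee0_abs ?lee_fin ?powR_ge0//.
have i1 := integrableZl mD (mean_field alpha gamma q nu) (imom _ m1).
have i2 := integrableZl mD q (imom _ m2).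
apply: eq_integrable (integrableB mD i1 i2) => // l; rewrite inE => /DP l0.
rewrite -!EFinM -EFinB powRD; last by apply/implyP => _; rewrite gt_eqF.
by congr EFin; ring.
Qed.

End moments.

(** * The energy balance and the equality case *)

Section energy_balance.
Context {R : realType} (alpha gamma q rho T : R).
Notation mR := (measurableTypeR R).
Variable nu : R.-sfker mR ~> mR.
Hypothesis alpha01 : 0 <= alpha <= 1.
Hypothesis gamma01 : 0 < gamma < 1.
Hypothesis q0 : 0 < q.
Hypothesis T0 : 0 < T.
Hypothesis Mnu : forall t, in_M rho (nu t).
Hypothesis cnu : forall phi : R -> R, Cc_pos phi ->
  continuous (fun t => \int[nu t]_(l in `]0, +oo[) phi l : R).
Variable w : R -> R -> R.
Hypothesis mw : measurable_fun [set: mR * mR] (fun p => w p.1 p.2).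
Hypothesis CEw : continuity_equation alpha T nu w.
Hypothesis cotw : {ae lebesgue R, forall t, t \in `[0, T] -> cotangent alpha (nu t) (w t)}.
Hypothesis Aw : (\int[lebesgue R]_(t in `[0%R, T]) action alpha (nu t) (w t) < +oo)%E.
Hypothesis E0 : (energy gamma q (nu 0%R) < +oo)%E.
Hypothesis ET : (energy gamma q (nu T) < +oo)%E.

Let D : set mR := `]0%R, +oo[%classic.
Let mD : measurable D. Proof. exact: measurable_itv. Qed.
Let DP l : D l -> 0 < l. Proof. by rewrite /D /= in_itv/= andbT. Qed.

Let A : set mR := `]0%R, T[%classic.
Let mA : measurable A. Proof. exact: measurable_itv. Qed.

Let u t := mean_field alpha gamma q (nu t).
Let v t l := u t - q * l `^ (- gamma).

Let mu_ : measurable_fun [set: mR] u.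
Proof.
have mm p : measurable_fun [set: mR] (fun t => fine (moment p (nu t))).
  apply: measurableT_comp; first exact: fine_measurable.
  apply: (measurable_fun_kernel nu mD (f := fun z => (z.2 `^ p)%:E)).
  apply/measurable_EFinP; apply: (@measurableT_comp _ _ _ _ _ _ (@powR R ^~ p)) => //.
(* The inverse is rewritten as the power -1, a measurable function; the two agree on nonnegative
   reals, with value 0 at 0. *)
rewrite (_ : u = fun t => q * fine (moment (alpha - gamma) (nu t)) *
    fine (moment alpha (nu t)) `^ (-1)); last first.
  apply/funext => t; rewrite powR_inv1// fine_ge0//.
  by apply: integral_ge0 => l _; rewrite lee_fin powR_ge0.
apply: measurable_funM; first exact: measurable_funM.
by apply: (@measurableT_comp _ _ _ _ _ _ (@powR R ^~ (-1))) => //.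
Qed.

Let mv : measurable_fun [set: mR * mR] (fun p => v p.1 p.2).
Proof.
apply: measurable_funB; first exact: measurableT_comp.
apply: measurable_funM => //.
by apply: (@measurableT_comp _ _ _ _ _ _ (@powR R ^~ (- gamma))) => //.
Qed.

(** [a], [d], [e] and [f] are the densities of action, dissipation, velocity mismatch and energy
    flux. As v = - q (l^(-gamma) - u / q), they satisfy e = a + d + 2 q f pointwise. *)
Let a (p : mR * mR) : \bar R := (p.2 `^ alpha * `|w p.1 p.2| ^+ 2)%:E.
Let d (p : mR * mR) : \bar R := (p.2 `^ alpha * `|v p.1 p.2| ^+ 2)%:E.
Let e (p : mR * mR) : \bar R := (p.2 `^ alpha * `|w p.1 p.2 - v p.1 p.2| ^+ 2)%:E.
Let f (p : mR * mR) : \bar R :=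
  (p.2 `^ alpha * w p.1 p.2 * (p.2 `^ (- gamma) - u p.1 / q))%:E.

Let ma : measurable_fun [set: mR * mR] a. Proof. exact: measurable_action. Qed.
Let md : measurable_fun [set: mR * mR] d. Proof. exact: (measurable_action alpha mv). Qed.
Let me : measurable_fun [set: mR * mR] e.
Proof.
by apply: (measurable_action alpha (w := fun t l => w t l - v t l)); exact: measurable_funB.
Qed.
Let mf : measurable_fun [set: mR * mR] f.
Proof.
apply/measurable_EFinP; apply: measurable_funM.
  apply: measurable_funM => //.
  by apply: (@measurableT_comp _ _ _ _ _ _ (@powR R ^~ alpha)) => //.
apply: measurable_funB.
  by apply: (@measurableT_comp _ _ _ _ _ _ (@powR R ^~ (- gamma))) => //.
by apply: measurable_funM => //; exact: (measurableT_comp mu_).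
Qed.

Let a0 p : (0 <= a p)%E. Proof. by rewrite lee_fin mulr_ge0 ?powR_ge0 ?sqr_ge0. Qed.
Let d0 p : (0 <= d p)%E. Proof. by rewrite lee_fin mulr_ge0 ?powR_ge0 ?sqr_ge0. Qed.
Let e0 p : (0 <= e p)%E. Proof. by rewrite lee_fin mulr_ge0 ?powR_ge0 ?sqr_ge0. Qed.

Let mint g : measurable_fun [set: mR * mR] g ->
  measurable_fun A (fun t => \int[nu t]_(l in D) g (t, l))%E.
Proof. by move=> mg; apply: measurable_funTS; exact: measurable_fun_kernel. Qed.

(** [J] integrates over [0, T] and the equation over (0, T); the endpoints are Lebesgue-null. *)
Let int_closed (g : mR * mR -> \bar R) : measurable_fun [set: mR * mR] g ->
  (\int[lebesgue R]_(t in `[0%R, T]) \int[nu t]_(l in D) g (t, l) =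
   \int[lebesgue R]_(t in A) \int[nu t]_(l in D) g (t, l))%E.
Proof.
move=> mg; have mh := measurable_fun_kernel nu mD mg.
rewrite -integral_itv_bndo_bndc; last exact: measurable_funTS.
by rewrite -integral_itv_obnd_cbnd//; exact: measurable_funTS.
Qed.

Let intA : (\int[lebesgue R]_(t in `[0%R, T]) action alpha (nu t) (w t) =
   \int[lebesgue R]_(t in A) \int[nu t]_(l in D) a (t, l))%E.
Proof. exact: int_closed. Qed.

Let intD : (\int[lebesgue R]_(t in `[0%R, T]) dissipation alpha gamma q (nu t) =
   \int[lebesgue R]_(t in A) \int[nu t]_(l in D) d (t, l))%E.
Proof. exact: int_closed. Qed.

Let Alty : (\int[lebesgue R]_(t in A) \int[nu t]_(l in D) a (t, l) < +oo)%E.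
Proof. by have := Aw; rewrite intA. Qed.

Let abs_lty g : (forall p, 0 <= g p)%E ->
  (\int[lebesgue R]_(t in A) \int[nu t]_(l in D) g (t, l) < +oo)%E ->
  (\int[lebesgue R]_(t in A) \int[nu t]_(l in D) `|g (t, l)| < +oo)%E.
Proof.
move=> g0; apply: le_lt_trans; rewrite le_eqVlt; apply/orP; left; apply/eqP.
by apply: eq_integral => t _; apply: eq_integral => l _; rewrite gee0_abs.
Qed.

Let moment_fin s : (energy gamma q (nu s) < +oo)%E ->
  exists m : R, moment (1 - gamma) (nu s) = m%:E.
Proof.
have /andP[_ g1] := gamma01.
have c0 : 0 < q / (1 - gamma) by rewrite divr_gt0// subr_gt0.
have : (0 <= moment (1 - gamma) (nu s))%E.
  by apply: integral_ge0 => l _; rewrite lee_fin powR_ge0.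
rewrite /energy -/(moment _ _); case: (moment _ _) => [r| |]//; first by exists r.
by rewrite gt0_muley ?lte_fin.
Qed.

(** Since f = - l^alpha w v / q, this is |w v| <= w^2 + v^2. *)
Let abs_f_le t l : D l -> (`|f (t, l)| <= (q^-1)%:E * a (t, l) + (q^-1)%:E * d (t, l))%E.
Proof.
move=> /DP l0; rewrite /f /a /d/= -!EFinM -EFinD lee_fin.
have -> : l `^ (- gamma) - u t / q = - (q^-1 * v t l).
  by rewrite /v; field; rewrite gt_eqF.
rewrite mulrN normrN mulrCA -mulrDr normrM (ger0_norm (x := q^-1)) ?invr_ge0 ?(ltW q0)//.
rewrite ler_wpM2l ?invr_ge0 ?(ltW q0)// -mulrDr -mulrA normrM ger0_norm ?powR_ge0//.
rewrite ler_wpM2l ?powR_ge0// normrM.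
have := sqr_ge0 (`|w t l| - `|v t l|); have := sqr_ge0 (`|w t l|); have := sqr_ge0 (`|v t l|).
move: `|w t l| `|v t l| => x y; nra.
Qed.

Let f_lty : (\int[lebesgue R]_(t in A) \int[nu t]_(l in D) d (t, l) < +oo)%E ->
  (\int[lebesgue R]_(t in A) \int[nu t]_(l in D) `|f (t, l)| < +oo)%E.
Proof.
move=> Dlty.
have q0' : 0 <= q^-1 by rewrite invr_ge0 ltW.
pose g p := ((q^-1)%:E * a p + (q^-1)%:E * d p)%E.
have mg : measurable_fun [set: mR * mR] g.
  by apply: emeasurable_funD; exact: emeasurable_funM.
apply: (@le_lt_trans _ _ (\int[lebesgue R]_(t in A) \int[nu t]_(l in D) g (t, l))%E).
  apply: (le_iter_integral nu _ mA mD (f := abse \o f)) => //.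
    exact: measurableT_comp.
  by move=> t l _ Dl; rewrite abse_ge0/=; exact: abs_f_le.
have intg t : (\int[nu t]_(l in D) g (t, l) = (q^-1)%:E * \int[nu t]_(l in D) a (t, l) +
    (q^-1)%:E * \int[nu t]_(l in D) d (t, l))%E.
  have msa := measurable_fun_section (D := D) t ma.
  have msd := measurable_fun_section (D := D) t md.
  rewrite ge0_integralD//; last 4 first.
  - by move=> l _; rewrite mule_ge0.
  - exact: emeasurable_funM.
  - by move=> l _; rewrite mule_ge0.
  - exact: emeasurable_funM.
  by rewrite !ge0_integralZl.
under eq_integral do rewrite intg.
have i0 g' : (forall p, 0 <= g' p)%E -> forall t, A t -> (0 <= \int[nu t]_(l in D) g' (t, l))%E.
  by move=> h t _; exact: integral_ge0.
have mia := mint ma; have mid := mint md.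
rewrite ge0_integralD//; last 4 first.
- by move=> t At; rewrite mule_ge0// i0.
- exact: emeasurable_funM.
- by move=> t At; rewrite mule_ge0// i0.
- exact: emeasurable_funM.
rewrite !ge0_integralZl//; try exact: i0.
by apply: lte_add_pinfty; apply: lte_mul_pinfty.
Qed.

(** By the chain rule with U = u / q, the energy difference is q times the integral of f, so J is
    half the integral of a + d + 2 q f. Every term is finite, so the final computation takes place
    in R. *)
Let balance : (\int[lebesgue R]_(t in A) \int[nu t]_(l in D) d (t, l) < +oo)%E ->
  J alpha gamma q T nu w =
    (2^-1%:E * \int[lebesgue R]_(t in A) \int[nu t]_(l in D) e (t, l))%E.
Proof.
move=> Dlty; have flty := f_lty Dlty.
have [mT mTE] := moment_fin ET; have [m0 m0E] := moment_fin E0.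
have U0 t : 0 <= u t / q by rewrite divr_ge0 ?(ltW q0)//; exact: mean_field_ge0.
have mU : measurable_fun [set: mR] (fun t => u t / q) by exact: measurable_funM.
have := chain_rule alpha01 gamma01 T0 Mnu cnu mw Aw CEw.2 cotw mU U0 flty.
rewrite mTE m0E => /(_ (ltry _) (ltry _)) ch.
pose g p := ((2 * q)%:E * f p)%E.
have mg : measurable_fun [set: mR * mR] g by exact: emeasurable_funM.
have [glty intg] := iter_integralZl mA mD (2 * q) mf flty.
pose h p := (a p + d p)%E.
have mh : measurable_fun [set: mR * mR] h by exact: emeasurable_funD.
have alty := abs_lty a0 Alty; have dlty := abs_lty d0 Dlty.
have inth := iter_integralD mA mD ma md alty dlty.
have h0 p : (0 <= h p)%E by exact: adde_ge0.
have hlty : (\int[lebesgue R]_(t in A) \int[nu t]_(l in D) `|h (t, l)| < +oo)%E.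
  apply: abs_lty h0 _.
  by apply: le_lt_trans (lte_add_pinfty Alty Dlty); rewrite inth.
have inte := iter_integralD mA mD mh mg hlty glty.
have -> : (\int[lebesgue R]_(t in A) \int[nu t]_(l in D) e (t, l) =
   \int[lebesgue R]_(t in A) \int[nu t]_(l in D) (h (t, l) + g (t, l)))%E.
  apply: eq_integral => t _; apply: eq_integral => l _.
  rewrite /e /h /g /a /d /f /= -!EFinM -!EFinD; congr EFin.
  rewrite !real_normK ?num_real// /v.
  by field; rewrite gt_eqF.
rewrite inte inth intg -ch /J intA intD /energy -!/(moment _ _) mTE m0E.
have ia0 : (0 <= \int[lebesgue R]_(t in A) \int[nu t]_(l in D) a (t, l))%E.
  by apply: integral_ge0 => t _; exact: integral_ge0.
have id0 : (0 <= \int[lebesgue R]_(t in A) \int[nu t]_(l in D) d (t, l))%E.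
  by apply: integral_ge0 => t _; exact: integral_ge0.
move: Alty ia0; case: (\int[lebesgue R]_(t in A) _)%E => // ra _ _.
move: Dlty id0; case: (\int[lebesgue R]_(t in A) _)%E => // rd _ _.
rewrite -!EFinM -!EFinB -!EFinD; congr EFin.
have /andP[_ g1] := gamma01.
by field; rewrite gt_eqF// subr_gt0.
Qed.

Let ae_at_moments : (\int[lebesgue R]_(t in `[0%R, T]) dissipation alpha gamma q (nu t) < +oo)%E ->
  {ae lebesgue R, forall t, t \in `[0, T] ->
     (moment alpha (nu t) < +oo)%E /\ (moment (alpha - gamma) (nu t) < +oo)%E}.
Proof.
move=> Dlty.
have mdis := measurable_fun_kernel nu mD md.
have mI : measurable (`[0, T]%classic : set mR) by exact: measurable_itv.
have idis : (lebesgue R).-integrable `[0, T] (fun t => dissipation alpha gamma q (nu t)).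
  apply/integrableP; split; first exact: measurable_funTS.
  apply: le_lt_trans Dlty; rewrite le_eqVlt; apply/orP; left; apply/eqP.
  by apply: eq_integral => t _; rewrite gee0_abs//; apply: integral_ge0 => l _; exact: (d0 (t, l)).
have := integrable_ae mI idis.
have Fae := ae_filter_ringOfSetsType (lebesgue R).
apply: (@filterS _ _ Fae) => t h tI.
(* A priori the mean field could be a default value of [fine]. The moment bound holds for every real
   u, so finite dissipation rules this out. *)
apply: (moments_lty alpha01 gamma01 q0 (Mnu t) (u := mean_field alpha gamma q (nu t))).
by rewrite ltey_eq; apply/orP; left; apply: h.
Qed.

Let int_e_eq0 : (\int[lebesgue R]_(t in A) \int[nu t]_(l in D) e (t, l) = 0)%E <->
  {ae lebesgue R, forall t, A t -> {ae nu t, forall l, D l -> w t l = v t l}}.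
Proof.
have Fae := ae_filter_ringOfSetsType (lebesgue R).
split=> [h|h]; last first.
  transitivity (\int[lebesgue R]_(t in A) (cst 0%E : mR -> \bar R) t)%E; last exact: integral0.
  apply: ae_eq_integral_nomeas; apply: (@filterS _ _ Fae _ _ _ h) => t + At => /(_ At) wv.
  transitivity (\int[nu t]_(l in D) (cst 0%E : mR -> \bar R) l)%E; last exact: integral0.
  apply: ae_eq_integral_nomeas.
  have Ft := ae_filter_ringOfSetsType (nu t).
  apply: (@filterS _ _ Ft _ _ _ wv) => l + Dl => /(_ Dl) wvl.
  by rewrite /e /= wvl subrr normr0 expr0n mulr0.
have h' : (\int[lebesgue R]_(t in A) `|\int[nu t]_(l in D) e (t, l)| = 0)%E.
  rewrite -[RHS]h; apply: eq_integral => t _; rewrite gee0_abs//; exact: integral_ge0.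
have := (ae_eq_integral_abs (lebesgue R) mA (mint me)).1 h'.
apply: (@filterS _ _ Fae) => t + At => /(_ At) h2.
have h2' : (\int[nu t]_(l in D) `|e (t, l)| = 0)%E.
  by rewrite -[RHS]h2; apply: eq_integral => l _; rewrite gee0_abs.
have := (ae_eq_integral_abs (nu t) mD (measurable_fun_section t me)).1 h2'.
have Ft := ae_filter_ringOfSetsType (nu t).
apply: (@filterS _ _ Ft) => l + Dl => /(_ Dl) eE; have /eqP := EFin_inj eE.
rewrite mulf_eq0 gt_eqF ?powR_gt0 ?DP//= sqrf_eq0 normr_eq0 subr_eq0.
by move/eqP.
Qed.

(** For a solution of the LSW equation, finiteness of the dissipation is not given in advance; it is
    inherited from the action once w = v. *)
Let int_d_eq : {ae lebesgue R, forall t, A t -> {ae nu t, forall l, D l -> w t l = v t l}} ->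
  (\int[lebesgue R]_(t in A) \int[nu t]_(l in D) d (t, l) =
   \int[lebesgue R]_(t in A) \int[nu t]_(l in D) a (t, l))%E.
Proof.
have Fae := ae_filter_ringOfSetsType (lebesgue R).
move=> h; apply: ae_eq_integral_nomeas; apply: (@filterS _ _ Fae _ _ _ h) => t + At => /(_ At) wv.
apply: ae_eq_integral_nomeas.
have Ft := ae_filter_ringOfSetsType (nu t).
by apply: (@filterS _ _ Ft _ _ _ wv) => l + Dl => /(_ Dl) wvl; rewrite /a /d /= wvl.
Qed.

(** At almost every t, l^alpha v is integrable by the moment clause of [LSW_solution], and l^alpha w
    by the cotangent condition, as [velocity_unique] requires. *)
Let velocity_eq : LSW_solution alpha gamma q T nu ->
  {ae lebesgue R, forall t, A t -> {ae nu t, forall l, D l -> w t l = v t l}}.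
Proof.
move=> [mom cev].
have Fae := ae_filter_ringOfSetsType (lebesgue R).
have AI t : t \in `]0, T[ -> t \in `[0, T] by exact: subset_itv_oo_cc.
have iv : {ae lebesgue R, forall t, t \in `]0, T[ ->
    (nu t).-integrable D (fun l => (l `^ alpha * v t l)%:E)}.
  apply: (@filterS _ _ Fae _ _ _ mom) => t + /AI tI => /(_ tI)[m1 m2].
  exact: velocity_integrable.
have iw : {ae lebesgue R, forall t, t \in `]0, T[ ->
    (nu t).-integrable D (fun l => (l `^ alpha * w t l)%:E)}.
  by apply: (@filterS _ _ Fae _ _ _ cotw) => t + /AI tI => /(_ tI)[].
exact: (velocity_unique Mnu cnu mv mw cev CEw iv iw).
Qed.

Let LSW_of_velocity_eq :
  {ae lebesgue R, forall t, A t -> {ae nu t, forall l, D l -> w t l = v t l}} ->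
  continuity_equation alpha T nu v.
Proof.
move=> wv; have [ce1 ce2] := CEw.
have Fae := ae_filter_ringOfSetsType (lebesgue R).
split=> [K cK KT|phi tphi].
  apply: le_lt_trans (ce1 _ cK KT); rewrite le_eqVlt; apply/orP; left; apply/eqP.
  apply: ae_eq_integral_nomeas; apply: (@filterS _ _ Fae _ _ _ wv) => t + At => /(_ At) wvt.
  apply: ae_eq_integral_nomeas.
  have Ft := ae_filter_ringOfSetsType (nu t).
  apply: (@filterS _ _ Ft _ _ _ wvt) => l wvl.
  by rewrite xsectionE => /KT[_ /wvl ->].
rewrite -[RHS](ce2 _ tphi).
apply: ae_eq_integral_nomeas; apply: (@filterS _ _ Fae _ _ _ wv) => t + At => /(_ At) wvt.
apply: ae_eq_integral_nomeas.
have Ft := ae_filter_ringOfSetsType (nu t).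
by apply: (@filterS _ _ Ft _ _ _ wvt) => l wvl /wvl ->.
Qed.

(** Both energies are finite and the action is nonnegative, so nothing offsets the infinite
    dissipation. *)
Let J_infinite : (\int[lebesgue R]_(t in A) \int[nu t]_(l in D) d (t, l) = +oo)%E ->
  J alpha gamma q T nu w = +oo%E.
Proof.
move=> Doo; have [mT mTE] := moment_fin ET; have [m0 m0E] := moment_fin E0.
rewrite /J intA intD /energy -!/(moment _ _) mTE m0E Doo.
have : (0 <= \int[lebesgue R]_(t in A) \int[nu t]_(l in D) a (t, l))%E.
  by apply: integral_ge0 => t _; exact: integral_ge0.
case: (\int[lebesgue R]_(t in A) _)%E => // [r|] _; by rewrite gt0_muley ?lte_fin.
Qed.

Lemma energy_dissipation_principle :
  (0 <= J alpha gamma q T nu w)%E /\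
  (J alpha gamma q T nu w = 0%E <-> LSW_solution alpha gamma q T nu).
Proof.
have finite_or_infinite : (\int[lebesgue R]_(t in A) \int[nu t]_(l in D) d (t, l) < +oo)%E \/
    J alpha gamma q T nu w = +oo%E.
  by case: ltP => h; [left|right; apply: J_infinite; apply/eqP; rewrite -leye_eq].
split.
  case: finite_or_infinite => [/balance ->|->//].
  by rewrite mule_ge0//; apply: integral_ge0 => t _; exact: integral_ge0.
split=> [J0|lsw].
  case: finite_or_infinite => [Dlty|]; last by rewrite J0.
  have wv : {ae lebesgue R, forall t, A t -> {ae nu t, forall l, D l -> w t l = v t l}}.
    apply/int_e_eq0; move: J0; rewrite balance// => /eqP.
    by rewrite mule_eq0 eqe invr_eq0 pnatr_eq0/= => /eqP.
  by split; [apply: ae_at_moments; rewrite intD|exact: LSW_of_velocity_eq].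
have wv := velocity_eq lsw.
rewrite balance; last by rewrite (int_d_eq wv).
by rewrite (int_e_eq0.2 wv) mule0.
Qed.

End energy_balance.

(** * Extension of the data beyond [0, T] and the conclusion *)

Lemma continuity_equation_ext (R : realType) (alpha T : R) (nu nu' : R -> Rmeasure R)
    (v v' : R -> R -> R) :
  (forall t, t \in `]0, T[ -> nu t = nu' t) ->
  (forall t l, t \in `]0, T[ -> 0 < l -> v t l = v' t l) ->
  continuity_equation alpha T nu v -> continuity_equation alpha T nu' v'.
Proof.
move=> nn vv [ce1 ce2]; split=> [K cK KT|phi tphi].
  apply: le_lt_trans (ce1 _ cK KT); rewrite le_eqVlt; apply/orP; left; apply/eqP.
  apply: eq_integral => t; rewrite inE/= => tT; rewrite -nn//.
  apply: eq_integral => l; rewrite inE xsectionE => /KT[/= _].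
  by rewrite in_itv/= andbT => l0; rewrite vv.
rewrite -[RHS](ce2 _ tphi).
apply: eq_integral => t; rewrite inE/= => tT; rewrite -nn//.
by apply: eq_integral => l; rewrite inE/= in_itv/= andbT => l0; rewrite vv.
Qed.

Lemma LSW_solution_ext (R : realType) (alpha gamma q T : R) (nu nu' : R -> Rmeasure R) :
  (forall t, t \in `[0, T] -> nu t = nu' t) ->
  LSW_solution alpha gamma q T nu -> LSW_solution alpha gamma q T nu'.
Proof.
move=> nn [mom ce]; split.
  have Fae := ae_filter_ringOfSetsType (lebesgue R).
  by apply: (@filterS _ _ Fae _ _ _ mom) => t + tI => /(_ tI); rewrite nn.
have nno t : t \in `]0, T[ -> nu t = nu' t by move=> tT; apply: nn; exact: subset_itv_oo_cc tT.
by apply: continuity_equation_ext ce => // t l tT _; rewrite nno.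
Qed.

Section clamped_time.
Context {R : realType} (T : R) (T0 : 0 < T).
Notation mR := (measurableTypeR R).

(** [nu] is constrained on [0, T] only. Freezing it outside at its end values keeps it in M and
    makes the weak* continuity global, as the kernel construction over R requires. *)
Definition clamp (t : R) : R := Num.max 0 (Num.min t T).

Lemma clamp_in t : clamp t \in `[0, T].
Proof. by rewrite in_itv/= le_max lexx/= ge_max (ltW T0) ge_min lexx orbT. Qed.

Lemma clamp_id t : t \in `[0, T] -> clamp t = t.
Proof. by rewrite in_itv/= => /andP[t0 tT]; rewrite /clamp min_l// max_r. Qed.

Lemma continuous_clamp : continuous clamp.
Proof.
move=> t; apply: (@continuous_max _ _ (fun=> 0) (fun t => Num.min t T)).
  exact: cvg_cst.
by apply: (@continuous_min _ _ id (fun=> T)); [exact: cvg_id|exact: cvg_cst].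
Qed.

Lemma within_continuous_clamp (g : R -> R) :
  {within `[0, T], continuous g} -> continuous (g \o clamp).
Proof.
move=> /subspace_continuousP gc t.
have := gc _ (clamp_in t); apply: cvg_trans => P /= h.
(* A neighbourhood in the subspace [0, T] restricts only the points of [0, T], and [clamp] takes all
   its values there. *)
have h2 : nbhs (clamp t) [set s | s \in `[0, T] -> P (g s)] := h.
have h3 : nbhs t [set s | clamp s \in `[0, T] -> P (g (clamp s))] := continuous_clamp h2.
by apply: (@filterS _ (nbhs t) _ _ _ _ h3) => s; apply; exact: clamp_in.
Qed.

End clamped_time.

Theorem proposition3p6 (R : realType) (alpha gamma q rho T : R)
    (halpha : 0 <= alpha < 1) (hgamma : 0 < gamma < 1) (hq : 0 < q)
    (hrho : 0 < rho) (hT : 0 < T) (hag : 1 - 3 * gamma <= alpha)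
    (nu : R -> Rmeasure R) (w : R -> R -> R)
    (hCE : CE alpha rho T nu w) (hfin : finite_action alpha gamma q T nu w) :
  (0 <= J alpha gamma q T nu w)%E /\
  (J alpha gamma q T nu w = 0%E <-> LSW_solution alpha gamma q T nu).
Proof.
have [Mnu cnu mw ce] := hCE; have [cot act sup] := hfin.
pose mR := measurableTypeR R.
have a01 : 0 <= alpha <= 1 by case/andP: halpha => -> /ltW.
pose nu' (t : mR) := nu (clamp T t).
have nn t : t \in `[0, T] -> nu t = nu' t by move=> tI; rewrite /nu' clamp_id.
have Mnu' t : in_M rho (nu' t) by apply: Mnu; exact: clamp_in.
have cnu' (phi : R -> R) : Cc_pos phi ->
    continuous (fun t => \int[nu' t]_(l in `]0, +oo[) phi l : R).
  by move=> /cnu/(within_continuous_clamp hT).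
have mnu' : forall U : set mR, measurable U -> measurable_fun [set: mR] (fun t => nu' t U).
  by apply: (measurable_fun_in_M Mnu') => a; exact: (weakstar_measurable_ray Mnu' cnu').
have [K KE] := in_M_sfkernel Mnu' mnu'.
pose S : set (mR * mR) := `[0, T] `*` `]0, +oo[.
have mS : measurable S by apply: measurableX; exact: measurable_itv.
(* Extension by zero makes the velocity measurable on the whole plane; all the integrals involved
   see it only on [S]. *)
pose w' t l := ((fun p : mR * mR => w p.1 p.2) \_ S) (t, l).
have ww t l : t \in `[0, T] -> 0 < l -> w t l = w' t l.
  by move=> tI l0; rewrite /w' patchE mem_set//; split => //=; rewrite in_itv/= l0.
have oc t : t \in `]0, T[ -> t \in `[0, T] by exact: subset_itv_oo_cc.
have mw' : measurable_fun [set: mR * mR] (fun p => w' p.1 p.2).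
  rewrite (_ : (fun p => _) = (fun p : mR * mR => w p.1 p.2) \_ S); last first.
    by apply/funext => -[].
  by apply/(measurable_restrictT _ _).1.
have Knu t : K t = nu' t by rewrite KE.
have KnuT t : t \in `[0, T] -> nu t = K t by move=> tI; rewrite Knu; exact: nn.
have ceK : continuity_equation alpha T K w'.
  by apply: continuity_equation_ext ce => [t /oc|t l /oc]; [exact: KnuT|exact: ww].
have actE t : t \in `[0, T] -> action alpha (nu t) (w t) = action alpha (K t) (w' t).
  move=> tI; rewrite KnuT//; apply: eq_integral => l; rewrite inE/= in_itv/= andbT => l0.
  by rewrite ww.
have cotK : {ae lebesgue R, forall t, t \in `[0, T] -> cotangent alpha (K t) (w' t)}.
  have Fae := ae_filter_ringOfSetsType (lebesgue R).
  apply: (@filterS _ _ Fae _ _ _ cot) => t + tI => /(_ tI)[it ot].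
  have fE l : l \in (`]0, +oo[%classic : set mR) -> (l `^ alpha * w t l)%:E = (l `^ alpha * w' t l)%:E.
    by rewrite inE/= in_itv/= andbT => l0; rewrite ww.
  split; first by apply: eq_integrable fE _ => //; rewrite -KnuT.
  by rewrite -[RHS]ot KnuT//; apply/esym; exact: eq_integral.
have actK : (\int[lebesgue R]_(t in `[0%R, T]) action alpha (nu t) (w t) =
    \int[lebesgue R]_(t in `[0%R, T]) action alpha (K t) (w' t))%E.
  by apply: eq_integral => t; rewrite inE/=; exact: actE.
have disK : (\int[lebesgue R]_(t in `[0%R, T]) dissipation alpha gamma q (nu t) =
    \int[lebesgue R]_(t in `[0%R, T]) dissipation alpha gamma q (K t))%E.
  by apply: eq_integral => t; rewrite inE/= => /KnuT ->.
have I0 : 0 \in `[0, T] by rewrite in_itv/= lexx ltW.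
have IT : T \in `[0, T] by rewrite in_itv/= lexx ltW.
have enK t : t \in `[0, T] -> (energy gamma q (K t) < +oo)%E.
  move=> tI; rewrite -KnuT//; apply: le_lt_trans sup.
  by apply: ereal_sup_ubound; exists t.
have MK t : in_M rho (K t) by rewrite Knu.
have cK (phi : R -> R) : Cc_pos phi ->
    continuous (fun t => \int[K t]_(l in `]0, +oo[) phi l : R).
  by move=> /cnu'; rewrite KE.
have aK : (\int[lebesgue R]_(t in `[0%R, T]) action alpha (K t) (w' t) < +oo)%E by rewrite -actK.
have [J0 Jeq] := energy_dissipation_principle a01 hgamma hq hT MK cK mw' ceK cotK aK (enK _ I0) (enK _ IT).
have JE : J alpha gamma q T nu w = J alpha gamma q T K w' by rewrite /J actK disK !KnuT.
rewrite JE; split => //; split => [/Jeq|h].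
  by apply: LSW_solution_ext => t /KnuT.
by apply/Jeq; apply: LSW_solution_ext h.
Qed.
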